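(* Let $\Lambda\subseteq\mathbb{R}$, let $\varphi(t)=e^{-\pi t^2}$, and for $\lambda\in\mathbb{R}$ let $$T_\lambda: L^2(\mathbb{R})\to L^2(\mathbb{R}),\quad T_\lambda f=\mathfrak{F}(\varphi(\cdot-\lambda)f).$$ Then the family $\{T_\lambda:\lambda\in\Lambda\}$ does phase retrieval if and only if $\Lambda$ is not contained in an arithmetic progression. In particular, for real numbers $\alpha<\beta<\gamma$, the system of three self-adjoint operators $\{T_\alpha\circ\mathfrak{F}^{-1},\ T_\beta\circ\mathfrak{F}^{-1},\ T_\gamma\circ\mathfrak{F}^{-1}\}$ does phase retrieval if and only if $\frac{\beta-\alpha}{\gamma-\beta}\notin\mathbb{Q}$.
   Context: An arithmetic progression is a set of the form $a\mathbb{Z}+b$ with $a,b\in\mathbb{R}$ (the choice $a=0$ is allowed). $\mathfrak{F}$ is the Fourier transform on $L^2(\mathbb{R})$ (complex-valued functions), i.e. the unitary extension of $\mathfrak{F}f(\xi)=\int_{\mathbb{R}}f(t)e^{-2\pi i\xi t}\,dt$, $f\in L^1(\mathbb{R})\cap L^2(\mathbb{R})$. Write $f\sim h$ if there is $\tau\in\mathbb{C}$, $|\tau|=1$, with $f=\tau h$ (equality almost everywhere). A family $\mathcal{T}$ of bounded linear operators on $L^2(\mathbb{R})$ does phase retrieval if for all $f,h\in L^2(\mathbb{R})$: $|Tf|=|Th|$ (almost everywhere) for all $T\in\mathcal{T}$ implies $f\sim h$. *)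

(* Defs.v *)
From mathcomp Require Import all_boot all_order all_algebra.
From mathcomp Require Export complex.
From mathcomp Require Export all_classical all_reals all_analysis.

Set Implicit Arguments.
Unset Strict Implicit.
Unset Printing Implicit Defensive.

Import Order.TTheory GRing.Theory Num.Theory.
Import numFieldNormedType.Exports.

Local Open Scope classical_set_scope.
Local Open Scope ring_scope.
Local Open Scope complex_scope.

(* Elements of L^2(R; C) are represented by functions R -> R[i], and equality
   in L^2 is equality almost everywhere. *)

Section ComplexLebesgue.
Context {R : realType}.
Local Notation mu := (@lebesgue_measure R).
Implicit Types (f g h : R -> R[i]) (p : \bar R).

Definition modulus (z : R[i]) : R := ComplexField.Normc.normc z.

Definition cmeasurable f : Prop :=
  measurable_fun [set: R] (fun t => complex.Re (f t)) /\
  measurable_fun [set: R] (fun t => complex.Im (f t)).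

Definition cLnorm p f : \bar R := Lnorm mu p (fun t => (modulus (f t))%:E).

Definition inL p f : Prop := cmeasurable f /\ (cLnorm p f < +oo)%E.

Definition cintegral f : R[i] :=
  Rintegral mu [set: R] (fun t => complex.Re (f t)) +i*
  Rintegral mu [set: R] (fun t => complex.Im (f t)).

Definition cinner f g : R[i] := cintegral (fun t => f t * conjc (g t)).

Definition equiv_phase f h : Prop :=
  exists tau : R[i], modulus tau = 1 /\ {ae mu, forall t, f t = tau * h t}.

End ComplexLebesgue.

Section Fourier.
Context {R : realType}.
Local Notation mu := (@lebesgue_measure R).
Implicit Types (f g : R -> R[i]).

Definition expi (x : R) : R[i] := cos x +i* sin x.

Definition fourier_integral f (xi : R) : R[i] :=
  cintegral (fun t => f t * expi (- (2 * pi * xi * t))).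

(* The graph of the closure of fourier_integral, restricted to the dense
   subspace L^1 `&` L^2 of L^2, with respect to the L^2 norm on both sides. *)
Definition is_fourier f g : Prop :=
  inL 2%:E g /\
  exists u : nat -> R -> R[i],
    [/\ forall n, inL 1%:E (u n) /\ inL 2%:E (u n),
        cLnorm 2%:E (fun t => u n t - f t) @[n --> \oo] --> 0%E
      & cLnorm 2%:E (fun xi => fourier_integral (u n) xi - g xi)
          @[n --> \oo] --> 0%E].

(* By Plancherel's theorem both sets below are, for f in L^2, exactly one
   class modulo almost everywhere equality; xget picks a representative. *)
Definition fourier f : R -> R[i] :=
  xget (cst 0) [set g | is_fourier f g].

Definition fourier_inv f : R -> R[i] :=
  xget (cst 0) [set g | inL 2%:E g /\ {ae mu, forall xi, fourier g xi = f xi}].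

End Fourier.

Section Operators.
Context {R : realType}.
Local Notation mu := (@lebesgue_measure R).
Local Notation operator := ((R -> R[i]) -> (R -> R[i])).

(* No compatibility with almost everywhere equality is required here, since
   linearity and boundedness imply it. *)
Definition bounded_operator (T : operator) : Prop :=
  [/\ forall f, inL 2%:E f -> inL 2%:E (T f),
      forall (c : R[i]) f g, inL 2%:E f -> inL 2%:E g ->
        {ae mu, forall x, T (fun t => c * f t + g t) x = c * T f x + T g x}
    & exists M : R, forall f, inL 2%:E f ->
        (cLnorm 2%:E (T f) <= M%:E * cLnorm 2%:E f)%E].

Definition self_adjoint (T : operator) : Prop :=
  bounded_operator T /\
  forall f g, inL 2%:E f -> inL 2%:E g -> cinner (T f) g = cinner f (T g).

Definition phase_retrieval (TT : set operator) : Prop :=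
  forall f h : R -> R[i], inL 2%:E f -> inL 2%:E h ->
    (forall T, TT T ->
      {ae mu, forall x, modulus (T f x) = modulus (T h x)}) ->
    equiv_phase f h.

Definition gaussian (t : R) : R := expR (- (pi * t ^+ 2)).

Definition gabor_op (lambda : R) : operator :=
  fun f => fourier (fun t => (gaussian (t - lambda))%:C * f t).

End Operators.

Definition arithmetic_progression {R : realType} (A : set R) : Prop :=
  exists a b : R, A = [set a * n%:~R + b | n in [set: int]].

(* Main.v *)
Require Import Defs.
From mathcomp Require Import all_boot all_order all_algebra.
From mathcomp Require Import all_classical all_reals all_analysis.
From mathcomp Require Import measurable_realfun.
From mathcomp Require Import ring lra.

Set Implicit Arguments.
Unset Strict Implicit.
Unset Printing Implicit Defensive.

Import Order.TTheory GRing.Theory Num.Theory.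
Import numFieldNormedType.Exports.
Import ComplexField ComplexField.Normc.
Local Open Scope classical_set_scope.
Local Open Scope complex_scope.
Local Open Scope ring_scope.

Local Notation re := complex.Re.
Local Notation im := complex.Im.

(* Let g = gaussian f and let F be its two-sided Laplace transform, an entire
   function.  Up to constants, the transform of the window of f at lambda is
   x |-> F (x + 2 pi lambda), and |T_lambda f|^2, read off on the imaginary axis,
   has the same Taylor coefficients, up to powers of i, as
   F (x + 2 pi lambda) conj (F (- x + 2 pi lambda)) on the real axis.  If h has the
   same phaseless data and H is its transform, then these products agree for F and
   H, so two values of lambda force F / H to be periodic with real period
   4 pi (lambda' - lambda).  The periods form a closed subgroup of R: unless Lambda
   lies in an arithmetic progression, it is R, and F / H is a unimodular constant.
   Conversely, on the progression aZ + b the functions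
   gaussian (t) (1 +- i exp (i pi (2 t - b) / a)) are exchanged, after windowing at
   lambda, by conjugation and t |-> lambda - t, which preserves the moduli of the
   Fourier transforms. *)

(** * Lebesgue integrals of real functions *)

(** Entire functions appear as complex functions of a real variable whose Taylor remainders decay
    geometrically on every interval, so no complex variable occurs: the values on the imaginary axis
    form a second function, with coefficients multiplied by powers of 'i, and conjugation acts on
    the coefficients. The obstacle to forming F / H is that both functions may have zeros. The
    quotient is never formed: a period d is encoded by F (y) H (y + d) = H (y) F (y + d), and
    factors are cancelled because power series form an integral domain. The constant 4 pi arises
    because the window at lambda shifts the Laplace variable by 2 pi lambda, so the data pair two
    points with sum 4 pi lambda. Returning from F = tau H to f requires an injective transform;
    injectivity is read off from Plancherel's theorem, which rests on Abel summation, the Poisson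
    kernel and continuity of translations in L^2. *)

Section lebesgue_kit.
Context {R : realType}.
Local Notation mu := (@lebesgue_measure R).
Implicit Types f g : R -> R.

Lemma ae_imp (P Q : R -> Prop) : (forall x, P x -> Q x) ->
  {ae mu, forall x, P x} -> {ae mu, forall x, Q x}.
Proof. by move=> PQ; apply: (@filterS _ _ (ae_filter_ringOfSetsType mu)). Qed.

Lemma ae_imp2 (P Q S : R -> Prop) : (forall x, P x -> Q x -> S x) ->
  {ae mu, forall x, P x} -> {ae mu, forall x, Q x} -> {ae mu, forall x, S x}.
Proof. by move=> PQ; apply: (@filterS2 _ _ (ae_filter_ringOfSetsType mu)). Qed.

Lemma ae_all (P : R -> Prop) : (forall x, P x) -> {ae mu, forall x, P x}.
Proof.
by move=> aP; apply: (@filterE _ _ (ae_filter_ringOfSetsType mu)).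
Qed.

Definition integrableR f := mu.-integrable [set: R] (EFin \o f).

Lemma integrableR_measurable f : integrableR f -> measurable_fun [set: R] f.
Proof. by move=> /measurable_int/measurable_EFinP. Qed.

Lemma integrableR_le f g : measurable_fun [set: R] f ->
  (forall x, `|f x| <= g x) -> integrableR g -> integrableR f.
Proof.
move=> mf fg; apply: le_integrable => //; first exact/measurable_EFinP.
move=> x _ /=; rewrite lee_fin; apply: le_trans (fg x) _; exact: ler_norm.
Qed.

Lemma integrableRD f g : integrableR f -> integrableR g ->
  integrableR (fun x => f x + g x).
Proof. by move=> hf hg; have := integrableD measurableT hf hg. Qed.

Lemma integrableRZ c f : integrableR f -> integrableR (fun x => c * f x).
Proof. by move=> hf; have := @integrableZl _ _ _ _ _ measurableT c _ hf. Qed.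

Lemma integrableRN f : integrableR f -> integrableR (fun x => - f x).
Proof.
move=> hf; have := integrableRZ (-1) hf.
by apply: eq_integrable => // x _ /=; rewrite mulN1r.
Qed.

Lemma integrableRB f g : integrableR f -> integrableR g ->
  integrableR (fun x => f x - g x).
Proof. by move=> hf hg; apply: integrableRD => //; exact: integrableRN. Qed.

Lemma integrableR_norm f : integrableR f -> integrableR (fun x => `|f x|).
Proof.
move=> hf; apply: (integrableR_le (g := fun x => `|f x|)).
- by apply: measurableT_comp => //; exact: integrableR_measurable.
- by move=> x; rewrite normr_id.
- exact: (integrable_norm hf).
Qed.

Lemma integrableR0 : integrableR (fun=> 0).
Proof. exact: integrable0. Qed.

Lemma integrableR_mul_bounded M f g : measurable_fun [set: R] f ->
  (forall x, `|f x| <= M) -> integrableR g -> integrableR (fun x => f x * g x).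
Proof.
move=> mf fM hg; have mg := integrableR_measurable hg.
apply: (integrableR_le (g := fun x => M * `|g x|)).
- exact: measurable_funM.
- by move=> x; rewrite normrM ler_wpM2r.
- by apply: integrableRZ; exact: integrableR_norm.
Qed.

Lemma RintD f g : integrableR f -> integrableR g ->
  \int[mu]_x (f x + g x) = \int[mu]_x f x + \int[mu]_x g x.
Proof. by move=> hf hg; rewrite RintegralD. Qed.

Lemma RintB f g : integrableR f -> integrableR g ->
  \int[mu]_x (f x - g x) = \int[mu]_x f x - \int[mu]_x g x.
Proof. by move=> hf hg; rewrite RintegralB. Qed.

Lemma RintZ c f : integrableR f -> \int[mu]_x (c * f x) = c * \int[mu]_x f x.
Proof. by move=> hf; rewrite RintegralZl. Qed.

Lemma RintN f : integrableR f -> \int[mu]_x (- f x) = - \int[mu]_x f x.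
Proof.
move=> hf; rewrite -mulN1r -RintZ//.
by apply: eq_Rintegral => x _; rewrite mulN1r.
Qed.

Lemma eq_Rint f g : f =1 g -> \int[mu]_x f x = \int[mu]_x g x.
Proof. by move=> fg; apply: eq_Rintegral => x _; exact: fg. Qed.

Lemma Rint0 : \int[mu]_x 0 = 0 :> R.
Proof. by rewrite /Rintegral lebesgue_integral_definition.integral0. Qed.

Lemma le_Rint f g : integrableR f -> integrableR g -> (forall x, f x <= g x) ->
  \int[mu]_x f x <= \int[mu]_x g x.
Proof. by move=> hf hg fg; apply: le_Rintegral => // x _; exact: fg. Qed.

Lemma ge0_Rint f : (forall x, 0 <= f x) -> 0 <= \int[mu]_x f x.
Proof. by move=> f0; apply: Rintegral_ge0. Qed.

Lemma norm_Rint f : integrableR f -> `|\int[mu]_x f x| <= \int[mu]_x `|f x|.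
Proof. by move=> hf; exact: le_normr_Rintegral. Qed.

Lemma RintE f : integrableR f ->
  (\int[mu]_x f x)%:E = (\int[mu]_x (f x)%:E)%E.
Proof.
by move=> hf; rewrite /Rintegral fineK//; exact: integrable_fin_num.
Qed.

Lemma integrableR_ge0P f : measurable_fun [set: R] f -> (forall x, 0 <= f x) ->
  integrableR f <-> (\int[mu]_x (f x)%:E < +oo)%E.
Proof.
move=> mf f0; have e : (\int[mu]_x `|(f x)%:E|)%E = (\int[mu]_x (f x)%:E)%E.
  by apply: eq_integral => x _; rewrite gee0_abs// lee_fin.
split=> [/integrableP[_]|h]; first by rewrite -e.
by apply/integrableP; split; [exact/measurable_EFinP|rewrite /= e].
Qed.

Lemma Rint_ae_eq f g : measurable_fun [set: R] f -> measurable_fun [set: R] g ->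
  {ae mu, forall x, f x = g x} -> \int[mu]_x f x = \int[mu]_x g x.
Proof.
move=> mf mg fg; congr fine.
apply: ae_eq_integral => //; try exact/measurable_EFinP.
by apply: ae_imp fg => x fgx _; rewrite fgx.
Qed.

Section affine.
Variables (a b : R).
Hypothesis a0 : a != 0.
Let phi (x : R) : measurableTypeR R := a * x + b.

Let mphi : measurable_fun [set: R] phi.
Proof. by apply: measurable_funD => //; exact: measurable_funM. Qed.

Let nu : {measure set (measurableTypeR R) -> \bar R} :=
  mscale (NngNum (normr_ge0 a)) (measure_function_pushforward__canonical__measure_function_Measure mu mphi).

(** Lebesgue measure is determined by its values on half-open intervals, and [phi] pulls ]c, d] back
    to an interval of length (d - c) / |a|. For a < 0 the ends are exchanged, so the preimage is
    closed on the left. *)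
Let mu_nu A : measurable A -> mu A = nu A.
Proof.
apply: lebesgue_measure_unique => _ [[c d] _ <-] /=.
rewrite /mscale/= /pushforward.
have [ap|an|/eqP] := ltgtP a 0; last by rewrite (negPf a0).
- have -> : phi @^-1` `]c, d] = `[(d - b) / a, (c - b) / a[%classic.
    apply/seteqP; split => x /=; rewrite !in_itv/= /phi.
      by rewrite ler_ndivrMr// ltr_ndivlMr// (mulrC x) lerBrDr ltrBlDr andbC.
    by rewrite ler_ndivrMr// ltr_ndivlMr// (mulrC x) lerBrDr ltrBlDr andbC.
  rewrite !lebesgue_measure_itv/= !lte_fin ltr_nM2r ?invr_lt0// ltrD2r.
  case: ifPn => cd; last by rewrite mule0.
  rewrite ltr0_norm// -!EFinB -EFinM; congr EFin; by field.
- have -> : phi @^-1` `]c, d] = `](c - b) / a, (d - b) / a]%classic.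
    apply/seteqP; split => x /=; rewrite !in_itv/= /phi.
      by rewrite ler_pdivlMr// ltr_pdivrMr// (mulrC x) lerBrDr ltrBlDr.
    by rewrite ler_pdivlMr// ltr_pdivrMr// (mulrC x) lerBrDr ltrBlDr.
  rewrite !lebesgue_measure_itv/= !lte_fin ltr_pM2r ?invr_gt0// ltrD2r.
  case: ifPn => cd; last by rewrite mule0.
  rewrite gtr0_norm// -!EFinB -EFinM; congr EFin; by field.
Qed.

Lemma ge0_integral_affine (f : R -> \bar R) : measurable_fun [set: R] f ->
  (forall x, 0 <= f x)%E ->
  (\int[mu]_x f (a * x + b)%R = (`|a|^-1)%:E * \int[mu]_x f x)%E.
Proof.
move=> mf f0.
rewrite (_ : (\int[mu]_x f x) = (\int[nu]_x f x))%E; last first.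
  by apply: eq_measure_integral => A mA _; rewrite -mu_nu.
rewrite ge0_integral_mscale//= ge0_integral_pushforward//= preimage_setT.
by rewrite muleA -EFinM mulVf ?mul1e// normr_eq0.
Qed.

Lemma integrableR_affine f : integrableR f -> integrableR (fun x => f (a * x + b)).
Proof.
move=> hf; have mf := integrableR_measurable hf.
apply/integrableP; split.
  by apply/measurable_EFinP; exact: (measurableT_comp mf mphi).
rewrite /= (ge0_integral_affine (f := fun x => `|(f x)%:E|%E))//; last first.
  by apply: measurableT_comp => //; exact/measurable_EFinP.
have /integrableP[_ fi] := hf; rewrite lte_mul_pinfty ?lee_fin//.
Qed.

Lemma Rint_affine f : integrableR f ->
  \int[mu]_x f (a * x + b) = `|a|^-1 * \int[mu]_x f x.
Proof.
move=> hf; have mf := integrableR_measurable hf.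
have mp (h : R -> R) : measurable_fun [set: R] h ->
  measurable_fun [set: R] (fun x => h (a * x + b)).
  by move=> mh; exact: (measurableT_comp mh mphi).
have pE (g : R -> R) : integrableR g -> (forall x, 0 <= g x) ->
  \int[mu]_x g (a * x + b) = `|a|^-1 * \int[mu]_x g x.
  move=> hg g0; have mg := integrableR_measurable hg.
  rewrite /Rintegral (ge0_integral_affine (f := EFin \o g))//.
  - by rewrite fineM//=; exact: integrable_fin_num.
  - exact/measurable_EFinP.
(* Positive and negative parts reduce the signed case to [pE]. *)
pose p x := (`|f x| + f x) / 2; pose n x := (`|f x| - f x) / 2.
have hn := integrableR_norm hf.
have hp : integrableR p.
  rewrite /p; apply: (@integrableR_le _ (fun x => `|f x|)) => //.
    apply: measurable_funM => //; apply: measurable_funD => //.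
    exact: integrableR_measurable hn.
  by move=> x; rewrite ger0_norm; have := ler_norm (f x); have := ler_norm (- f x); rewrite normrN; lra.
have hm : integrableR n.
  rewrite /n; apply: (@integrableR_le _ (fun x => `|f x|)) => //.
    apply: measurable_funM => //; apply: measurable_funB => //.
    exact: integrableR_measurable hn.
  by move=> x; rewrite ger0_norm; have := ler_norm (f x); have := ler_norm (- f x); rewrite normrN; lra.
have fE x : f x = p x - n x by rewrite /p /n; field.
rewrite (eq_Rint fE) RintB// mulrBr -!pE//; last 2 first.
- by move=> x; rewrite /n; have := ler_norm (f x); lra.
- by move=> x; rewrite /p; have := ler_norm (- f x); rewrite normrN; lra.
rewrite -RintB; first exact: eq_Rint; exact: integrableR_affine.
Qed.

End affine.

Lemma Rint_shift b f : integrableR f -> \int[mu]_x f (x + b) = \int[mu]_x f x.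
Proof.
move=> hf; have := Rint_affine b (oner_neq0 R) hf.
rewrite normr1 invr1 mul1r => <-; apply: eq_Rint => x; by rewrite mul1r.
Qed.

Lemma integrableR_shift b f : integrableR f -> integrableR (fun x => f (x + b)).
Proof.
move=> hf; have := integrableR_affine b (oner_neq0 R) hf.
by apply: eq_integrable => // x _ /=; rewrite mul1r.
Qed.

Let N1_neq0 : (-1 : R) != 0. Proof. by rewrite oppr_eq0 oner_neq0. Qed.

Lemma Rint_sub b f : integrableR f -> \int[mu]_x f (b - x) = \int[mu]_x f x.
Proof.
move=> hf; have := Rint_affine b N1_neq0 hf.
rewrite normrN normr1 invr1 mul1r => <-; apply: eq_Rint => x.
by rewrite mulN1r addrC.
Qed.

Lemma Rint_odd f : integrableR f -> (forall x, f (- x) = - f x) ->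
  \int[mu]_x f x = 0.
Proof.
move=> hf fN; have := Rint_sub 0 hf.
under eq_Rint do rewrite sub0r fN.
by rewrite RintN// => h; lra.
Qed.

(** Fubini, with the integrand dominated by M |f x| |g y|. The integrability of the outer function
    is recorded too: it is what later makes the transforms measurable. *)
Let Rint_swap_subproof f g (k : R -> R -> R) (M : R) : integrableR f -> integrableR g ->
  measurable_fun [set: R * R] (fun p => k p.1 p.2) ->
  (forall x y, `|k x y| <= M) ->
  integrableR (fun x => f x * \int[mu]_y (g y * k x y)) /\
   \int[mu]_x (f x * \int[mu]_y (g y * k x y)) =
   \int[mu]_y (g y * \int[mu]_x (f x * k x y)).
Proof.
move=> hf hg mk kM.
have mf := integrableR_measurable hf; have mg := integrableR_measurable hg.
have mkx x : measurable_fun [set: R] (k x).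
  exact: (measurable_fun_pair2 x mk).
have mky y : measurable_fun [set: R] (k ^~ y).
  exact: (measurable_fun_pair1 y mk).
pose F (p : R * R) := (f p.1 * (g p.2 * k p.1 p.2))%:E.
have mF : measurable_fun [set: R * R] F.
  apply/measurable_EFinP; apply: measurable_funM.
    by apply: measurableT_comp.
  by apply: measurable_funM => //; exact: measurableT_comp.
have igk x : integrableR (fun y => g y * k x y).
  have := integrableR_mul_bounded (mkx x) (kM x) hg.
  by apply: eq_integrable => // y _ /=; rewrite mulrC.
have ifk y : integrableR (fun x => f x * k x y).
  have := integrableR_mul_bounded (mky y) (kM ^~ y) hf.
  by apply: eq_integrable => // x _ /=; rewrite mulrC.
have M0 : 0 <= M by apply: le_trans (kM 0 0).
have iF : (mu \x mu)%E.-integrable [set: R * R] F.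
  apply: (integrable12ltyP mu mu mF).2.
  have b x : (\int[mu]_y `|F (x, y)| <= (`|f x| * (M * \int[mu]_y `|g y|))%:E)%E.
    have ig := integrableRZ (`|f x| * M) (integrableR_norm hg).
    rewrite mulrA -RintZ ?RintE//; last exact: integrableR_norm.
    apply: ge0_le_integral => //.
    - apply: measurableT_comp => //.
      exact: (measurable_fun_pair2 x mF).
    - by apply/measurable_EFinP; exact: integrableR_measurable ig.
    - move=> y _ /=; rewrite /F/= lee_fin !normrM -mulrA ler_wpM2l//.
      by rewrite mulrC ler_wpM2r.
  apply: le_lt_trans (_ : (\int[mu]_x (`|f x| * (M * \int[mu]_y `|g y|))%:E < +oo)%E).
    apply: ge0_le_integral => //.
    - by move=> x _; exact: integral_ge0.
    - apply: (@measurable_fun_fubini_tonelli_F _ _ _ _ _ mu (fun p => `|F p|%E)) => //.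
      exact: measurableT_comp.
    - apply/measurable_EFinP; apply: measurable_funM => //; exact: measurableT_comp.
  have : integrableR (fun x => `|f x| * (M * \int[mu]_y `|g y|)).
    have := integrableRZ (M * \int[mu]_y `|g y|) (integrableR_norm hf).
    by apply: eq_integrable => // x _ /=; rewrite mulrC.
  move=> /integrable_lty; apply => //.
have e1 : (fun x => (f x * \int[mu]_y (g y * k x y))%:E) = (fun x => \int[mu]_y F (x, y))%E.
  apply/funext => x; rewrite -RintZ// RintE//; exact: integrableRZ.
have e2 : (fun y => (g y * \int[mu]_x (f x * k x y))%:E) = (fun y => \int[mu]_x F (x, y))%E.
  apply/funext => y; rewrite -RintZ// RintE; last exact: integrableRZ.
  by apply: eq_integral => x _; rewrite /F/= mulrCA.
split.
- have := integrable_fubini_F iF.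
  by apply: eq_integrable => // x _; exact: esym (congr1 (@^~ x) e1).
- by rewrite /Rintegral e1 e2 (Fubini iF).
Qed.

Lemma Rint_swap f g (k : R -> R -> R) (M : R) : integrableR f -> integrableR g ->
  measurable_fun [set: R * R] (fun p => k p.1 p.2) ->
  (forall x y, `|k x y| <= M) ->
  [/\ integrableR (fun x => f x * \int[mu]_y (g y * k x y)),
      integrableR (fun y => g y * \int[mu]_x (f x * k x y)) &
   \int[mu]_x (f x * \int[mu]_y (g y * k x y)) =
   \int[mu]_y (g y * \int[mu]_x (f x * k x y))].
Proof.
move=> hf hg mk kM; have [h1 h2] := Rint_swap_subproof hf hg mk kM.
split=> //; have mk' : measurable_fun [set: R * R] (fun p => k p.2 p.1).
  exact: (measurableT_comp mk (measurable_fun_pair measurable_snd measurable_fst)).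
by have [] := Rint_swap_subproof (k := fun y x => k x y) hg hf mk' (fun y x => kM x y).
Qed.

Lemma Rint_dominated (f_ : nat -> R -> R) f g :
  (forall n, measurable_fun [set: R] (f_ n)) -> measurable_fun [set: R] f ->
  integrableR g -> (forall n x, `|f_ n x| <= g x) ->
  {ae mu, forall x, f_ n x @[n --> \oo] --> f x} ->
  integrableR f /\ \int[mu]_x f_ n x @[n --> \oo] --> \int[mu]_x f x.
Proof.
move=> mf_ mf ig fg cf.
have [] := @dominated_convergence _ _ R mu _ measurableT (fun n => EFin \o f_ n)
  (EFin \o f) (EFin \o g).
- by move=> n; apply/measurable_EFinP; exact: mf_.
- by apply/measurable_EFinP; exact: mf.
- by apply: ae_imp cf => x cfx _; apply: cvg_EFin => //; exact: nearW.
- exact: ig.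
- by apply: ae_all => x n _ /=; rewrite lee_fin.
move=> hf _ cI; split=> //.
have cI' : (\int[mu]_x (f_ n x)%:E)%E @[n --> \oo] --> (\int[mu]_x f x)%:E.
  by rewrite RintE.
exact: (fine_cvg cI').
Qed.

Lemma Rint_fatou (f_ : nat -> R -> R) f M :
  (forall n, integrableR (f_ n)) -> (forall n x, 0 <= f_ n x) ->
  (\forall n \near \oo, \int[mu]_x f_ n x <= M) ->
  measurable_fun [set: R] f ->
  {ae mu, forall x, f_ n x @[n --> \oo] --> f x} -> (forall x, 0 <= f x) ->
  integrableR f /\ \int[mu]_x f x <= M.
Proof.
move=> hf f0 fM mf cf fge0.
have key : (\int[mu]_x (f x)%:E <= M%:E)%E.
  (* The convergence holds only almost everywhere, so f is traded for the lower limit, which is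
     defined at every point. *)
  have -> : (\int[mu]_x (f x)%:E = \int[mu]_x limn_einf (fun n => (f_ n x)%:E))%E.
    apply: ae_eq_integral => //; first exact/measurable_EFinP.
      apply: (emeasurable_fun_cvg (fun n x => einfs (fun m => (f_ m x)%:E) n)).
        apply: measurable_fun_einfs => n.
        by apply/measurable_EFinP; exact: integrableR_measurable.
      by move=> x _; rewrite limn_einf_lim; exact: is_cvg_einfs.
    apply: ae_imp cf => x cfx _.
    have cE : (f_ n x)%:E @[n --> \oo] --> (f x)%:E.
      by apply: cvg_EFin => //; exact: nearW.
    by rewrite is_cvg_limn_einfE; [exact/esym/cvg_lim|apply/cvg_ex; exists (f x)%:E].
  apply: (le_trans (fatou mu measurableT _ _)).
  - by move=> n; apply/measurable_EFinP; exact: integrableR_measurable.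
  - by move=> n x _; rewrite lee_fin.
  have [N _ hN] := fM.
  rewrite limn_einf_lim; apply: lime_le; first exact: is_cvg_einfs.
  (* The infimum of the tail from n on is at most its term of index max (n, N), where the eventual
     bound applies. *)
  apply: nearW => n; apply: le_trans (_ : (\int[mu]_x (f_ (maxn n N) x)%:E <= _)%E).
    by apply: ereal_inf_lbound; exists (maxn n N) => //=; rewrite leq_maxl.
  by rewrite -RintE// lee_fin; apply: hN => /=; rewrite leq_maxr.
have hfi : integrableR f.
  by apply/integrableR_ge0P => //; apply: le_lt_trans key _; rewrite ltry.
by split=> //; rewrite -lee_fin RintE.
Qed.

End lebesgue_kit.

(** * The Poisson kernel *)

Section poisson_kernel.
Context {R : realType}.
Local Notation mu := (@lebesgue_measure R).

Lemma scaleRE (a b : R) : a *: b = a * b. Proof. by []. Qed.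

Lemma is_derive_expRM (c x : R) :
  is_derive x 1 (fun y => expR (c * y)) (c * expR (c * x)).
Proof.
have h : is_derive x 1 (fun y : R => c * y) c.
  by have := is_deriveZ (f := id) c (is_derive_id x 1); rewrite scaler1.
have := is_derive1_comp (is_derive_expR (c * x)) h.
by rewrite mulrC.
Qed.

(** Evenness doubles the integral over the half line. The antiderivative is needed only for x > 0,
    where |x| in the integrand is smooth. *)
Let even_cont_itg (f F : R -> R) l : (forall x, 0 <= f x) -> continuous f ->
  (forall x, f (- x) = f x) -> F x @[x --> +oo] --> l ->
  (forall x : R, 0 < x -> is_derive x 1 F (f x)) ->
  F x @[x --> 0^'+] --> F 0 ->
  integrableR f /\ \int[mu]_x f x = 2 * (l - F 0).
Proof.
move=> f0 cf fN Fl F' F0.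
have mf : measurable_fun [set: R] f by exact: continuous_measurable_fun.
have e : (\int[mu]_x (f x)%:E = (2 * (l - F 0))%:E)%E.
  rewrite ge0_symfun_integralT//; last by move=> x /=; rewrite fN.
  rewrite -set_itvcy (@ge0_continuous_FTC2y _ _ F 0 l)//.
  - exact: continuous_subspaceT.
  - by move=> x x0; apply: ex_derive; exact: F'.
  - move=> x; rewrite in_itv/= andbT => x0.
    by rewrite derive1E; apply: derive_val; exact: F'.
split; first by apply/integrableR_ge0P => //; rewrite e ltry.
by rewrite /Rintegral e.
Qed.

(** The summand 1 keeps the integrand nonnegative, as [even_cont_itg] asks. The case b = 0 isolates
    the integral of the exponential, and subtracting it leaves the cosine. *)
Let abel_cos (e b : R) : 0 < e ->
  integrableR (fun x => expR (- (e * `|x|)) * (1 + cos (b * x))) /\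
  \int[mu]_x (expR (- (e * `|x|)) * (1 + cos (b * x))) =
  2 / e + 2 * e / (e ^+ 2 + b ^+ 2).
Proof.
move=> e0; have eb : e ^+ 2 + b ^+ 2 != 0.
  by rewrite gt_eqF// ltr_pwDl ?exprn_gt0// sqr_ge0.
pose F (x : R) := expR (- e * x) *
  (- e^-1 + (b * sin (b * x) - e * cos (b * x)) / (e ^+ 2 + b ^+ 2)).
have dcos (x : R) : is_derive x 1 (fun y : R => cos (b * y)) (- (b * sin (b * x))).
  have h : is_derive x 1 (fun y : R => b * y) b.
    by have := is_deriveZ (f := id) b (is_derive_id x 1); rewrite scaler1.
  by have := is_derive1_comp (is_derive_cos (b * x)) h; rewrite mulNr mulrC.
have dsin (x : R) : is_derive x 1 (fun y : R => sin (b * y)) (b * cos (b * x)).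
  have h : is_derive x 1 (fun y : R => b * y) b.
    by have := is_deriveZ (f := id) b (is_derive_id x 1); rewrite scaler1.
  by have := is_derive1_comp (is_derive_sin (b * x)) h; rewrite mulrC.
have dF (x : R) : is_derive x 1 F (expR (- e * x) * (1 + cos (b * x))).
  have h := is_deriveM (is_derive_expRM (- e) x) (is_deriveD
    (is_derive_cst (- e^-1 : R) x 1)
    (is_deriveM (is_deriveB (is_deriveZ b (dsin x)) (is_deriveZ e (dcos x)))
      (is_derive_cst ((e ^+ 2 + b ^+ 2)^-1) x 1))).
  apply: (is_derive_eq h); rewrite !fctE/= !scaleRE; field.
  by rewrite eb gt_eqF.
have cexp : continuous (fun x : R => expR (- (e * `|x|))).
  move=> x; apply: continuous_comp; last exact: continuous_expR.
  apply: cvgN; apply: cvgM; first exact: cvg_cst.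
  exact: norm_continuous.
have ccos : continuous (fun x : R => 1 + cos (b * x)).
  move=> x; apply: cvgD; first exact: cvg_cst.
  by apply: differentiable_continuous; apply/derivable1_diffP; apply: ex_derive; exact: dcos.
have [| | | | | |h1 h2] := @even_cont_itg (fun x => expR (- (e * `|x|)) * (1 + cos (b * x)))
  F 0.
- by move=> x; rewrite mulr_ge0 ?expR_ge0//; have := cos_geN1 (b * x); lra.
- by move=> x; apply: cvgM; [exact: cexp|exact: ccos].
- by move=> x; rewrite normrN mulrN cosN.
- apply/cvgr0Pnorm_le => d d0.
  (* [M] bounds the second factor of [F], which therefore decays like exp (- e x). *)
  pose M := e^-1 + (`|b| + e) / (e ^+ 2 + b ^+ 2).
  have M0 : 0 < M.
    rewrite ltr_pwDl ?invr_gt0// mulr_ge0 ?addr_ge0 ?invr_ge0 ?addr_ge0 ?sqr_ge0//.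
    exact: ltW.
  have FM x : `|F x| <= expR (- e * x) * M.
    rewrite /F normrM ger0_norm ?expR_ge0// ler_wpM2l ?expR_ge0//.
    apply: le_trans (ler_normD _ _) _; rewrite normrN gtr0_norm ?invr_gt0// lerD2l.
    rewrite normrM [X in _ * X <= _]ger0_norm ?invr_ge0 ?addr_ge0 ?sqr_ge0//.
    rewrite ler_wpM2r ?invr_ge0 ?addr_ge0 ?sqr_ge0//.
    apply: le_trans (ler_normB _ _) _; rewrite !normrM (gtr0_norm e0) lerD//.
      by rewrite ler_piMr// ler_norml sin_geN1 sin_le1.
    by rewrite ler_piMr ?(ltW e0)// ler_norml cos_geN1 cos_le1.
  near=> x; apply: le_trans (FM x) _; rewrite -ler_pdivlMr//.
  rewrite mulNr expRN -[leRHS]invrK lef_pV2 ?posrE ?expR_gt0 ?invr_gt0 ?divr_gt0//.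
  apply: le_trans (_ : 1 + e * x <= _); last exact: expR_ge1Dx.
  rewrite -lerBlDl -ler_pdivrMl//; near: x; apply: nbhs_pinfty_ge; exact: num_real.
- move=> x x0; rewrite (gtr0_norm x0) -mulNr; exact: dF.
- apply: cvg_at_right_filter; apply: differentiable_continuous.
  by apply/derivable1_diffP; apply: ex_derive; exact: dF.
split=> //; rewrite h2 /F !mulr0 expR0 sin0 cos0; field.
by rewrite eb gt_eqF.
Unshelve. all: by end_near. Qed.

Lemma integrableR_expRN_norm (e : R) : 0 < e ->
  integrableR (fun x => expR (- (e * `|x|))).
Proof.
move=> e0; have [h _] := abel_cos 0 e0.
have := integrableRZ 2^-1 h; apply: eq_integrable => // x _ /=.
by rewrite mul0r cos0; congr EFin; field.
Qed.

Lemma Rint_expRN_cos (e b : R) : 0 < e ->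
  \int[mu]_x (expR (- (e * `|x|)) * cos (b * x)) = 2 * e / (e ^+ 2 + b ^+ 2).
Proof.
move=> e0; have [h1 h2] := abel_cos b e0; have [_ h0] := abel_cos 0 e0.
have he := integrableR_expRN_norm e0.
have {h0} h0 : \int[mu]_x expR (- (e * `|x|)) = 2 / e.
  have -> : 2 / e = 2^-1 * (2 / e + 2 * e / (e ^+ 2 + 0 ^+ 2)) by field; rewrite gt_eqF.
  rewrite -h0 -RintZ.
    by apply: eq_Rint => x; rewrite mul0r cos0; field.
  have := integrableRZ 2 he; apply: eq_integrable => // x _ /=.
  by rewrite mul0r cos0 mulrC.
have -> : 2 * e / (e ^+ 2 + b ^+ 2) = 2 / e + 2 * e / (e ^+ 2 + b ^+ 2) - 2 / e by ring.
by rewrite -h2 -h0 -RintB//; apply: eq_Rint => x; ring.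
Qed.

(** The Fourier transform of exp (- e |t|) at frequency x, that is, [Rint_expRN_cos] at b = 2 pi
    x. *)
Definition poisson (e x : R) : R := 2 * e / (e ^+ 2 + (2 * pi * x) ^+ 2).

Let poisson_den (e x : R) : 0 < e -> 0 < e ^+ 2 + (2 * pi * x) ^+ 2.
Proof. by move=> e0; rewrite ltr_pwDl ?exprn_gt0// sqr_ge0. Qed.

Lemma poisson_ge0 (e x : R) : 0 < e -> 0 <= poisson e x.
Proof. by move=> e0; rewrite divr_ge0 ?mulr_ge0 ?(ltW e0)// ltW// poisson_den. Qed.

Lemma poisson_le (e x : R) : 0 < e -> poisson e x <= 2 / e.
Proof.
move=> e0; rewrite /poisson ler_pdivrMr ?poisson_den// mulrAC ler_pdivlMr//.
by have := sqr_ge0 (2 * pi * x); nra.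
Qed.

Lemma poissonN (e x : R) : poisson e (- x) = poisson e x.
Proof. by rewrite /poisson mulrN sqrrN. Qed.

(** With the total mass 1 of [poisson 1], this scaling makes [poisson e] an approximate identity as
    e tends to 0. *)
Lemma poisson_scale (e x : R) : 0 < e -> poisson e (e * x) = e^-1 * poisson 1 x.
Proof.
move=> e0; have := poisson_den x ltr01; rewrite /poisson expr1n mulrCA (exprMn _ e).
set y := (2 * pi * x) ^+ 2 => y0; field; rewrite (gt_eqF e0) ?(gt_eqF y0)/=.
have : 0 < e ^+ 2 * (1 + y) by rewrite mulr_gt0 ?exprn_gt0.
by rewrite mulrDr mulr1 => /gt_eqF ->.
Qed.

Lemma poisson_int : integrableR (poisson 1) /\ \int[mu]_x poisson 1 x = 1.
Proof.
have dF (x : R) : is_derive x 1 (fun y => pi^-1 * atan (2 * pi * y)) (poisson 1 x).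
  have h : is_derive x 1 (fun y : R => 2 * pi * y) (2 * pi).
    by have := is_deriveZ (f := id) (2 * pi) (is_derive_id x 1); rewrite scaler1.
  have h' := is_deriveZ pi^-1 (is_derive1_comp (is_derive1_atan (2 * pi * x)) h).
  apply: (is_derive_eq h'); rewrite /= !scaleRE /poisson expr1n.
  have := poisson_den x ltr01; rewrite expr1n.
  move: (pi_gt0 R); move: (pi : R) => p p0 d.
  by field; rewrite (gt_eqF d) (gt_eqF p0).
have [h1 h2] : integrableR (poisson 1) /\
    \int[mu]_x poisson 1 x = 2 * (2^-1 - pi^-1 * atan (2 * pi * 0)).
  pose F (y : R) := pi^-1 * atan (2 * pi * y).
  apply: (@even_cont_itg _ F).
  - by move=> x; exact: poisson_ge0.
  - move=> x; apply: cvgM; first exact: cvg_cst.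
    apply: cvgV; first by rewrite gt_eqF// poisson_den.
    apply: cvgD; first exact: cvg_cst.
    by apply: (continuous_comp (f := fun y : R => 2 * pi * y) (g := fun y => y ^+ 2));
      [exact: mulrl_continuous|exact: exprn_continuous].
  - exact: poissonN.
  - rewrite /F; have -> : 2^-1 = pi^-1 * (pi / 2) :> R by rewrite mulKf// gt_eqF// pi_gt0.
    apply: cvgM; first exact: cvg_cst.
    apply: (@cvg_comp _ _ _ (fun y : R => 2 * pi * y) atan _ (pinfty_nbhs R)).
      apply: gt0_cvgMry; first by rewrite mulr_gt0 ?pi_gt0.
      exact: cvg_id.
    exact: cvgy_atan.
  - apply: cvg_at_right_filter; apply: differentiable_continuous.
    by apply/derivable1_diffP; apply: ex_derive; exact: dF.
by split=> //; rewrite h2 mulr0 atan0 mulr0 subr0 mulfV.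
Qed.

End poisson_kernel.

(** * Square integrable functions and continuity of translations *)

Section translation.
Context {R : realType}.
Local Notation mu := (@lebesgue_measure R).
Implicit Types f g : R -> R.

Definition squareR f :=
  measurable_fun [set: R] f /\ integrableR (fun x => f x ^+ 2).

Lemma squareR_measurable f : squareR f -> measurable_fun [set: R] f.
Proof. by case. Qed.

Lemma squareR_mul f g : squareR f -> squareR g -> integrableR (fun x => f x * g x).
Proof.
move=> [mf hf] [mg hg].
apply: (integrableR_le (g := fun x => f x ^+ 2 + g x ^+ 2)).
- exact: measurable_funM.
- move=> x; rewrite ler_norml; have := sqr_ge0 (f x + g x).
  have := sqr_ge0 (f x - g x); rewrite sqrrB sqrrD => h1 h2.
  by apply/andP; split; have := sqr_ge0 (f x); have := sqr_ge0 (g x); lra.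
- exact: integrableRD.
Qed.

Lemma squareRD f g : squareR f -> squareR g -> squareR (fun x => f x + g x).
Proof.
move=> hf hg; have [mf f2] := hf; have [mg g2] := hg.
split; first exact: measurable_funD.
have := integrableRD (integrableRD f2 g2) (integrableRZ 2 (squareR_mul hf hg)).
by apply: eq_integrable => // x _ /=; congr EFin; ring.
Qed.

Lemma squareRZ c f : squareR f -> squareR (fun x => c * f x).
Proof.
move=> [mf f2]; split; first exact: measurable_funM.
have := integrableRZ (c ^+ 2) f2.
by apply: eq_integrable => // x _ /=; rewrite exprMn.
Qed.

Lemma squareRN f : squareR f -> squareR (fun x => - f x).
Proof.
move=> [mf f2]; split; first exact: measurableT_comp.
by have := f2; apply: eq_integrable => // x _ /=; rewrite sqrrN.
Qed.

Lemma squareRB f g : squareR f -> squareR g -> squareR (fun x => f x - g x).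
Proof. by move=> hf hg; apply: squareRD => //; exact: squareRN. Qed.

Lemma squareR_le f g : measurable_fun [set: R] f ->
  (forall x, `|f x| <= `|g x|) -> squareR g -> squareR f.
Proof.
move=> mf fg [mg g2]; split=> //; apply: integrableR_le g2.
  exact: measurable_funX.
move=> x; rewrite normrX -[leRHS]real_normK ?num_real//.
by rewrite lerXn2r ?nnegrE.
Qed.

Lemma squareR_shift b f : squareR f -> squareR (fun x => f (x + b)).
Proof.
move=> [mf f2]; split; last exact: (integrableR_shift b f2).
apply: (measurableT_comp mf); exact: measurable_funD.
Qed.

Lemma Rint_sqrD_le f g : squareR f -> squareR g ->
  \int[mu]_x (f x + g x) ^+ 2 <=
  2 * \int[mu]_x f x ^+ 2 + 2 * \int[mu]_x g x ^+ 2.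
Proof.
move=> hf hg; have [mf f2] := hf; have [mg g2] := hg.
rewrite -!RintZ// -RintD; [|exact: integrableRZ|exact: integrableRZ].
apply: le_Rint; first by have [] := squareRD hf hg.
  by apply: integrableRD; exact: integrableRZ.
by move=> x; have := sqr_ge0 (f x - g x); rewrite sqrrB sqrrD; lra.
Qed.

Definition clip (n x : R) : R := Num.max (- n) (Num.min n x).

(** A continuous trapezoid instead of an indicator, so that truncating a continuous function keeps
    it continuous. *)
Definition cutoff (n x : R) : R := Num.max 0 (Num.min 1 (n + 1 - `|x|)).

Lemma clip_continuous (n : R) : continuous (clip n).
Proof.
move=> x; apply: (@continuous_max _ _ (cst (- n)) (fun y => Num.min n y)).
  exact: cvg_cst.
by apply: (@continuous_min _ _ (cst n) id); [exact: cvg_cst|exact: cvg_id].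
Qed.

Lemma cutoff_continuous (n : R) : continuous (cutoff n).
Proof.
move=> x; apply: (@continuous_max _ _ (cst 0) (fun y => Num.min 1 (n + 1 - `|y|))).
  exact: cvg_cst.
apply: (@continuous_min _ _ (cst 1) (fun y => n + 1 - `|y|)); first exact: cvg_cst.
apply: cvgB; first exact: cvg_cst.
exact: norm_continuous.
Qed.

Lemma clip_norm (n x : R) : 0 <= n -> `|clip n x| <= n.
Proof.
move=> n0; rewrite ler_norml /clip; case: (leP n x) => ?.
  by case: (leP (- n) n) => ?; lra.
by case: (leP (- n) x) => ?; lra.
Qed.

Lemma clip_le (n x : R) : 0 <= n -> `|clip n x| <= `|x|.
Proof.
move=> n0; rewrite ler_norml /clip.
by case: (leP n x) => nx; case: (leP (- n)) => h; case: (ger0P x) => ?; lra.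
Qed.

Lemma clip_id (n x : R) : `|x| <= n -> clip n x = x.
Proof.
by rewrite ler_norml /clip => h; case: (leP n x) => ?; case: (leP (- n)) => ?; lra.
Qed.

Lemma clip_dist (n x y : R) : `|clip n x - clip n y| <= `|x - y|.
Proof.
have h1 := ler_norm (x - y); have h2 := ler_norm (y - x); rewrite distrC in h2.
have h3 := normr_ge0 (x - y); rewrite ler_norml /clip.
case: (leP n x) => nx; case: (leP n y) => ny; case: (leP (- n) n) => ?;
  case: (leP (- n) x) => ?; case: (leP (- n) y) => ?; lra.
Qed.

Lemma cutoff_ge0 (n x : R) : 0 <= cutoff n x.
Proof. by rewrite /cutoff le_max lexx. Qed.

Lemma cutoff_le1 (n x : R) : cutoff n x <= 1.
Proof. by rewrite /cutoff ge_max ler01 ge_min lexx. Qed.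

Lemma cutoff1 (n x : R) : `|x| <= n -> cutoff n x = 1.
Proof. by move=> xn; rewrite /cutoff min_l; [rewrite max_r|lra]. Qed.

Lemma cutoff0 (n x : R) : n + 1 <= `|x| -> cutoff n x = 0.
Proof. by move=> xn; rewrite /cutoff max_l// ge_min; apply/orP; right; lra. Qed.

Lemma cutoff_cvg (x : R) : cutoff n%:R x @[n --> \oo] --> (1 : R).
Proof.
apply: cvg_near_cst; near=> n; apply: cutoff1; near: n; exact: nbhs_infty_ger.
Unshelve. all: by end_near. Qed.

Lemma clip_cvg (x : R) : clip n%:R x @[n --> \oo] --> x.
Proof.
apply: cvg_near_cst; near=> n; apply: clip_id; near: n; exact: nbhs_infty_ger.
Unshelve. all: by end_near. Qed.

(** Truncation in value and in space approximates f in L^2 by dominated convergence. The truncated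
    function is then approximated by continuous ones in L^1 on a bounded interval, and since
    everything is bounded by n, L^1 closeness gives L^2 closeness. *)
Lemma continuous_squareR_dense f (e : R) : squareR f -> 0 < e ->
  exists (g : R -> R) (M N : R), [/\ continuous g, forall x, `|g x| <= M,
    forall x, N <= `|x| -> g x = 0, squareR g &
    \int[mu]_x (f x - g x) ^+ 2 < e].
Proof.
move=> hf e0; have [mf f2] := hf.
pose fn n x := clip n%:R (f x) * cutoff n%:R x.
have mfn n : measurable_fun [set: R] (fn n).
  apply: measurable_funM; last first.
    by apply: continuous_measurable_fun; exact: cutoff_continuous.
  by apply: measurableT_comp => //; apply: continuous_measurable_fun;
    exact: clip_continuous.
have fnf n x : `|fn n x| <= `|f x|.
  rewrite /fn normrM (ger0_norm (cutoff_ge0 _ _)).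
  by rewrite -[leRHS]mulr1 ler_pM// ?cutoff_ge0 ?cutoff_le1 ?clip_le.
have hfn n : squareR (fn n) by exact: squareR_le (fnf n) hf.
have [_ cI] : integrableR (fun=> 0 : R) /\
    \int[mu]_x (f x - fn n x) ^+ 2 @[n --> \oo] --> \int[mu]_x (0 : R).
  apply: (Rint_dominated (g := fun x => 4 * f x ^+ 2)) => //.
  - by move=> n; have [] := squareRB hf (hfn n); move=> m _; exact: measurable_funX.
  - exact: integrableRZ.
  - move=> n x; rewrite ger0_norm ?sqr_ge0//.
    have -> : 4 * f x ^+ 2 = (2 * `|f x|) ^+ 2 by rewrite exprMn real_normK ?num_real//; ring.
    rewrite -real_normK ?num_real// lerXn2r ?nnegrE ?mulr_ge0//.
    by apply: le_trans (ler_normB _ _) _; have := fnf n x; lra.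
  - apply: ae_all => x; have -> : 0 = (f x - f x * 1) ^+ 2 by rewrite mulr1 subrr expr0n.
    apply: (@cvg_comp _ _ _ (fun n => f x - fn n x) (fun y => y ^+ 2)); last first.
      exact: exprn_continuous.
    by apply: cvgB; [exact: cvg_cst|apply: cvgM; [exact: clip_cvg|exact: cutoff_cvg]].
rewrite Rint0 in cI.
have [n nI] : exists n, \int[mu]_x (f x - fn n x) ^+ 2 < e / 4.
  have e4 : 0 < e / 4 by rewrite divr_gt0.
  move/cvgr0Pnorm_lt : cI => /(_ _ e4) [n _ nI]; exists n.
  by apply: le_lt_trans (nI n _) => /=; [exact: ler_norm|].
pose E : set R := `[- (n%:R + 2), n%:R + 2]%classic.
have mE : @measurable _ (measurableTypeR R) E by exact: measurable_itv.
have n0 : 0 <= n%:R :> R by [].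
have Ex x : E x <-> `|x| <= n%:R + 2 by rewrite /E/= in_itv/= ler_norml.
have fnn x : `|fn n x| <= n%:R.
  rewrite /fn normrM (ger0_norm (cutoff_ge0 _ _)).
  by rewrite -[leRHS]mulr1 ler_pM// ?cutoff_ge0 ?cutoff_le1 ?clip_norm.
have muE : (mu E < +oo)%E.
  by rewrite /E lebesgue_measure_itv/=; case: ifP => _; rewrite ltry.
have iE : mu.-integrable E (EFin \o fn n).
  apply: measurable_bounded_integrable => //.
  - exact: (measurable_funTS (mfn n)).
  - exists n%:R; split; first exact: num_real.
    by move=> M nM x _ /=; apply: le_trans (fnn x) _; exact: ltW.
have [h_ [ch ih hI]] := approximation_continuous_integrable mE muE iE.
(* The squared distance is at most 2 (n + 1) times the distance [u], so this tolerance yields e / 4;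
   [Rint_sqrD_le] doubles each of two such errors. *)
have e8 : 0 < e / (8 * (n%:R + 1)) by rewrite divr_gt0// mulr_gt0// ltr_wpDl.
have [k kI] : exists k, (\int[mu]_(z in E) `|(fn n z - h_ k z)%:E| < (e / (8 * (n%:R + 1)))%:E)%E.
  have := hI; move/fine_cvgP => [[k1 _ hk1] /cvgr0Pnorm_lt/(_ _ e8)[k2 _ hk2]].
  exists (maxn k1 k2); rewrite -[ltLHS]fineK ?hk1//= ?leq_maxl// lte_fin.
  by apply: le_lt_trans (hk2 (maxn k1 k2) _) => /=; [exact: ler_norm|rewrite leq_maxr].
(* Clipping is 1-Lipschitz and leaves the values of [fn n] alone, and [fn n] vanishes where this
   wider cutoff is not 1; so the approximation does not get worse. *)
pose g x := clip n%:R (h_ k x) * cutoff (n%:R + 1) x.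
have cg : continuous g.
  move=> x; apply: cvgM; last exact: cutoff_continuous.
  by apply: (continuous_comp (ch k x)); exact: clip_continuous.
have gn x : `|g x| <= n%:R.
  rewrite /g normrM (ger0_norm (cutoff_ge0 _ _)).
  by rewrite -[leRHS]mulr1 ler_pM// ?cutoff_ge0 ?cutoff_le1 ?clip_norm.
have g0 x : n%:R + 2 <= `|x| -> g x = 0.
  by move=> xn; rewrite /g cutoff0 ?mulr0//; lra.
have mg : measurable_fun [set: R] g by exact: continuous_measurable_fun.
pose u := (fun z => `|fn n z - h_ k z|) \_ E.
have iu : integrableR u.
  have iB : mu.-integrable E (EFin \o (fun z => fn n z - h_ k z)).
    by have := integrableB mE iE (ih k).
  have := (integrable_mkcond _ mE).1 (integrable_norm iB).
  by rewrite /integrableR /u -restrict_EFin.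
have uI : \int[mu]_x u x < e / (8 * (n%:R + 1)).
  rewrite -lte_fin RintE//; move: kI; congr (_ < _)%E.
  by rewrite integral_mkcond; apply: eq_integral => x _; rewrite /u /patch; case: ifP.
have u0 x : 0 <= u x by rewrite /u /patch; case: ifP.
have fgu x : (fn n x - g x) ^+ 2 <= 2 * (n%:R + 1) * u x.
  have [xE|xE] := leP `|x| (n%:R + 2).
    have uE : u x = `|fn n x - h_ k x| by rewrite /u /patch mem_set//; apply/Ex.
    have fE : fn n x = clip n%:R (fn n x) * cutoff (n%:R + 1) x.
      rewrite clip_id//; have [xn|xn] := leP `|x| (n%:R + 1).
        by rewrite cutoff1// mulr1.
      by rewrite /fn cutoff0 ?(ltW xn)// mulr0 mul0r.
    have d1 : `|fn n x - g x| <= u x.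
      rewrite {1}fE /g -mulrBl normrM (ger0_norm (cutoff_ge0 _ _)) uE.
      by rewrite -[leRHS]mulr1 ler_pM// ?cutoff_ge0 ?cutoff_le1 ?clip_dist.
    rewrite -real_normK ?num_real// expr2 ler_pM//.
    by apply: le_trans (ler_normB _ _) _; have := fnn x; have := gn x; lra.
  rewrite g0 ?(ltW xE)// subr0 /fn cutoff0; last by lra.
  by rewrite mulr0 expr0n/= mulr_ge0// mulr_ge0// addr_ge0.
have hg : squareR g.
  split=> //; apply: (integrableR_le (g := fun x => n%:R ^+ 2 * \1_E x)).
  - exact: measurable_funX.
  - move=> x; rewrite normrX indicE; have [xE|xE] := leP `|x| (n%:R + 2).
      by rewrite mem_set ?mulr1 ?lerXn2r ?nnegrE//; apply/Ex.
    by rewrite g0 ?(ltW xE)// normr0 expr0n/= mulr_ge0// sqr_ge0.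
  - apply: integrableRZ.
    exact: (integrable_indic_itv (- (n%:R + 2)) (n%:R + 2) true false).
exists g, n%:R, (n%:R + 2); split=> //.
have -> : \int[mu]_x (f x - g x) ^+ 2 = \int[mu]_x ((f x - fn n x) + (fn n x - g x)) ^+ 2.
  by apply: eq_Rint => x; congr (_ ^+ 2); ring.
apply: le_lt_trans (Rint_sqrD_le (squareRB hf (hfn n)) (squareRB (hfn n) hg)) _.
have : \int[mu]_x (fn n x - g x) ^+ 2 <= 2 * (n%:R + 1) * \int[mu]_x u x.
  rewrite -RintZ//; apply: le_Rint => //; last exact: integrableRZ.
  by have [] := squareRB (hfn n) hg.
have : 2 * (n%:R + 1) * \int[mu]_x u x < e / 4.
  have -> : e / 4 = 2 * (n%:R + 1) * (e / (8 * (n%:R + 1))).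
    by field; rewrite gt_eqF// ltr_wpDl.
  by rewrite ltr_pM2l// mulr_gt0// ltr_wpDl.
by lra.
Qed.

(** Dominated convergence settles continuous functions of bounded support. In general, f is replaced
    by such a g; the error f - g occurs once translated and once not, with the same L^2 norm. *)
Lemma translate_cvg f (x_ : nat -> R) : squareR f -> x_ n @[n --> \oo] --> (0 : R) ->
  \int[mu]_t (f (t + x_ n) - f t) ^+ 2 @[n --> \oo] --> (0 : R).
Proof.
move=> hf cx; apply/cvgr0Pnorm_le => /= e e0.
have e16 : 0 < e / 16 by rewrite divr_gt0.
have [g [M [N [cg gM gN hg gI]]]] := continuous_squareR_dense hf e16.
have mg := squareR_measurable hg.
have [B xB] : exists B : R, forall n, `|x_ n| <= B.
  have /cvg_seq_bounded [B [_ hB]] : cvgn x_ by apply/cvg_ex; exists 0.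
  by exists (B + 1) => n; apply: hB => //; rewrite ltrDl.
have B0 : 0 <= B by apply: le_trans (xB 0).
have M0 : 0 <= M by apply: le_trans (gM 0).
pose E : set R := `[- (N + B), N + B]%classic.
have [_ cI] : integrableR (fun=> 0 : R) /\
    \int[mu]_t (g (t + x_ n) - g t) ^+ 2 @[n --> \oo] --> \int[mu]_t (0 : R).
  apply: (Rint_dominated (g := fun t => (2 * M) ^+ 2 * \1_E t)) => //.
  - move=> n; apply: measurable_funX; apply: measurable_funB => //.
    by apply: (measurableT_comp mg); exact: measurable_funD.
  - apply: integrableRZ.
    exact: (integrable_indic_itv (- (N + B)) (N + B) true false).
  - move=> n t; rewrite normrX indicE; have [tE|tE] := leP `|t| (N + B).
      rewrite mem_set; last by rewrite /E/= in_itv/= -ler_norml.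
      rewrite mulr1 lerXn2r ?nnegrE ?mulr_ge0//; apply: le_trans (ler_normB _ _) _.
      by have := gM t; have := gM (t + x_ n); lra.
    rewrite (gN t); last by lra.
    rewrite gN; last by have := lerB_normD t (x_ n); have := xB n; lra.
    by rewrite subrr normr0 expr0n/= mulr_ge0// sqr_ge0.
  - apply: ae_all => t; have -> : 0 = (g (t + 0) - g t) ^+ 2 by rewrite addr0 subrr expr0n.
    apply: (@cvg_comp _ _ _ (fun n => g (t + x_ n) - g t) (fun y => y ^+ 2)); last first.
      exact: exprn_continuous.
    apply: cvgB; last exact: cvg_cst.
    apply: (@cvg_comp _ _ _ (fun n => t + x_ n) g); last exact: cg.
    by apply: cvgD; [exact: cvg_cst|].
rewrite Rint0 in cI.
have e8 : 0 < e / 8 by rewrite divr_gt0.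
move/cvgr0Pnorm_le : cI => /(_ _ e8) cI.
near=> n.
have hn : `|\int[mu]_t (g (t + x_ n) - g t) ^+ 2| <= e / 8 by near: n.
rewrite ger0_norm; last by apply: ge0_Rint => t; exact: sqr_ge0.
have hfg := squareRB hf hg; have hs := squareR_shift (x_ n) hfg.
have hgs := squareRB (squareR_shift (x_ n) hg) hg.
have -> : \int[mu]_t (f (t + x_ n) - f t) ^+ 2 =
  \int[mu]_t (((f (t + x_ n) - g (t + x_ n)) + - (f t - g t)) + (g (t + x_ n) - g t)) ^+ 2.
  by apply: eq_Rint => t; congr (_ ^+ 2); ring.
apply: le_trans (Rint_sqrD_le (squareRD hs (squareRN hfg)) hgs) _.
have h1 := Rint_sqrD_le hs (squareRN hfg).
have h2 : \int[mu]_t (f (t + x_ n) - g (t + x_ n)) ^+ 2 = \int[mu]_t (f t - g t) ^+ 2.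
  by rewrite (Rint_shift (x_ n) (f := fun t => (f t - g t) ^+ 2))//; have [] := hfg.
have h3 : \int[mu]_t (- (f t - g t)) ^+ 2 = \int[mu]_t (f t - g t) ^+ 2.
  by apply: eq_Rint => t; rewrite sqrrN.
move: hn; rewrite ger0_norm; last by apply: ge0_Rint => t; exact: sqr_ge0.
by rewrite h2 h3 in h1; lra.
Unshelve. all: by end_near. Qed.

End translation.

(** * Plancherel's theorem for real functions *)

Section plancherel_real.
Context {R : realType}.
Local Notation mu := (@lebesgue_measure R).
Implicit Types a : R -> R.

Definition cosT a (xi : R) : R := \int[mu]_t (a t * cos (2 * pi * xi * t)).

Definition sinT a (xi : R) : R := \int[mu]_t (a t * sin (2 * pi * xi * t)).

Definition autocorr a (x : R) : R := \int[mu]_t (a t * a (t + x)).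

(** Polarization reduces continuity of the autocorrelation at 0 to continuity of translations in
    L^2. *)
Lemma autocorrE a x : squareR a ->
  autocorr a x = \int[mu]_t a t ^+ 2 - 2^-1 * \int[mu]_t (a (t + x) - a t) ^+ 2.
Proof.
move=> ha; have hs := squareR_shift x ha.
have [_ a2] := ha; have [_ s2] := hs.
have -> : \int[mu]_t (a (t + x) - a t) ^+ 2 =
  \int[mu]_t (a (t + x) ^+ 2 + a t ^+ 2 - 2 * (a t * a (t + x))).
  by apply: eq_Rint => t; ring.
have h := squareR_mul ha hs.
rewrite RintB; [|exact: integrableRD|exact: integrableRZ].
by rewrite RintD// RintZ// (Rint_shift x a2) /autocorr; field.
Qed.

Lemma autocorr_cvg a (x_ : nat -> R) : squareR a ->
  x_ n @[n --> \oo] --> (0 : R) ->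
  autocorr a (x_ n) @[n --> \oo] --> \int[mu]_t a t ^+ 2.
Proof.
move=> ha cx; under eq_fun do rewrite autocorrE//.
set S := \int[mu]_t a t ^+ 2; rewrite -[X in nbhs X](subr0 S) -[in X in nbhs X](mulr0 2^-1).
apply: cvgB; first exact: cvg_cst.
by apply: cvgM; [exact: cvg_cst|exact: translate_cvg].
Qed.

Lemma autocorr_bound a x : squareR a ->
  \int[mu]_t `|a t * a (t + x)| <= \int[mu]_t a t ^+ 2.
Proof.
move=> ha; have hs := squareR_shift x ha; have [_ a2] := ha; have [_ s2] := hs.
have e : \int[mu]_t a t ^+ 2 = \int[mu]_t (2^-1 * a t ^+ 2 + 2^-1 * a (t + x) ^+ 2).
  rewrite RintD; [|exact: integrableRZ|exact: integrableRZ].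
  by rewrite !RintZ// (Rint_shift x a2); field.
rewrite e; apply: le_Rint.
- exact: integrableR_norm (squareR_mul ha hs).
- by apply: integrableRD; exact: integrableRZ.
- move=> t; rewrite ler_norml; have := sqr_ge0 (a t - a (t + x)).
  by have := sqr_ge0 (a t + a (t + x)); rewrite sqrrB sqrrD => h1 h2; apply/andP; split; lra.
Qed.

Lemma autocorr_le a x : squareR a -> `|autocorr a x| <= \int[mu]_t a t ^+ 2.
Proof.
move=> ha; apply: le_trans (autocorr_bound x ha); apply: norm_Rint.
exact: squareR_mul ha (squareR_shift x ha).
Qed.

Lemma measurable_poisson (e : R) : 0 < e -> measurable_fun [set: R] (poisson e).
Proof.
move=> e0; apply: continuous_measurable_fun => x.
apply: cvgM; first exact: cvg_cst.
apply: cvgV; first by rewrite gt_eqF// ltr_pwDl ?exprn_gt0// sqr_ge0.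
apply: cvgD; first exact: cvg_cst.
by apply: (continuous_comp (f := fun y : R => 2 * pi * y) (g := fun y => y ^+ 2));
  [exact: mulrl_continuous|exact: exprn_continuous].
Qed.

Lemma integrableR_poisson (e : R) : 0 < e -> integrableR (poisson e).
Proof.
move=> e0; have e'0 : e^-1 != 0 by rewrite gt_eqF// invr_gt0.
have := integrableRZ e^-1 (integrableR_affine 0 e'0 (@poisson_int R).1).
apply: eq_integrable => // x _ /=; rewrite addr0 -poisson_scale//.
by rewrite mulrA mulfV ?mul1r// gt_eqF.
Qed.

(** Fubini again: [autocorr_bound] bounds the inner absolute integral uniformly in x, and the
    Poisson kernel is integrable in x. *)
Lemma poisson_autocorr a (e : R) : squareR a -> 0 < e ->
  [/\ integrableR (fun x => poisson e x * autocorr a x) &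
  \int[mu]_s (a s * \int[mu]_x (a (s + x) * poisson e x)) =
  \int[mu]_x (poisson e x * autocorr a x)].
Proof.
move=> ha e0; have ma := squareR_measurable ha.
pose F (p : R * R) := (poisson e p.1 * (a p.2 * a (p.2 + p.1)))%:E.
have mF : measurable_fun [set: R * R] F.
  apply/measurable_EFinP; apply: measurable_funM.
    by apply: (measurableT_comp (measurable_poisson e0)); exact: measurable_fst.
  apply: measurable_funM; first by apply: (measurableT_comp ma); exact: measurable_snd.
  apply: (measurableT_comp ma); apply: measurable_funD.
    exact: measurable_snd.
  exact: measurable_fst.
have iaa x : integrableR (fun t => a t * a (t + x)).
  exact: squareR_mul ha (squareR_shift x ha).
have iF : (mu \x mu)%E.-integrable [set: R * R] F.
  apply: (integrable12ltyP mu mu mF).2.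
  have iP := integrableRZ (\int[mu]_t a t ^+ 2) (integrableR_poisson e0).
  apply: le_lt_trans (_ : (\int[mu]_x (\int[mu]_t a t ^+ 2 * poisson e x)%:E < +oo)%E).
    apply: ge0_le_integral => //.
    - by move=> x _; exact: integral_ge0.
    - apply: (@measurable_fun_fubini_tonelli_F _ _ _ _ _ mu (fun p => `|F p|%E)) => //.
      exact: measurableT_comp.
    - by apply/measurable_EFinP; exact: integrableR_measurable iP.
    - move=> x _; have -> : (\int[mu]_y `|F (x, y)| =
          (poisson e x * \int[mu]_t `|a t * a (t + x)|)%:E)%E.
        rewrite -RintZ ?RintE; last 2 first.
        - exact: integrableRZ (integrableR_norm (iaa x)).
        - exact: integrableR_norm.
        apply: eq_integral => y _; rewrite /F/= normrM.
        by rewrite (ger0_norm (poisson_ge0 _ e0)).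
      by rewrite lee_fin mulrC ler_wpM2r ?poisson_ge0// autocorr_bound.
  rewrite -RintE ?ltry//.
have iaP s : integrableR (fun x => a (s + x) * poisson e x).
  have sP : squareR (poisson e).
    split; first exact: measurable_poisson.
    have P_le x : `|poisson e x| <= 2 / e by rewrite ger0_norm ?poisson_ge0 ?poisson_le.
    exact: integrableR_mul_bounded (measurable_poisson e0) P_le (integrableR_poisson e0).
  have := squareR_mul (squareR_shift s ha) sP.
  by apply: eq_integrable => // x _ /=; rewrite addrC.
have e1 : (fun x => (poisson e x * autocorr a x)%:E) = (fun x => \int[mu]_y F (x, y))%E.
  by apply/funext => x; rewrite -RintZ// RintE//; exact: integrableRZ.
have e2 : (fun s => (a s * \int[mu]_x (a (s + x) * poisson e x))%:E) =
    (fun s => \int[mu]_x F (x, s))%E.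
  apply/funext => s; rewrite -RintZ// RintE; last exact: integrableRZ.
  by apply: eq_integral => x _; rewrite /F/=; congr EFin; ring.
split; last by rewrite /Rintegral e1 e2 (Fubini iF).
have := integrable_fubini_F iF.
by apply: eq_integrable => // x _; exact: esym (congr1 (@^~ x) e1).
Qed.

Let Ee (e x : R) := expR (- (e * `|x|)).

Let Ee_le1 (e x : R) : 0 < e -> Ee e x <= 1.
Proof.
by move=> e0; rewrite /Ee -[leRHS]expR0 ler_expR oppr_le0 mulr_ge0// ltW.
Qed.

Lemma measurable_mulc (c : R) : measurable_fun [set: R] (fun x => c * x).
Proof. exact: measurable_funM. Qed.

Lemma measurable_cosR : measurable_fun [set: R] (@cos R).
Proof. by apply: continuous_measurable_fun; exact: continuous_cos. Qed.

Lemma measurable_sinR : measurable_fun [set: R] (@sin R).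
Proof. by apply: continuous_measurable_fun; exact: continuous_sin. Qed.

Lemma measurable_expRR : measurable_fun [set: R] (@expR R).
Proof. by apply: continuous_measurable_fun; exact: continuous_expR. Qed.

Let mcos2 : measurable_fun [set: R * R] (fun p : R * R => cos (2 * pi * p.1 * p.2)).
Proof.
apply: (measurableT_comp measurable_cosR).
apply: measurable_funM; last exact: measurable_snd.
by apply: (measurableT_comp (measurable_mulc (2 * pi))); exact: measurable_fst.
Qed.

Let msin2 : measurable_fun [set: R * R] (fun p : R * R => sin (2 * pi * p.1 * p.2)).
Proof.
apply: (measurableT_comp measurable_sinR).
apply: measurable_funM; last exact: measurable_snd.
by apply: (measurableT_comp (measurable_mulc (2 * pi))); exact: measurable_fst.
Qed.

Lemma cos_norm (x : R) : `|cos x| <= 1.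
Proof. by rewrite ler_norml cos_geN1 cos_le1. Qed.

Lemma sin_norm (x : R) : `|sin x| <= 1.
Proof. by rewrite ler_norml sin_geN1 sin_le1. Qed.

(** [Rint_swap] with the integrable weight exp (- |x|) makes the weighted transform integrable,
    hence measurable; the weight is then divided out. *)
Let measurable_transform a (k : R -> R -> R) : integrableR a ->
  measurable_fun [set: R * R] (fun p => k p.1 p.2) -> (forall x y, `|k x y| <= 1) ->
  measurable_fun [set: R] (fun xi => \int[mu]_t (a t * k xi t)).
Proof.
move=> ha mk k1.
have [h _ _] := Rint_swap (integrableR_expRN_norm (@ltr01 R)) ha mk k1.
have mE : measurable_fun [set: R] (fun x : R => expR `|x|).
  apply: (measurableT_comp measurable_expRR); exact: normr_measurable.
have := measurable_funM mE (integrableR_measurable h).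
congr (measurable_fun _ _); apply/funext => x /=.
by rewrite mulrA -expRD mul1r addrN expR0 mul1r.
Qed.

Lemma measurable_cosT a : integrableR a -> measurable_fun [set: R] (cosT a).
Proof. move=> ha.
exact: (measurable_transform (k := fun xi t => cos (2 * pi * xi * t)) ha mcos2
  (fun x y => cos_norm _)). Qed.

Lemma measurable_sinT a : integrableR a -> measurable_fun [set: R] (sinT a).
Proof. move=> ha.
exact: (measurable_transform (k := fun xi t => sin (2 * pi * xi * t)) ha msin2
  (fun x y => sin_norm _)). Qed.

Lemma integrableR_mcos a (b : R) : integrableR a ->
  integrableR (fun t => a t * cos (b * t)).
Proof.
move=> ha; have m : measurable_fun [set: R] (fun t : R => cos (b * t)).
  exact: (measurableT_comp measurable_cosR (measurable_mulc b)).
have := integrableR_mul_bounded m (fun t => cos_norm (b * t)) ha.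
by apply: eq_integrable => // x _ /=; rewrite mulrC.
Qed.

Lemma integrableR_msin a (b : R) : integrableR a ->
  integrableR (fun t => a t * sin (b * t)).
Proof.
move=> ha; have m : measurable_fun [set: R] (fun t : R => sin (b * t)).
  exact: (measurableT_comp measurable_sinR (measurable_mulc b)).
have := integrableR_mul_bounded m (fun t => sin_norm (b * t)) ha.
by apply: eq_integrable => // x _ /=; rewrite mulrC.
Qed.

Lemma cosT_norm a xi : integrableR a -> `|cosT a xi| <= \int[mu]_t `|a t|.
Proof.
move=> ha; apply: le_trans (norm_Rint (integrableR_mcos _ ha)) _.
apply: le_Rint; [exact/integrableR_norm/integrableR_mcos|exact: integrableR_norm|].
by move=> t; rewrite normrM ler_piMr// cos_norm.
Qed.

Lemma sinT_norm a xi : integrableR a -> `|sinT a xi| <= \int[mu]_t `|a t|.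
Proof.
move=> ha; apply: le_trans (norm_Rint (integrableR_msin _ ha)) _.
apply: le_Rint; [exact/integrableR_norm/integrableR_msin|exact: integrableR_norm|].
by move=> t; rewrite normrM ler_piMr// sin_norm.
Qed.

(* The Abel factor turns the energy of the transform into a Poisson mean of the
   autocorrelation of a at 0. *)
Let abel_plancherel a (e : R) : integrableR a -> squareR a -> 0 < e ->
  integrableR (fun xi => Ee e xi * (cosT a xi ^+ 2 + sinT a xi ^+ 2)) /\
  \int[mu]_xi (Ee e xi * (cosT a xi ^+ 2 + sinT a xi ^+ 2)) =
  \int[mu]_x (poisson e x * autocorr a x).
Proof.
move=> ha h2 e0; have hE : integrableR (Ee e) := integrableR_expRN_norm e0.
(* The real part of exp (2 pi i xi s) times the transform of a at xi. Integrating it against a (s)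
   gives the energy density, while by [DE] it depends on s and t only through s - t. *)
pose D xi s := cos (2 * pi * xi * s) * cosT a xi + sin (2 * pi * xi * s) * sinT a xi.
have DE xi s : D xi s = \int[mu]_t (a t * cos (2 * pi * (s - t) * xi)).
  rewrite /D /cosT /sinT -!RintZ; [|exact: integrableR_msin|exact: integrableR_mcos].
  rewrite -RintD; last 2 first.
  - exact/integrableRZ/integrableR_mcos.
  - exact/integrableRZ/integrableR_msin.
  apply: eq_Rint => t; have -> : 2 * pi * (s - t) * xi = 2 * pi * xi * s - 2 * pi * xi * t by ring.
  by rewrite cosB; ring.
pose M := \int[mu]_t `|a t|.
have mD : measurable_fun [set: R * R] (fun p => D p.1 p.2).
  apply: measurable_funD; (apply: measurable_funM; first by []).
    by apply: (measurableT_comp (measurable_cosT ha)); exact: measurable_fst.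
  by apply: (measurableT_comp (measurable_sinT ha)); exact: measurable_fst.
have D_le xi s : `|D xi s| <= M + M.
  apply: le_trans (ler_normD _ _) _; rewrite !normrM; apply: lerD.
    rewrite -[leRHS]mul1r; apply: ler_pM => //; [exact: cos_norm|exact: cosT_norm].
  rewrite -[leRHS]mul1r; apply: ler_pM => //; [exact: sin_norm|exact: sinT_norm].
have [i1 _ e1] := Rint_swap hE ha mD D_le.
have CS xi : \int[mu]_s (a s * D xi s) = cosT a xi ^+ 2 + sinT a xi ^+ 2.
  have c1 : cosT a xi * cosT a xi =
      \int[mu]_t (cosT a xi * (a t * cos (2 * pi * xi * t))).
    exact: (esym (RintZ (cosT a xi) (integrableR_mcos (2 * pi * xi) ha))).
  have s1 : sinT a xi * sinT a xi =
      \int[mu]_t (sinT a xi * (a t * sin (2 * pi * xi * t))).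
    exact: (esym (RintZ (sinT a xi) (integrableR_msin (2 * pi * xi) ha))).
  rewrite !expr2 c1 s1 -RintD; last 2 first.
  - exact/integrableRZ/integrableR_mcos.
  - exact/integrableRZ/integrableR_msin.
  by apply: eq_Rint => t; rewrite /D; ring.
have k_le (s xi t : R) : `|cos (2 * pi * (s - t) * xi)| <= 1 by exact: cos_norm.
have inner s : \int[mu]_xi (Ee e xi * D xi s) = \int[mu]_x (a (s + x) * poisson e x).
  have mk : measurable_fun [set: R * R] (fun p : R * R => cos (2 * pi * (s - p.2) * p.1)).
    apply: (measurableT_comp measurable_cosR).
    apply: measurable_funM; last exact: measurable_fst.
    apply: (measurableT_comp (measurable_mulc (2 * pi))).
    by apply: measurable_funB => //; exact: measurable_snd.
  have [_ i2 e2] := Rint_swap (k := fun xi t => cos (2 * pi * (s - t) * xi)) hE ha mk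
     (fun xi t => k_le s xi t).
  under eq_Rint do rewrite DE.
  have pE t : \int[mu]_x (Ee e x * cos (2 * pi * (s - t) * x)) = poisson e (t - s).
    by rewrite -(poissonN e) opprB; exact: (Rint_expRN_cos (2 * pi * (s - t)) e0).
  move: i2 e2; under eq_fun do rewrite pE; move=> i2.
  move=> ->.
  rewrite -(Rint_shift s i2); apply: eq_Rint => x.
  by rewrite addrK (addrC x).
have e3 : (fun xi => Ee e xi * \int[mu]_s (a s * D xi s)) =
  (fun xi => Ee e xi * (cosT a xi ^+ 2 + sinT a xi ^+ 2)).
  by apply/funext => xi; rewrite CS.
rewrite e3 in i1 e1; split; first exact: i1.
have [_ <-] := poisson_autocorr h2 e0; rewrite e1.
by apply: eq_Rint => s; rewrite inner.
Qed.

Let eps (n : nat) : R := n.+1%:R^-1.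

Let eps_gt0 n : 0 < eps n. Proof. by rewrite invr_gt0. Qed.

(** As e tends to 0, the Poisson mean of the autocorrelation tends to its value at 0, the energy of
    a; rescaling by [poisson_scale] gives a fixed dominating weight. On the frequency side, Fatou
    gives integrability and one inequality, and the Abel factor being at most 1 gives the other. *)
Lemma plancherel_real a : integrableR a -> squareR a ->
  integrableR (fun xi => cosT a xi ^+ 2 + sinT a xi ^+ 2) /\
  \int[mu]_xi (cosT a xi ^+ 2 + sinT a xi ^+ 2) = \int[mu]_t a t ^+ 2.
Proof.
move=> ha h2; have [iP IP] := @poisson_int R.
pose G xi := cosT a xi ^+ 2 + sinT a xi ^+ 2.
have G0 xi : 0 <= G xi by rewrite addr_ge0// sqr_ge0.
have mG : measurable_fun [set: R] G.
  by apply: measurable_funD; apply: measurable_funX;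
    [exact: measurable_cosT|exact: measurable_sinT].
pose S := \int[mu]_t a t ^+ 2.
have sc n : \int[mu]_x (poisson (eps n) x * autocorr a x) =
    \int[mu]_y (poisson 1 y * autocorr a (eps n * y)) /\
    integrableR (fun y => poisson 1 y * autocorr a (eps n * y)).
  have [i1 _] := poisson_autocorr h2 (eps_gt0 n).
  have e0 : eps n != 0 by rewrite gt_eqF.
  have pE y : poisson (eps n) (eps n * y + 0) * autocorr a (eps n * y + 0) =
      (eps n)^-1 * (poisson 1 y * autocorr a (eps n * y)).
    by rewrite addr0 poisson_scale// -mulrA.
  have i2 : integrableR (fun y => poisson 1 y * autocorr a (eps n * y)).
    have := integrableRZ (eps n) (integrableR_affine 0 e0 i1).
    by apply: eq_integrable => // y _ /=; rewrite pE mulrA mulfV ?mul1r.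
  split; last exact: i2.
  have h := Rint_affine 0 e0 i1.
  rewrite (eq_Rint pE) (RintZ _ i2) (gtr0_norm (eps_gt0 n)) in h.
  by apply/esym; apply: (mulfI _ h); rewrite invr_eq0.
have S0 : 0 <= S by apply: ge0_Rint => t; exact: sqr_ge0.
have ce : eps n @[n --> \oo] --> (0 : R) by exact: cvg_harmonic.
have cI : \int[mu]_xi (Ee (eps n) xi * G xi) @[n --> \oo] --> S.
  have -> : S = \int[mu]_y (poisson 1 y * S).
    under eq_Rint do rewrite mulrC.
    by rewrite RintZ// IP mulr1.
  have -> : (fun n => \int[mu]_xi (Ee (eps n) xi * G xi)) =
      (fun n => \int[mu]_y (poisson 1 y * autocorr a (eps n * y))).
    apply/funext => n; have [_ ->] := abel_plancherel ha h2 (eps_gt0 n).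
    by have [] := sc n.
  have [] // := Rint_dominated (f_ := fun n y => poisson 1 y * autocorr a (eps n * y))
    (f := fun y => poisson 1 y * S) (g := fun y => S * poisson 1 y).
  - by move=> n; have [_] := sc n; exact: integrableR_measurable.
  - by apply: measurable_funM => //; exact: measurable_poisson.
  - exact: integrableRZ.
  - move=> n x; rewrite normrM (ger0_norm (poisson_ge0 _ ltr01)) mulrC.
    by rewrite ler_wpM2r ?poisson_ge0//; exact: autocorr_le.
  - apply: ae_all => y; apply: cvgM; first exact: cvg_cst.
    apply: autocorr_cvg => //.
    by rewrite -[X in _ --> X](mul0r y); apply: cvgM; [exact: ce|exact: cvg_cst].
have EG n xi : Ee (eps n) xi * G xi <= G xi by rewrite ler_piMl// Ee_le1.
have EG0 n xi : 0 <= Ee (eps n) xi * G xi by rewrite mulr_ge0// expR_ge0.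
have iEG n : integrableR (fun xi => Ee (eps n) xi * G xi).
  by have [] := abel_plancherel ha h2 (eps_gt0 n).
(* Fatou needs an eventual bound, and convergence to [S] supplies one only for M above [S]. *)
have fat M : S < M -> integrableR G /\ \int[mu]_xi G xi <= M.
  move=> SM; apply: (Rint_fatou (f_ := fun n xi => Ee (eps n) xi * G xi)) => //.
  - near=> n; apply: ltW; near: n.
    by apply: (cvgr_lt S).
  - apply: ae_all => xi; rewrite -[X in _ --> X]mul1r; apply: cvgM; last exact: cvg_cst.
    have c1 : - (eps n * `|xi|) @[n --> \oo] --> - (0 * `|xi|).
      by apply: cvgN; apply: cvgM; [exact: ce|exact: cvg_cst].
    have c2 := cvg_comp _ _ c1 (@continuous_expR R (- (0 * `|xi|))).
    by rewrite mul0r oppr0 expR0 in c2.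
have iG : integrableR G by have [] // := fat (S + 1); rewrite ltrDl.
split=> //; apply/eqP; rewrite eq_le; apply/andP; split.
  apply/ler_addgt0Pr => d d0; have [] // := fat (S + d).
  by rewrite ltrDl.
have nI n : \int[mu]_xi (Ee (eps n) xi * G xi) <= \int[mu]_xi G xi by exact: le_Rint.
rewrite -/S; have <- : limn (fun n => \int[mu]_xi (Ee (eps n) xi * G xi)) = S.
  exact: cvg_lim.
by apply: limr_le; [exact: cvgP cI|exact: nearW nI].
Unshelve. all: by end_near. Qed.

Lemma Rint_cosT a b : integrableR a -> integrableR b ->
  \int[mu]_x (cosT a x * b x) = \int[mu]_x (a x * cosT b x).
Proof.
move=> ha hb; have k1 (x y : R) : `|cos (2 * pi * x * y)| <= 1 by exact: cos_norm.
have [_ _ h] := Rint_swap hb ha mcos2 k1.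
transitivity (\int[mu]_x (b x * cosT a x)); first by apply: eq_Rint => x; rewrite mulrC.
rewrite h; apply: eq_Rint => x; congr (_ * _); apply: eq_Rint => y.
by rewrite mulrAC.
Qed.

Lemma Rint_sinT a b : integrableR a -> integrableR b ->
  \int[mu]_x (sinT a x * b x) = \int[mu]_x (a x * sinT b x).
Proof.
move=> ha hb; have k1 (x y : R) : `|sin (2 * pi * x * y)| <= 1 by exact: sin_norm.
have [_ _ h] := Rint_swap hb ha msin2 k1.
transitivity (\int[mu]_x (b x * sinT a x)); first by apply: eq_Rint => x; rewrite mulrC.
rewrite h; apply: eq_Rint => x; congr (_ * _); apply: eq_Rint => y.
by rewrite mulrAC.
Qed.

End plancherel_real.

(** * Real sequences; real and imaginary parts of complex numbers *)

Lemma eq_cvg_seq (R : realType) (u v : nat -> R) (l : R) : u =1 v ->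
  u n @[n --> \oo] --> l -> v n @[n --> \oo] --> l.
Proof. by move=> /funext ->. Qed.

Lemma cvg_seq_unique (R : realType) (u : nat -> R) (l l' : R) :
  u n @[n --> \oo] --> l -> u n @[n --> \oo] --> l' -> l = l'.
Proof. by move=> h h'; rewrite -(cvg_lim _ h)// -(cvg_lim _ h'). Qed.

Section complex_parts.
Context {R : realType}.
Implicit Types (z w : R[i]) (x : R).

Lemma complexP z w : re z = re w -> im z = im w -> z = w.
Proof. by case: z => a b; case: w => c d /= -> ->. Qed.

Lemma re_add z w : re (z + w) = re z + re w.
Proof. by case: z => a b; case: w. Qed.

Lemma im_add z w : im (z + w) = im z + im w.
Proof. by case: z => a b; case: w. Qed.

Lemma re_opp z : re (- z) = - re z.
Proof. by case: z. Qed.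

Lemma im_opp z : im (- z) = - im z.
Proof. by case: z. Qed.

Lemma re_mul z w : re (z * w) = re z * re w - im z * im w.
Proof. by case: z => a b; case: w. Qed.

Lemma im_mul z w : im (z * w) = re z * im w + im z * re w.
Proof. by case: z => a b; case: w. Qed.

Lemma re_conj z : re (conjc z) = re z.
Proof. by case: z. Qed.

Lemma im_conj z : im (conjc z) = - im z.
Proof. by case: z. Qed.

Lemma re_real x : re x%:C = x. Proof. by []. Qed.

Lemma im_real x : im x%:C = 0. Proof. by []. Qed.

Definition reimE := (re_add, im_add, re_opp, im_opp, re_mul, im_mul, re_conj,
  im_conj, re_real, im_real).

(** Polynomial in the two parts, so identities reduce to [ring] and no square root enters the
    integrals. *)
Definition normsq z : R := re z ^+ 2 + im z ^+ 2.

Lemma normsq_ge0 z : 0 <= normsq z.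
Proof. by rewrite addr_ge0// sqr_ge0. Qed.

Lemma normsq_eq0 z : normsq z = 0 -> z = 0.
Proof.
move=> /eqP; rewrite paddr_eq0 ?sqr_ge0// !sqrf_eq0 => /andP[/eqP h1 /eqP h2].
exact: complexP.
Qed.

Lemma normsqM z w : normsq (z * w) = normsq z * normsq w.
Proof. by rewrite /normsq !reimE; ring. Qed.

Lemma normsq_conj z : normsq (conjc z) = normsq z.
Proof. by rewrite /normsq !reimE sqrrN. Qed.

Lemma normsqN z : normsq (- z) = normsq z.
Proof. by rewrite /normsq !reimE !sqrrN. Qed.

Lemma mul_conj z : z * conjc z = (normsq z)%:C.
Proof. by apply: complexP; rewrite /normsq !reimE; ring. Qed.

Lemma modulusE z : modulus z = Num.sqrt (normsq z).
Proof. by case: z. Qed.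

Lemma modulus_ge0 z : 0 <= modulus z.
Proof. by rewrite modulusE sqrtr_ge0. Qed.

Lemma modulus_sqr z : modulus z ^+ 2 = normsq z.
Proof. by rewrite modulusE sqr_sqrtr// normsq_ge0. Qed.

Lemma modulus_inj z w : modulus z = modulus w <-> normsq z = normsq w.
Proof. by split=> [h|h]; [rewrite -!modulus_sqr h|rewrite !modulusE h]. Qed.

Lemma re_le_modulus z : `|re z| <= modulus z.
Proof. by rewrite modulusE -sqrtr_sqr ler_wsqrtr// lerDl sqr_ge0. Qed.

Lemma im_le_modulus z : `|im z| <= modulus z.
Proof. by rewrite modulusE -sqrtr_sqr ler_wsqrtr// lerDr sqr_ge0. Qed.

Lemma modulus_le z : modulus z <= `|re z| + `|im z|.
Proof.
rewrite modulusE -[leRHS]ger0_norm ?addr_ge0// -sqrtr_sqr ler_wsqrtr//.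
rewrite sqrrD !real_normK ?num_real// /normsq -addrA lerD2l lerDr.
by rewrite mulrn_wge0// mulr_ge0.
Qed.

End complex_parts.

(** * The space of complex square integrable functions *)

Section complex_L2.
Context {R : realType}.
Local Notation mu := (@lebesgue_measure R).
Implicit Types (f g h : R -> R[i]) (c : R[i]).

Definition cintegrable f :=
  integrableR (fun t => re (f t)) /\ integrableR (fun t => im (f t)).

Definition csquare f :=
  squareR (fun t => re (f t)) /\ squareR (fun t => im (f t)).

Lemma measurable_modulus f : cmeasurable f ->
  measurable_fun [set: R] (fun t => modulus (f t)).
Proof.
move=> [m1 m2]; under eq_fun do rewrite modulusE.
apply: (measurableT_comp (f := fun x : R => Num.sqrt x)).
  by apply: continuous_measurable_fun; exact: sqrt_continuous.
by apply: measurable_funD; exact: measurable_funX.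
Qed.

Lemma cintegrable_measurable f : cintegrable f -> cmeasurable f.
Proof. by move=> [/integrableR_measurable ? /integrableR_measurable ?]. Qed.

Lemma csquare_measurable f : csquare f -> cmeasurable f.
Proof. by move=> [[? _] [? _]]. Qed.

Lemma csquare_normsq f : csquare f -> integrableR (fun t => normsq (f t)).
Proof. by move=> [[? ?] [? ?]]; exact: integrableRD. Qed.

Lemma csquareP f : cmeasurable f ->
  csquare f <-> integrableR (fun t => normsq (f t)).
Proof.
move=> [m1 m2]; split; first exact: csquare_normsq.
move=> h; split; split=> //; apply: integrableR_le h => //.
- exact: measurable_funX.
- by move=> t; rewrite ger0_norm ?sqr_ge0// lerDl sqr_ge0.
- exact: measurable_funX.
- by move=> t; rewrite ger0_norm ?sqr_ge0// lerDr sqr_ge0.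
Qed.

Let powR_cLnorm f :
  poweR (cLnorm 2%:E f) 2 = (\int[mu]_t (normsq (f t))%:E)%E.
Proof.
rewrite /cLnorm powR_Lnorm//; apply: eq_integral => t _ /=.
by rewrite -modulus_sqr ger0_norm ?modulus_ge0// powR_mulrn ?modulus_ge0.
Qed.

Lemma inL2P f : inL 2%:E f <-> csquare f.
Proof.
have mn : cmeasurable f -> measurable_fun [set: R] (fun t => normsq (f t)).
  by move=> [m1 m2]; apply: measurable_funD; exact: measurable_funX.
split=> [[mf fi]|hf].
  apply/csquareP => //; apply/integrableR_ge0P; [exact: mn|exact: (fun _ => normsq_ge0 _)|].
  by rewrite -powR_cLnorm poweR_lty.
have mf := csquare_measurable hf; split=> //.
have := csquare_normsq hf => /integrableR_ge0P.
move=> /(_ (mn mf) (fun t => normsq_ge0 _)); rewrite -powR_cLnorm => h.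
rewrite ltey; apply/eqP => e; move: h; rewrite e.
by rewrite poweRyr// ltxx.
Qed.

Lemma inL1P f : inL 1%:E f <-> cintegrable f.
Proof.
have e : cLnorm 1%:E f = (\int[mu]_t (modulus (f t))%:E)%E.
  rewrite /cLnorm Lnorm1; apply: eq_integral => t _.
  by rewrite gee0_abs// lee_fin modulus_ge0.
split=> [[mf fi]|hf].
  have hm : integrableR (fun t => modulus (f t)).
    by apply/integrableR_ge0P; [exact: measurable_modulus|exact: (fun _ => modulus_ge0 _)|rewrite -e].
  have [m1 m2] := mf; split.
    by apply: integrableR_le hm => // t; exact: re_le_modulus.
  by apply: integrableR_le hm => // t; exact: im_le_modulus.
have mf := cintegrable_measurable hf; split=> //; rewrite e.
apply/integrableR_ge0P; [exact: measurable_modulus|exact: (fun _ => modulus_ge0 _)|].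
have [h1 h2] := hf; apply: integrableR_le (integrableRD (integrableR_norm h1) (integrableR_norm h2)).
  exact: measurable_modulus.
by move=> t; rewrite ger0_norm ?modulus_ge0//; exact: modulus_le.
Qed.

Definition sqnorm f : R := \int[mu]_t normsq (f t).

Lemma sqnorm_ge0 f : 0 <= sqnorm f.
Proof. by apply: ge0_Rint => t; exact: normsq_ge0. Qed.

Lemma sqnormE f : csquare f ->
  sqnorm f = \int[mu]_t re (f t) ^+ 2 + \int[mu]_t im (f t) ^+ 2.
Proof. by move=> [[? ?] [? ?]]; rewrite /sqnorm RintD. Qed.

Lemma cLnorm2E f : csquare f -> cLnorm 2%:E f = (Num.sqrt (sqnorm f))%:E.
Proof.
move=> hf; have hn := csquare_normsq hf.
have : poweR (cLnorm 2%:E f) 2 = poweR (Num.sqrt (sqnorm f))%:E 2.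
  rewrite powR_cLnorm -RintE// poweR_EFin powR_mulrn ?sqrtr_ge0//.
  by rewrite sqr_sqrtr// sqnorm_ge0.
have := Lnorm_ge0 mu 2%:E (fun t => (modulus (f t))%:E); rewrite -/(cLnorm _ _).
have [_] := (inL2P f).2 hf.
case: (cLnorm 2%:E f) => [r| |]//= _ r0.
rewrite /= !powR_mulrn ?sqrtr_ge0// => -[] /eqP.
by rewrite eqrXn2 ?sqrtr_ge0// => /eqP ->.
Qed.

Lemma csquareD f g : csquare f -> csquare g -> csquare (fun t => f t + g t).
Proof.
move=> [f1 f2] [g1 g2]; split; under eq_fun do rewrite reimE; exact: squareRD.
Qed.

Lemma csquareZ c f : csquare f -> csquare (fun t => c * f t).
Proof.
move=> [f1 f2]; split; under eq_fun do rewrite reimE.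
  by apply: squareRB; exact: squareRZ.
by apply: squareRD; exact: squareRZ.
Qed.

Lemma csquareN f : csquare f -> csquare (fun t => - f t).
Proof.
move=> [f1 f2]; split; under eq_fun do rewrite reimE; exact: squareRN.
Qed.

Lemma csquareB f g : csquare f -> csquare g -> csquare (fun t => f t - g t).
Proof. by move=> hf hg; apply: csquareD => //; exact: csquareN. Qed.

Lemma csquare_conj f : csquare f -> csquare (fun t => conjc (f t)).
Proof.
move=> [f1 f2]; split; under eq_fun do rewrite reimE; [by []|exact: squareRN].
Qed.

Lemma csquare0 : csquare (fun=> 0).
Proof.
have h : squareR (fun=> 0 : R).
  split=> //; under eq_fun do rewrite expr0n/=; exact: integrableR0.
by split.
Qed.

Lemma csquare_le (k : R -> R) f : measurable_fun [set: R] k ->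
  (forall t, `|k t| <= 1) -> csquare f -> csquare (fun t => (k t)%:C * f t).
Proof.
move=> mk k1 [[m1 f1] [m2 f2]].
have e (t : R) : re ((k t)%:C * f t) = k t * re (f t) /\
  im ((k t)%:C * f t) = k t * im (f t).
  by rewrite !reimE !mul0r subr0 addr0.
split; under eq_fun do rewrite ?(e _).1 ?(e _).2.
  apply: (squareR_le (g := fun t => re (f t))) => //; first exact: measurable_funM.
  by move=> t; rewrite normrM ler_piMl.
apply: (squareR_le (g := fun t => im (f t))) => //; first exact: measurable_funM.
by move=> t; rewrite normrM ler_piMl.
Qed.

Lemma eq_sqnorm f g : f =1 g -> sqnorm f = sqnorm g.
Proof. by move=> fg; apply: eq_Rint => t; rewrite fg. Qed.

Lemma eq_csquare f g : f =1 g -> csquare f -> csquare g.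
Proof. by move=> /funext ->. Qed.

Lemma sqnormN f : sqnorm (fun t => - f t) = sqnorm f.
Proof. by apply: eq_Rint => t; rewrite normsqN. Qed.

Lemma sqnorm_conj f : sqnorm (fun t => conjc (f t)) = sqnorm f.
Proof. by apply: eq_Rint => t; rewrite normsq_conj. Qed.

Lemma sqnormZ c f : csquare f -> sqnorm (fun t => c * f t) = normsq c * sqnorm f.
Proof.
move=> hf; rewrite /sqnorm -RintZ; last exact: csquare_normsq.
by apply: eq_Rint => t; rewrite normsqM.
Qed.

Lemma sqnorm_subC f g : sqnorm (fun t => f t - g t) = sqnorm (fun t => g t - f t).
Proof. by rewrite -sqnormN; apply: eq_sqnorm => t; rewrite opprB. Qed.

Lemma sqnorm0 : sqnorm (fun=> 0) = 0.
Proof.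
rewrite /sqnorm -[RHS](@Rint0 R); apply: eq_Rint => t.
by rewrite /normsq/= expr0n addr0.
Qed.

Lemma sqnorm_eq0 f : csquare f -> sqnorm f = 0 -> {ae mu, forall t, f t = 0}.
Proof.
move=> hf h0; have hn := csquare_normsq hf.
have : (\int[mu]_t `|(normsq (f t))%:E| = 0)%E.
  under eq_integral do rewrite gee0_abs ?lee_fin ?normsq_ge0//.
  by rewrite -RintE// -/(sqnorm f) h0.
move/ae_eq_integral_abs => /(_ measurableT) h.
have {h} h := h (measurable_int _ hn).
by apply: ae_imp h => t /(_ I) [] /normsq_eq0.
Qed.

Lemma cmeasurable_ae_sqnorm f g : csquare f -> csquare g ->
  {ae mu, forall t, f t = g t} -> sqnorm f = sqnorm g.
Proof.
move=> hf hg fg; apply: Rint_ae_eq.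
- exact: integrableR_measurable (csquare_normsq hf).
- exact: integrableR_measurable (csquare_normsq hg).
- by apply: ae_imp fg => t ->.
Qed.

(* The real part of the inner product; Im <f, g> is the real part of <f, 'i g>. *)
Definition rinner f g : R := \int[mu]_t (re (f t) * re (g t) + im (f t) * im (g t)).

Lemma integrableR_rinner f g : csquare f -> csquare g ->
  integrableR (fun t => re (f t) * re (g t) + im (f t) * im (g t)).
Proof. by move=> [f1 f2] [g1 g2]; apply: integrableRD; exact: squareR_mul. Qed.

Lemma sqnormD f g : csquare f -> csquare g ->
  sqnorm (fun t => f t + g t) = sqnorm f + 2 * rinner f g + sqnorm g.
Proof.
move=> hf hg; rewrite /sqnorm /rinner.
have i1 := csquare_normsq hf; have i2 := csquare_normsq hg.
have i3 := integrableR_rinner hf hg.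
rewrite -(RintZ 2 i3) -RintD//; last exact: integrableRZ.
rewrite -RintD//; last by apply: integrableRD => //; exact: integrableRZ.
by apply: eq_Rint => t; rewrite /normsq !reimE; ring.
Qed.

Lemma rinnerN f g : csquare f -> csquare g -> rinner f (fun t => - g t) = - rinner f g.
Proof.
move=> hf hg; rewrite /rinner -(RintN (integrableR_rinner hf hg)).
by apply: eq_Rint => t; rewrite !reimE; ring.
Qed.

Lemma sqnormB f g : csquare f -> csquare g ->
  sqnorm (fun t => f t - g t) = sqnorm f - 2 * rinner f g + sqnorm g.
Proof.
move=> hf hg; rewrite sqnormD ?rinnerN ?sqnormN//; first by ring.
exact: csquareN.
Qed.

Lemma rinner_polar f g : csquare f -> csquare g ->
  rinner f g = (sqnorm (fun t => f t + g t) - sqnorm (fun t => f t - g t)) / 4.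
Proof. by move=> hf hg; rewrite sqnormB// sqnormD//; field. Qed.

Lemma sqnorm_triangle f g : csquare f -> csquare g ->
  sqnorm (fun t => f t + g t) <= 2 * sqnorm f + 2 * sqnorm g.
Proof.
move=> hf hg; have := sqnorm_ge0 (fun t => f t - g t).
by rewrite sqnormB// sqnormD//; lra.
Qed.

Lemma cauchy_schwarz f g : csquare f -> csquare g ->
  rinner f g ^+ 2 <= sqnorm f * sqnorm g.
Proof.
move=> hf hg; set B := rinner f g.
have q (s t : R) : 0 <= s ^+ 2 * sqnorm f + 2 * s * t * B + t ^+ 2 * sqnorm g.
  have := sqnorm_ge0 (fun x => s%:C * f x + t%:C * g x).
  rewrite sqnormD; [|exact: csquareZ|exact: csquareZ].
  rewrite !sqnormZ//; have -> : rinner (fun x => s%:C * f x) (fun x => t%:C * g x) = s * t * B.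
    rewrite /B /rinner -(RintZ _ (integrableR_rinner hf hg)).
    by apply: eq_Rint => x; rewrite !reimE; ring.
  by rewrite /normsq !reimE expr0n/= !addr0; nra.
have f0 := sqnorm_ge0 f; have g0 := sqnorm_ge0 g.
(* At (|g|^2, - B) the quadratic form equals |g|^2 (|f|^2 |g|^2 - B^2). *)
have [gp|] := ltP 0 (sqnorm g).
  by have := q (sqnorm g) (- B); nra.
move=> g_le0; have g_eq : sqnorm g = 0 by lra.
(* If |g| = 0, the form at this point is - B^2 (|f|^2 + 2), which forces B = 0. *)
have := q (- B) (sqnorm f + 1); rewrite g_eq mulr0.
by have := sqr_ge0 B; nra.
Qed.

Lemma sqnorm_cvg (u : nat -> R -> R[i]) f : (forall n, csquare (u n)) -> csquare f ->
  sqnorm (fun t => u n t - f t) @[n --> \oo] --> (0 : R) ->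
  sqnorm (u n) @[n --> \oo] --> sqnorm f.
Proof.
move=> hu hf cu.
pose h n := Num.sqrt (sqnorm f) * Num.sqrt (sqnorm (fun t => u n t - f t)).
have hn n : csquare (fun t => u n t - f t) by exact: csquareB.
have ch : h n @[n --> \oo] --> (0 : R).
  rewrite -[X in _ --> X](mulr0 (Num.sqrt (sqnorm f))); apply: cvgM; first exact: cvg_cst.
  by rewrite -sqrtr0; exact: (cvg_comp _ _ cu (@sqrt_continuous R 0)).
have cB : rinner f (fun t => u n t - f t) @[n --> \oo] --> (0 : R).
  apply/norm_cvg0P.
  apply: (@squeeze_cvgr _ _ _ _ (fun=> 0) h) => //; last exact: cvg_cst.
  apply: nearW => n; rewrite normr_ge0/= /h -sqrtrM ?sqnorm_ge0// -sqrtr_sqr.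
  by rewrite ler_wsqrtr// cauchy_schwarz.
have -> : (fun n => sqnorm (u n)) = (fun n => sqnorm f +
    2 * rinner f (fun t => u n t - f t) + sqnorm (fun t => u n t - f t)).
  apply/funext => n; rewrite -sqnormD//; apply: eq_sqnorm => t.
  by rewrite addrC subrK.
rewrite -[X in _ --> X]addr0 -[X in _ --> X + _]addr0.
apply: cvgD => //; apply: cvgD; first exact: cvg_cst.
by rewrite -[X in _ --> X](mulr0 2); apply: cvgM => //; exact: cvg_cst.
Qed.

Lemma sqnorm_cvgD (u v : nat -> R -> R[i]) f g :
  (forall n, csquare (u n)) -> (forall n, csquare (v n)) -> csquare f -> csquare g ->
  sqnorm (fun t => u n t - f t) @[n --> \oo] --> (0 : R) ->
  sqnorm (fun t => v n t - g t) @[n --> \oo] --> (0 : R) ->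
  sqnorm (fun t => (u n t + v n t) - (f t + g t)) @[n --> \oo] --> (0 : R).
Proof.
move=> hu hv hf hg cu cv.
apply: (@squeeze_cvgr _ _ _ _ (fun=> 0) (fun n => 2 * sqnorm (fun t => u n t - f t) +
  2 * sqnorm (fun t => v n t - g t))).
- apply: nearW => n; rewrite sqnorm_ge0/=.
  rewrite (_ : sqnorm _ = sqnorm (fun t => (u n t - f t) + (v n t - g t))); last first.
    by apply: eq_sqnorm => t; ring.
  by apply: sqnorm_triangle; exact: csquareB.
- exact: cvg_cst.
- rewrite -[X in _ --> X]addr0 -[X in _ --> X + X](mulr0 2).
  by apply: cvgD; (apply: cvgM; [exact: cvg_cst|]).
Qed.

Lemma sqnorm_cvgZ (u : nat -> R -> R[i]) f c :
  (forall n, csquare (u n)) -> csquare f ->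
  sqnorm (fun t => u n t - f t) @[n --> \oo] --> (0 : R) ->
  sqnorm (fun t => c * u n t - c * f t) @[n --> \oo] --> (0 : R).
Proof.
move=> hu hf cu.
have -> : (fun n => sqnorm (fun t => c * u n t - c * f t)) =
  (fun n => normsq c * sqnorm (fun t => u n t - f t)).
  apply/funext => n; rewrite -sqnormZ; last exact: csquareB.
  by apply: eq_sqnorm => t; rewrite mulrBr.
by rewrite -[X in _ --> X](mulr0 (normsq c)); apply: cvgM => //; exact: cvg_cst.
Qed.

Lemma rinner_cvg (u v : nat -> R -> R[i]) f g :
  (forall n, csquare (u n)) -> (forall n, csquare (v n)) -> csquare f -> csquare g ->
  sqnorm (fun t => u n t - f t) @[n --> \oo] --> (0 : R) ->
  sqnorm (fun t => v n t - g t) @[n --> \oo] --> (0 : R) ->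
  rinner (u n) (v n) @[n --> \oo] --> rinner f g.
Proof.
move=> hu hv hf hg cu cv; rewrite rinner_polar//.
have -> : (fun n => rinner (u n) (v n)) = (fun n =>
  (sqnorm (fun t => u n t + v n t) - sqnorm (fun t => u n t - v n t)) / 4).
  by apply/funext => n; rewrite rinner_polar.
apply: cvgM; last exact: cvg_cst.
apply: cvgB; apply: sqnorm_cvg.
- by move=> n; exact: csquareD.
- exact: csquareD.
- exact: sqnorm_cvgD.
- by move=> n; exact: csquareB.
- exact: csquareB.
- have cv' := sqnorm_cvgZ (-1) hv hg cv.
  have := sqnorm_cvgD hu (fun n => csquareZ (-1) (hv n)) hf (csquareZ (-1) hg) cu cv'.
  by apply: eq_cvg_seq => n; apply: eq_sqnorm => t; rewrite !mulN1r.
Qed.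

Lemma cLnorm_cvg0P (u : nat -> R -> R[i]) f : (forall n, csquare (u n)) -> csquare f ->
  cLnorm 2%:E (fun t => u n t - f t) @[n --> \oo] --> 0%E <->
  sqnorm (fun t => u n t - f t) @[n --> \oo] --> (0 : R).
Proof.
move=> hu hf; have hn n := csquareB (hu n) hf.
have -> : (fun n => cLnorm 2%:E (fun t => u n t - f t)) =
  (fun n => (Num.sqrt (sqnorm (fun t => u n t - f t)))%:E).
  by apply/funext => n; rewrite cLnorm2E.
split=> [/fine_cvg h|h].
  have {h} h : Num.sqrt (sqnorm (fun t => u n t - f t)) @[n --> \oo] --> (0 : R) := h.
  pose v n := Num.sqrt (sqnorm (fun t => u n t - f t)).
  apply: (@eq_cvg_seq R (fun n => v n * v n)).
    by move=> n; rewrite /v -expr2 sqr_sqrtr// sqnorm_ge0.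
  by rewrite -[X in _ --> X](mulr0 0); apply: cvgM.
apply: cvg_EFin; first exact: nearW.
by rewrite -sqrtr0; exact: (cvg_comp _ _ h (@sqrt_continuous R 0)).
Qed.

End complex_L2.

(** * Complex integrals and the Fourier integral on L^1 and L^2 *)

Section complex_integral.
Context {R : realType}.
Local Notation mu := (@lebesgue_measure R).
Implicit Types (f g h : R -> R[i]) (c : R[i]).

Lemma re_cintegral f : re (cintegral f) = \int[mu]_t re (f t).
Proof. by []. Qed.

Lemma im_cintegral f : im (cintegral f) = \int[mu]_t im (f t).
Proof. by []. Qed.

Lemma cintegrableD f g : cintegrable f -> cintegrable g ->
  cintegrable (fun t => f t + g t).
Proof.
move=> [f1 f2] [g1 g2]; split; under eq_fun do rewrite reimE; exact: integrableRD.
Qed.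

Lemma cintegrableZ c f : cintegrable f -> cintegrable (fun t => c * f t).
Proof.
move=> [f1 f2]; split; under eq_fun do rewrite reimE.
  by apply: integrableRB; exact: integrableRZ.
by apply: integrableRD; exact: integrableRZ.
Qed.

Lemma cintegrable_conj f : cintegrable f -> cintegrable (fun t => conjc (f t)).
Proof.
move=> [f1 f2]; split; under eq_fun do rewrite reimE; [by []|exact: integrableRN].
Qed.

Lemma cintegralD f g : cintegrable f -> cintegrable g ->
  cintegral (fun t => f t + g t) = cintegral f + cintegral g.
Proof.
move=> [f1 f2] [g1 g2]; apply: complexP.
  rewrite re_add !re_cintegral -RintD//.
  by apply: eq_Rint => t; rewrite reimE.
rewrite im_add !im_cintegral -RintD//.
by apply: eq_Rint => t; rewrite reimE.
Qed.

Lemma cintegralZ c f : cintegrable f ->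
  cintegral (fun t => c * f t) = c * cintegral f.
Proof.
move=> [f1 f2]; apply: complexP.
  rewrite re_mul !re_cintegral !im_cintegral -(RintZ _ f1) -(RintZ _ f2).
  rewrite -RintB; [|exact: integrableRZ|exact: integrableRZ].
  by apply: eq_Rint => t; rewrite reimE.
rewrite im_mul !re_cintegral !im_cintegral -(RintZ _ f1) -(RintZ _ f2).
rewrite -RintD; [|exact: integrableRZ|exact: integrableRZ].
by apply: eq_Rint => t; rewrite reimE.
Qed.

Lemma eq_cintegral f g : f =1 g -> cintegral f = cintegral g.
Proof. by move=> /funext ->. Qed.

Lemma cintegral_conj f : cintegrable f ->
  cintegral (fun t => conjc (f t)) = conjc (cintegral f).
Proof.
move=> [f1 f2]; apply: complexP.
  rewrite re_conj !re_cintegral.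
  by apply: eq_Rint => t; rewrite reimE.
rewrite im_conj !im_cintegral -RintN//.
by apply: eq_Rint => t; rewrite reimE.
Qed.

Lemma cintegrable_mul_bounded M g f : cmeasurable g ->
  (forall t, modulus (g t) <= M) -> cintegrable f ->
  cintegrable (fun t => g t * f t).
Proof.
move=> [m1 m2] gM [f1 f2].
have gr t : `|re (g t)| <= M by apply: le_trans (gM t); exact: re_le_modulus.
have gi t : `|im (g t)| <= M by apply: le_trans (gM t); exact: im_le_modulus.
split; under eq_fun do rewrite reimE.
  by apply: integrableRB; [exact: integrableR_mul_bounded gr f1|
    exact: integrableR_mul_bounded gi f2].
by apply: integrableRD; [exact: integrableR_mul_bounded gr f2|
  exact: integrableR_mul_bounded gi f1].
Qed.

Lemma csquare_cintegrable_mul (k : R -> R) f : squareR k -> csquare f ->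
  cintegrable (fun t => (k t)%:C * f t).
Proof.
move=> hk [f1 f2]; split; under eq_fun do rewrite !reimE !mul0r ?subr0 ?addr0.
  exact: squareR_mul.
exact: squareR_mul.
Qed.

Lemma expi_modulus (x : R) : modulus (expi x) = 1.
Proof. by rewrite modulusE /normsq/= cos2Dsin2 sqrtr1. Qed.

Lemma expiD (x y : R) : expi (x + y) = expi x * expi y.
Proof. by apply: complexP; rewrite reimE/= ?cosD ?sinD//; ring. Qed.

Lemma expi0 : expi (0 : R) = 1.
Proof. by rewrite /expi cos0 sin0. Qed.

Lemma conj_expi (x : R) : conjc (expi x) = expi (- x).
Proof. by apply: complexP; rewrite reimE/= ?cosN ?sinN. Qed.

Lemma cmeasurable_expi (k : R -> R) : measurable_fun [set: R] k ->
  cmeasurable (fun t => expi (k t)).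
Proof.
by move=> mk; split; [exact: (measurableT_comp measurable_cosR mk)|
  exact: (measurableT_comp measurable_sinR mk)].
Qed.

Lemma cintegrable_expi (b : R) f : cintegrable f ->
  cintegrable (fun t => f t * expi (b * t)).
Proof.
move=> hf; have m := cmeasurable_expi (measurable_mulc b).
have := cintegrable_mul_bounded m (M := 1) _ hf.
under [X in _ -> cintegrable X]eq_fun do rewrite mulrC.
by apply=> t; rewrite expi_modulus.
Qed.

Lemma fourier_integralE f xi :
  fourier_integral f xi = cintegral (fun t => f t * expi (- (2 * pi * xi) * t)).
Proof. by apply: eq_cintegral => t; rewrite mulNr. Qed.

Lemma fourier_integral_linear c f g xi : cintegrable f -> cintegrable g ->
  fourier_integral (fun t => c * f t + g t) xi =
  c * fourier_integral f xi + fourier_integral g xi.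
Proof.
move=> hf hg; rewrite !fourier_integralE.
have i1 := cintegrable_expi (- (2 * pi * xi)) hf.
have i2 := cintegrable_expi (- (2 * pi * xi)) hg.
rewrite -(cintegralZ c i1) -cintegralD//; last exact: cintegrableZ.
by apply: eq_cintegral => t; rewrite mulrDl mulrA.
Qed.

Lemma re_fourier_integral f xi : cintegrable f ->
  re (fourier_integral f xi) =
  cosT (fun t => re (f t)) xi + sinT (fun t => im (f t)) xi.
Proof.
move=> [f1 f2]; rewrite /cosT /sinT -RintD; last 2 first.
- exact: integrableR_mcos.
- exact: integrableR_msin.
rewrite re_cintegral; apply: eq_Rint => t.
by rewrite reimE/= cosN sinN mulrN opprK.
Qed.

Lemma im_fourier_integral f xi : cintegrable f ->
  im (fourier_integral f xi) =
  cosT (fun t => im (f t)) xi - sinT (fun t => re (f t)) xi.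
Proof.
move=> [f1 f2]; rewrite /cosT /sinT -RintB; last 2 first.
- exact: integrableR_mcos.
- exact: integrableR_msin.
rewrite im_cintegral; apply: eq_Rint => t.
by rewrite reimE/= cosN sinN mulrN addrC.
Qed.

Lemma cosTN (a : R -> R) xi : cosT a (- xi) = cosT a xi.
Proof. by apply: eq_Rint => t; rewrite mulrN mulNr cosN. Qed.

Lemma sinTN (a : R -> R) xi : integrableR a -> sinT a (- xi) = - sinT a xi.
Proof.
move=> ha; rewrite /sinT -RintN; last exact: integrableR_msin.
by apply: eq_Rint => t; rewrite mulrN mulNr sinN mulrN.
Qed.

Lemma squareR_cosT (a : R -> R) : integrableR a -> squareR a -> squareR (cosT a).
Proof.
move=> ha h2; have [i1 _] := plancherel_real ha h2.
have m := measurable_cosT ha; split=> //; apply: integrableR_le i1.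
  exact: measurable_funX.
by move=> x; rewrite ger0_norm ?sqr_ge0// lerDl sqr_ge0.
Qed.

Lemma squareR_sinT (a : R -> R) : integrableR a -> squareR a -> squareR (sinT a).
Proof.
move=> ha h2; have [i1 _] := plancherel_real ha h2.
have m := measurable_sinT ha; split=> //; apply: integrableR_le i1.
  exact: measurable_funX.
by move=> x; rewrite ger0_norm ?sqr_ge0// lerDr sqr_ge0.
Qed.

Lemma csquare_fourier_integral f : cintegrable f -> csquare f ->
  csquare (fourier_integral f).
Proof.
move=> hf [s1 s2]; have [f1 f2] := hf; split.
  under eq_fun do rewrite re_fourier_integral//.
  by apply: squareRD; [exact: squareR_cosT|exact: squareR_sinT].
under eq_fun do rewrite im_fourier_integral//.
by apply: squareRB; [exact: squareR_cosT|exact: squareR_sinT].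
Qed.

(** For f = a + i b the cross terms between the transforms of a and b are odd in xi and integrate to
    0; the real case applied to a and to b gives the rest. *)
Lemma plancherel_L1L2 f : cintegrable f -> csquare f ->
  sqnorm (fourier_integral f) = sqnorm f.
Proof.
move=> hf h2; have [s1 s2] := h2; have [f1 f2] := hf.
pose a t := re (f t); pose b t := im (f t).
have [ia ea] := plancherel_real f1 s1; have [ib eb] := plancherel_real f2 s2.
have i1 := squareR_mul (squareR_cosT f1 s1) (squareR_sinT f2 s2).
have i2 := squareR_mul (squareR_cosT f2 s2) (squareR_sinT f1 s1).
have iab := integrableRB i1 i2.
have odd : \int[mu]_x (cosT a x * sinT b x - cosT b x * sinT a x) = 0.
  apply: Rint_odd iab _ => x; rewrite !cosTN (sinTN _ f1) (sinTN _ f2); ring.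
rewrite (sqnormE h2) -ea -eb -(RintD ia ib) -[RHS]addr0 -[in RHS](mulr0 2) -odd.
rewrite -(RintZ 2 iab) -RintD; [|exact: integrableRD|exact: integrableRZ].
apply: eq_Rint => xi; rewrite /normsq re_fourier_integral// im_fourier_integral//.
by rewrite /a /b; ring.
Qed.

(** On the four real components this is the symmetry of the cosine and sine kernels, [Rint_cosT] and
    [Rint_sinT]. It identifies the adjoint as conjugate, transform, conjugate. *)
Lemma fourier_integral_adjoint f k : cintegrable f -> csquare f ->
  cintegrable k -> csquare k ->
  rinner (fourier_integral f) k =
  rinner f (fun x => conjc (fourier_integral (fun t => conjc (k t)) x)).
Proof.
move=> hf f2 hk k2; have hck := cintegrable_conj hk.
have [fr fi] := hf; have [kr ki] := hk; have [fr2 fi2] := f2; have [kr2 ki2] := k2.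
pose a t := re (f t); pose b t := im (f t); pose p t := re (k t); pose q t := im (k t).
have c1 : squareR (cosT a) := squareR_cosT fr fr2.
have c2 : squareR (cosT b) := squareR_cosT fi fi2.
have c3 : squareR (cosT p) := squareR_cosT kr kr2.
have c4 : squareR (cosT q) := squareR_cosT ki ki2.
have d1 : squareR (sinT a) := squareR_sinT fr fr2.
have d2 : squareR (sinT b) := squareR_sinT fi fi2.
have d3 : squareR (sinT p) := squareR_sinT kr kr2.
have d4 : squareR (sinT q) := squareR_sinT ki ki2.
have reE x : re (conjc (fourier_integral (fun t => conjc (k t)) x)) = cosT p x - sinT q x.
  rewrite reimE re_fourier_integral//; congr (_ + _).
    by apply: eq_Rint => t; rewrite reimE.
  rewrite /sinT -RintN; last exact: integrableR_msin.
  by apply: eq_Rint => t; rewrite reimE mulNr.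
have imE x : im (conjc (fourier_integral (fun t => conjc (k t)) x)) = cosT q x + sinT p x.
  rewrite reimE im_fourier_integral// opprB addrC; congr (_ + _).
    rewrite /cosT -RintN; last by apply: integrableR_mcos; have [] := hck.
    by apply: eq_Rint => t; rewrite reimE mulNr opprK.
  by apply: eq_Rint => t; rewrite reimE.
transitivity ((\int[mu]_x (cosT a x * p x) + \int[mu]_x (sinT b x * p x)) +
   (\int[mu]_x (cosT b x * q x) - \int[mu]_x (sinT a x * q x))).
  have j1 := squareR_mul c1 kr2; have j2 := squareR_mul d2 kr2.
  have j3 := squareR_mul c2 ki2; have j4 := squareR_mul d1 ki2.
  rewrite -(RintD j1 j2) -(RintB j3 j4) -(RintD (integrableRD j1 j2) (integrableRB j3 j4)).
  apply: eq_Rint => x; rewrite re_fourier_integral// im_fourier_integral//.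
  by rewrite /a /b /p /q; ring.
rewrite (Rint_cosT fr kr) (Rint_cosT fi ki) (Rint_sinT fr ki) (Rint_sinT fi kr).
have j1 := squareR_mul fr2 c3; have j2 := squareR_mul fi2 d3.
have j3 := squareR_mul fi2 c4; have j4 := squareR_mul fr2 d4.
rewrite -(RintD j1 j2) -(RintB j3 j4) -(RintD (integrableRD j1 j2) (integrableRB j3 j4)).
by apply: eq_Rint => x; rewrite reE imE /a /b; ring.
Qed.

End complex_integral.

(** * Completeness *)

Section riesz_fischer.
Context {R : realType}.
Local Notation mu := (@lebesgue_measure R).

(** Summability of the weighted squares 2 ^ k d_k ^ 2 thus yields absolute summability of d_k, which
    is how [cvg_telescope] works. *)
Let am_gm (k : nat) (d : R) : `|d| <= (2 ^+ k)^-1 + 2 ^+ k * d ^+ 2.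
Proof.
have c0 : 0 < (2 : R) ^+ k by rewrite exprn_gt0.
rewrite -(ler_pM2r c0) mulrDl mulVf ?gt_eqF// -[d ^+ 2]real_normK ?num_real//.
by have := sqr_ge0 (1 - `|d| * 2 ^+ k); have := normr_ge0 d; nra.
Qed.

Let cvg_telescope (v : nat -> R) (s : R) :
  (forall n, \sum_(0 <= k < n) (2 ^+ k * (v k.+1 - v k) ^+ 2) <= s) -> cvgn v.
Proof.
move=> vs; pose d k := v k.+1 - v k.
have c1 : cvgn (series (fun k => 2 ^+ k * d k ^+ 2)).
  apply: nondecreasing_is_cvgn.
    by apply/nondecreasing_seqP => n; rewrite /series/= big_nat_recr//= lerDl mulr_ge0 ?sqr_ge0 ?exprn_ge0.
  by exists s => _ [n _ <-]; exact: vs.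
have c2 : cvgn (series (fun k => ((2 : R) ^+ k)^-1)).
  rewrite (_ : (fun k => _) = geometric 1 2^-1); last first.
    by apply/funext => k; rewrite /geometric/= mul1r exprVn.
  by apply: is_cvg_geometric_series; rewrite ger0_norm ?invr_ge0// invf_lt1// ltr1n.
have c3 : cvgn (series d).
  apply: normed_cvg; apply: (series_le_cvg _ _ (fun k => am_gm k (d k))) => //.
    move=> k; apply: addr_ge0; first by rewrite invr_ge0 exprn_ge0.
    by apply: mulr_ge0; [exact: exprn_ge0|exact: sqr_ge0].
  rewrite (_ : series _ = series (fun k => (2 ^+ k)^-1) +
      series (fun k => 2 ^+ k * d k ^+ 2)); first exact: is_cvgD.
  by apply/funext => n; rewrite fctE /series/= big_split.
have -> : v = (fun n => series d n + v 0%N).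
  by apply/funext => n; rewrite /series/= telescope_sumr// subrK.
by apply: is_cvgD => //; exact: is_cvg_cst.
Qed.

(** A fast subsequence has almost everywhere summable weighted squared increments, hence an almost
    everywhere limit; Fatou along it shows that the whole sequence converges to this limit in
    L^2. *)
Lemma riesz_fischer (v : nat -> R -> R) : (forall n, squareR (v n)) ->
  (forall e, 0 < e -> exists N, forall m n, (N <= m)%N -> (N <= n)%N ->
    \int[mu]_t (v n t - v m t) ^+ 2 <= e) ->
  exists w, squareR w /\ \int[mu]_t (v n t - w t) ^+ 2 @[n --> \oo] --> (0 : R).
Proof.
move=> hv cauchy.
(* The weight 2 ^ k of [cvg_telescope] times this bound is 2 ^ -(k + 1), which is summable. *)
pose e_ (k : nat) : R := (2 ^+ k.+1)^-1 / 2 ^+ k.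
have e_0 k : 0 < e_ k by rewrite divr_gt0 ?invr_gt0 ?exprn_gt0.
pose N k := projT1 (cid (cauchy _ (e_0 k))).
have NP k m n : (N k <= m)%N -> (N k <= n)%N -> \int[mu]_t (v n t - v m t) ^+ 2 <= e_ k.
  exact: (projT2 (cid (cauchy _ (e_0 k)))).
(* The maximum makes the indices monotone and at least [N k]; the summand k sends them to
   infinity. *)
pose nk k := (k + \max_(i < k.+1) N i)%N.
have nkN k : (N k <= nk k)%N.
  by rewrite (leq_trans _ (leq_addl _ _))// (bigD1 ord_max)//= leq_maxl.
have nkS k : (nk k <= nk k.+1)%N.
  by rewrite leq_add// [leqRHS]big_ord_recr/= leq_maxl.
have nk_ge k : (k <= nk k)%N by rewrite leq_addr.
pose d k t := v (nk k.+1) t - v (nk k) t.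
have hd k : squareR (d k) by exact: squareRB.
have dI k : \int[mu]_t d k t ^+ 2 <= e_ k.
  by apply: NP; [exact: nkN|exact: leq_trans (nkN _) (nkS _)].
pose F k t : \bar R := (2 ^+ k * d k t ^+ 2)%:E.
have iF k : integrableR (fun t => 2 ^+ k * d k t ^+ 2).
  by apply: integrableRZ; have [] := hd k.
have F0 k t : (0 <= F k t)%E by rewrite lee_fin mulr_ge0 ?sqr_ge0 ?exprn_ge0.
have mF k : measurable_fun [set: R] (F k) by exact: measurable_int (iF k).
have sumF : (\int[mu]_t \sum_(k <oo) F k t < +oo)%E.
  rewrite integral_nneseries//.
  apply: le_lt_trans (_ : (\sum_(k <oo) (1 / (2 ^ k.+1)%:R)%:E < +oo)%E).
    apply: lee_nneseries => [k _ _|k _]; first exact: integral_ge0.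
    rewrite -(RintE (iF k)) lee_fin RintZ; last by have [] := hd k.
    rewrite div1r natrX mulrC -ler_pdivlMr ?exprn_gt0//; exact: dI.
  by apply: le_lt_trans (@epsilon_trick0 R 1 xpredT ler01) _; rewrite ltry.
have aeF : {ae mu, forall t, cvgn (fun k => v (nk k) t)}.
  have iS : mu.-integrable [set: R] (fun t => \sum_(k <oo) F k t)%E.
    apply/integrableP; split; first by apply: ge0_emeasurable_sum => [k t _ _|k _]; [exact: F0|exact: mF].
    under eq_integral do rewrite gee0_abs ?nneseries_ge0//.
    exact: sumF.
  have := integrable_ae measurableT iS; apply: ae_imp => t /(_ I) fin.
  apply: (@cvg_telescope _ (fine (\sum_(k <oo) F k t))) => n.
  rewrite -lee_fin fineK// -sumEFin.
  by apply: (@nneseries_lim_ge R (F^~ t) xpredT 0%N n) => k _ _; exact: F0.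
(* The upper limit exists everywhere and is measurable; [fine] sends its infinite values to 0. *)
pose w t := fine (limn_esup (fun k => (v (nk k) t)%:E)).
have mw : measurable_fun [set: R] w.
  apply: measurableT_comp; first exact: fine_measurable.
  apply: measurable_fun_limn_esup => k.
  by apply/measurable_EFinP; have [] := hv (nk k).
have cw : {ae mu, forall t, v (nk k) t @[k --> \oo] --> w t}.
  apply: ae_imp aeF => t /cvg_ex[l cl].
  have cE : (v (nk k) t)%:E @[k --> \oo] --> l%:E.
    by apply: cvg_EFin => //; exact: nearW.
  rewrite /w is_cvg_limn_esupE; last by apply/cvg_ex; exists l%:E.
  by rewrite (cvg_lim _ cE).
have key e : 0 < e -> exists M, forall m, (M <= m)%N ->
    integrableR (fun t => (w t - v m t) ^+ 2) /\ \int[mu]_t (w t - v m t) ^+ 2 <= e.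
  move=> e0; have [M hM] := cauchy e e0; exists M => m Mm.
  apply: (Rint_fatou (f_ := fun k t => (v (nk k) t - v m t) ^+ 2)).
  - by move=> k; have [] := squareRB (hv (nk k)) (hv m).
  - by move=> k t; exact: sqr_ge0.
  - exists M => // k /= Mk; apply: hM => //; exact: leq_trans Mk (nk_ge k).
  - by apply: measurable_funX; apply: measurable_funB => //; have [] := hv m.
  - apply: ae_imp cw => t ct.
    apply: (@cvg_comp _ _ _ (fun k => v (nk k) t - v m t) (fun y => y ^+ 2)); last first.
      exact: exprn_continuous.
    by apply: cvgB => //; exact: cvg_cst.
  - by move=> t; exact: sqr_ge0.
have hw : squareR w.
  have [M hM] := key 1 ltr01; have [i1 _] := hM M (leqnn M).
  have hb : squareR (fun t => w t - v M t).
    by split=> //; apply: measurable_funB => //; have [] := hv M.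
  have := squareRD hb (hv M); by under eq_fun do rewrite subrK.
exists w; split=> //; apply/cvgr0Pnorm_le => e e0.
have [M hM] := key e e0; exists M => // m /= Mm.
rewrite ger0_norm; last by apply: ge0_Rint => t; exact: sqr_ge0.
have [_] := hM m Mm; apply: le_trans; rewrite le_eqVlt; apply/orP; left; apply/eqP.
by apply: eq_Rint => t; rewrite -sqrrN opprB.
Qed.

Lemma complex_riesz_fischer (v : nat -> R -> R[i]) : (forall n, csquare (v n)) ->
  (forall e, 0 < e -> exists N, forall m n, (N <= m)%N -> (N <= n)%N ->
    sqnorm (fun t => v n t - v m t) <= e) ->
  exists w, csquare w /\ sqnorm (fun t => v n t - w t) @[n --> \oo] --> (0 : R).
Proof.
move=> hv cauchy.
have part (p : R[i] -> R) : (forall z w, p (z - w) = p z - p w) ->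
    (forall z, p z ^+ 2 <= normsq z) -> (forall n, squareR (fun t => p (v n t))) ->
    exists w, squareR w /\
      \int[mu]_t (p (v n t) - w t) ^+ 2 @[n --> \oo] --> (0 : R).
  move=> pB p_le hp; apply: (riesz_fischer (v := fun n t => p (v n t))) => // e e0.
  have [N hN] := cauchy e e0; exists N => m n Nm Nn.
  apply: le_trans (hN m n Nm Nn); apply: le_Rint.
  - by have [] := squareRB (hp n) (hp m).
  - exact: csquare_normsq (csquareB (hv n) (hv m)).
  - by move=> t; rewrite -pB.
have [a [ha ca]] : exists w, squareR w /\
    \int[mu]_t (re (v n t) - w t) ^+ 2 @[n --> \oo] --> (0 : R).
  apply: part => [z w|z|n]; [by rewrite !reimE|by rewrite lerDl sqr_ge0|].
  by have [] := hv n.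
have [b [hb cb]] : exists w, squareR w /\
    \int[mu]_t (im (v n t) - w t) ^+ 2 @[n --> \oo] --> (0 : R).
  apply: part => [z w|z|n]; [by rewrite !reimE|by rewrite lerDr sqr_ge0|].
  by have [] := hv n.
have hw : csquare (fun t => a t +i* b t) by split.
exists (fun t => a t +i* b t); split=> //.
apply: (@eq_cvg_seq R (fun n => \int[mu]_t (re (v n t) - a t) ^+ 2 +
  \int[mu]_t (im (v n t) - b t) ^+ 2)).
  move=> n; rewrite sqnormE; last exact: csquareB.
  by congr (_ + _); apply: eq_Rint => t; rewrite !reimE.
by rewrite -[X in _ --> X]addr0; apply: cvgD.
Qed.

End riesz_fischer.

(** * The Fourier transform on square integrable functions *)

Section fourier_transform.
Context {R : realType}.
Local Notation mu := (@lebesgue_measure R).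
Implicit Types (f g h k : R -> R[i]) (c : R[i]) (u v : nat -> R -> R[i]).

Let L1L2 f := cintegrable f /\ csquare f.

Let approx u f g := [/\ forall n, L1L2 (u n),
  sqnorm (fun t => u n t - f t) @[n --> \oo] --> (0 : R) &
  sqnorm (fun x => fourier_integral (u n) x - g x) @[n --> \oo] --> (0 : R)].

Let F_csquare f : L1L2 f -> csquare (fourier_integral f).
Proof. by move=> [h1 h2]; exact: csquare_fourier_integral. Qed.

Lemma is_fourierP f g : csquare f ->
  is_fourier f g <-> csquare g /\ exists u, approx u f g.
Proof.
move=> hf; split=> [[/inL2P hg [u [hu cu cFu]]]|[hg [u [hu cu cFu]]]].
  split=> //; exists u.
  have hu' n : L1L2 (u n) by have [/inL1P ? /inL2P ?] := hu n.
  split=> //.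
  - by apply/cLnorm_cvg0P => // n; have [] := hu' n.
  - by apply/cLnorm_cvg0P => // n; exact: F_csquare.
split; first exact/inL2P.
exists u; split.
- by move=> n; have [? ?] := hu n; split; [exact/inL1P|exact/inL2P].
- by apply/cLnorm_cvg0P => // n; have [] := hu n.
- by apply/cLnorm_cvg0P => // n; exact: F_csquare.
Qed.

Let L1L2_lin c f g : L1L2 f -> L1L2 g -> L1L2 (fun t => c * f t + g t).
Proof.
move=> [f1 f2] [g1 g2]; split.
  by apply: cintegrableD => //; exact: cintegrableZ.
by apply: csquareD => //; exact: csquareZ.
Qed.

Let sqnorm_F f g : L1L2 f -> L1L2 g ->
  sqnorm (fun x => fourier_integral f x - fourier_integral g x) =
  sqnorm (fun t => f t - g t).
Proof.
move=> hf hg; have [f1 f2] := hf; have [g1 g2] := hg.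
have [h1 h2] := L1L2_lin (-1) hg hf.
rewrite (@eq_sqnorm _ _ (fourier_integral (fun t => -1 * g t + f t))); last first.
  by move=> x; rewrite fourier_integral_linear// mulN1r addrC.
rewrite plancherel_L1L2//; apply: eq_sqnorm => t.
by rewrite mulN1r addrC.
Qed.

Lemma is_fourier_L1L2 f : cintegrable f -> csquare f ->
  is_fourier f (fourier_integral f).
Proof.
move=> f1 f2; apply/is_fourierP => //; split; first exact: F_csquare.
exists (fun=> f); split=> //.
  rewrite (@eq_sqnorm _ (fun t => f t - f t) (fun=> 0)); last by move=> t; rewrite subrr.
  by rewrite sqnorm0; exact: cvg_cst.
rewrite (@eq_sqnorm _ (fun x => fourier_integral f x - fourier_integral f x) (fun=> 0)).
  by rewrite sqnorm0; exact: cvg_cst.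
by move=> t; rewrite subrr.
Qed.

Lemma is_fourier_linear c f g f' g' : csquare f -> csquare g ->
  is_fourier f f' -> is_fourier g g' ->
  is_fourier (fun t => c * f t + g t) (fun x => c * f' x + g' x).
Proof.
move=> hf hg /(is_fourierP _ hf)[hf' [u [hu cu cFu]]].
move=> /(is_fourierP _ hg)[hg' [v [hv cv cFv]]].
have u2 n : csquare (u n) by have [] := hu n.
have v2 n : csquare (v n) by have [] := hv n.
have Fu n := F_csquare (hu n); have Fv n := F_csquare (hv n).
apply/is_fourierP; first by apply: csquareD => //; exact: csquareZ.
split; first by apply: csquareD => //; exact: csquareZ.
exists (fun n t => c * u n t + v n t); split.
- by move=> n; exact: L1L2_lin.
- apply: sqnorm_cvgD => //; [by move=> n; exact: csquareZ|exact: csquareZ|].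
  exact: sqnorm_cvgZ.
- apply: (@eq_cvg_seq R (fun n => sqnorm (fun x => (c * fourier_integral (u n) x +
    fourier_integral (v n) x) - (c * f' x + g' x)))).
    move=> n; apply: eq_sqnorm => x.
    by rewrite fourier_integral_linear//; [have [] := hu n|have [] := hv n].
  apply: sqnorm_cvgD => //; [by move=> n; exact: csquareZ|exact: csquareZ|].
  exact: sqnorm_cvgZ.
Qed.

(** The isometry on L^1 and L^2 passes to limits. Combined with linearity it yields uniqueness of
    the transform and injectivity. *)
Lemma is_fourier_sqnorm f g : csquare f -> is_fourier f g -> sqnorm g = sqnorm f.
Proof.
move=> hf /(is_fourierP _ hf)[hg [u [hu cu cFu]]].
have c1 := sqnorm_cvg (fun n => (hu n).2) hf cu.
have c2 := sqnorm_cvg (fun n => F_csquare (hu n)) hg cFu.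
apply: (cvg_seq_unique c2); apply: eq_cvg_seq c1 => n.
by have [h1 h2] := hu n; rewrite plancherel_L1L2.
Qed.

Lemma is_fourier_unique f g g' : csquare f -> is_fourier f g -> is_fourier f g' ->
  {ae mu, forall x, g x = g' x}.
Proof.
move=> hf hg hg'; have [/inL2P h1 _] := hg; have [/inL2P h2 _] := hg'.
have h := is_fourier_linear (-1) hf hf hg hg'.
have h0 : sqnorm (fun x => -1 * g x + g' x) = 0.
  rewrite (is_fourier_sqnorm _ h); last by apply: csquareD => //; exact: csquareZ.
  rewrite (@eq_sqnorm _ _ (fun=> 0)) ?sqnorm0// => t.
  by rewrite mulN1r addNr.
have := sqnorm_eq0 _ h0; move=> /(_ (csquareD (csquareZ (-1) h1) h2)).
by apply: ae_imp => x; rewrite mulN1r addrC => /eqP; rewrite subr_eq0 => /eqP.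
Qed.

Lemma is_fourier_ae f f' g g' : csquare f -> csquare f' -> csquare g' ->
  {ae mu, forall t, f t = f' t} -> {ae mu, forall x, g x = g' x} ->
  is_fourier f g -> is_fourier f' g'.
Proof.
move=> hf hf' hg' ff' gg' /(is_fourierP _ hf)[hg [u [hu cu cFu]]].
apply/is_fourierP => //; split=> //; exists u; split=> //.
- apply: eq_cvg_seq cu => n; have [_ h2] := hu n.
  apply: cmeasurable_ae_sqnorm; [exact: csquareB|exact: csquareB|].
  by apply: ae_imp ff' => t ->.
- apply: eq_cvg_seq cFu => n; have h2 := F_csquare (hu n).
  apply: cmeasurable_ae_sqnorm; [exact: csquareB|exact: csquareB|].
  by apply: ae_imp gg' => t ->.
Qed.

Lemma is_fourier_adjoint f g k z : csquare f -> csquare k -> is_fourier f g ->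
  is_fourier (fun t => conjc (k t)) z ->
  rinner g k = rinner f (fun t => conjc (z t)).
Proof.
move=> hf hk /(is_fourierP _ hf)[hg [u [hu cu cFu]]].
have hck := csquare_conj hk.
move=> /(is_fourierP _ hck)[hz [v [hv cv cFv]]].
have conj_sq (w w' : R -> R[i]) : sqnorm (fun t => conjc (w t) - conjc (w' t)) =
    sqnorm (fun t => w t - w' t).
  rewrite -[RHS]sqnorm_conj; apply: eq_sqnorm => t.
  by apply: complexP; rewrite !reimE; ring.
have cv' : sqnorm (fun t => conjc (v n t) - k t) @[n --> \oo] --> (0 : R).
  apply: eq_cvg_seq cv => n; rewrite -[RHS]sqnorm_conj; apply: eq_sqnorm => t.
  by apply: complexP; rewrite !reimE; ring.
have cFv' : sqnorm (fun x => conjc (fourier_integral (v n) x) - conjc (z x))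
    @[n --> \oo] --> (0 : R).
  by apply: eq_cvg_seq cFv => n; rewrite conj_sq.
have c1 := rinner_cvg (fun n => F_csquare (hu n)) (fun n => csquare_conj (hv n).2)
  hg hk cFu cv'.
have c2 := rinner_cvg (fun n => (hu n).2) (fun n => csquare_conj (F_csquare (hv n)))
  hf (csquare_conj hz) cu cFv'.
apply: (cvg_seq_unique c1); apply: eq_cvg_seq c2 => n.
have [u1 u2] := hu n; have [v1 v2] := hv n.
rewrite (fourier_integral_adjoint u1 u2 (cintegrable_conj v1) (csquare_conj v2)).
apply: eq_Rint => x; congr (_ * re (conjc (fourier_integral _ x)) +
  _ * im (conjc (fourier_integral _ x))).
  by apply/funext => t; rewrite conjcK.
by apply/funext => t; rewrite conjcK.
Qed.

Let squareR_cutoff (n : R) : squareR (cutoff n).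
Proof.
have m : measurable_fun [set: R] (cutoff n).
  by apply: continuous_measurable_fun; exact: cutoff_continuous.
split=> //; apply: integrableR_le (integrable_indic_itv (- (n + 1)) (n + 1) true false).
  exact: measurable_funX.
move=> x; rewrite normrX indicE ger0_norm ?cutoff_ge0//.
have [xn|xn] := leP `|x| (n + 1).
  rewrite mem_set ?exprn_ile1 ?cutoff_ge0 ?cutoff_le1//=.
  by rewrite in_itv/= -ler_norml.
by rewrite cutoff0 ?expr0n//= ltW.
Qed.

(** The truncations of f are integrable and converge to f in L^2; by isometry their Fourier
    integrals form a Cauchy sequence, and completeness gives the limit. *)
Lemma is_fourier_exists f : csquare f -> exists g, is_fourier f g.
Proof.
move=> hf; pose u (n : nat) t := (cutoff n%:R t)%:C * f t.
have mc n : measurable_fun [set: R] (cutoff (n : R)) by have [] := squareR_cutoff n.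
have hu n : L1L2 (u n).
  split; first by apply: csquare_cintegrable_mul => //; exact: squareR_cutoff.
  apply: csquare_le => // t; rewrite ger0_norm ?cutoff_ge0//; exact: cutoff_le1.
have u2 n : csquare (u n) by have [] := hu n.
have cu : sqnorm (fun t => u n t - f t) @[n --> \oo] --> (0 : R).
  have [_] : integrableR (fun=> 0 : R) /\
      \int[mu]_t normsq (u n t - f t) @[n --> \oo] --> \int[mu]_t (0 : R).
    apply: (Rint_dominated (g := fun t => normsq (f t))) => //.
    - by move=> n; apply: integrableR_measurable (csquare_normsq (csquareB (u2 n) hf)).
    - exact: csquare_normsq.
    - move=> n t; rewrite ger0_norm ?normsq_ge0//.
      have -> : u n t - f t = (cutoff n%:R t - 1)%:C * f t.
        by rewrite /u; apply: complexP; rewrite !reimE; ring.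
      rewrite normsqM ler_piMl ?normsq_ge0// /normsq !reimE expr0n addr0.
      rewrite -[leRHS](expr1n _ 2) -[leLHS]real_normK ?num_real//.
      rewrite lerXn2r ?nnegrE// ler_norml.
      by have := cutoff_ge0 n%:R t; have := cutoff_le1 n%:R t; lra.
    - apply: ae_all => t.
      apply: (@eq_cvg_seq R (fun n => (cutoff n%:R t - 1) ^+ 2 * normsq (f t))).
        by move=> n; rewrite /u /normsq !reimE; ring.
      rewrite -[X in _ --> X](mul0r (normsq (f t))); apply: cvgM; last exact: cvg_cst.
      have -> : 0 = (1 - 1) ^+ 2 :> R by rewrite subrr expr0n.
      apply: (@cvg_comp _ _ _ (fun n => cutoff n%:R t - 1) (fun y => y ^+ 2)); last first.
        exact: exprn_continuous.
      by apply: cvgB; [exact: cutoff_cvg|exact: cvg_cst].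
  by rewrite Rint0.
have [w [hw cw]] : exists w, csquare w /\
    sqnorm (fun x => fourier_integral (u n) x - w x) @[n --> \oo] --> (0 : R).
  apply: complex_riesz_fischer => [n|e e0]; first exact: F_csquare.
  have e4 : 0 < e / 4 by rewrite divr_gt0.
  move/cvgr0Pnorm_le : cu => /(_ _ e4)[N _ hN]; exists N => m n Nm Nn.
  rewrite sqnorm_F// (@eq_sqnorm _ _ (fun t => (u n t - f t) + (f t - u m t))); last first.
    by move=> t; ring.
  apply: le_trans (sqnorm_triangle (csquareB (u2 n) hf) (csquareB hf (u2 m))) _.
  rewrite (sqnorm_subC f); have := hN n Nn; have := hN m Nm.
  by rewrite /= !ger0_norm ?sqnorm_ge0//; lra.
by exists w; apply/is_fourierP => //; split=> //; exists u; split.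
Qed.

Lemma fourierP f : csquare f -> is_fourier f (fourier f).
Proof.
move=> hf; rewrite /fourier; case: xgetP => [g -> //|h].
by have [g hg] := is_fourier_exists hf; case: (h g).
Qed.

Lemma csquare_fourier f : csquare f -> csquare (fourier f).
Proof. by move=> /fourierP[/inL2P]. Qed.

Lemma is_fourierE f g : csquare f -> is_fourier f g ->
  {ae mu, forall x, fourier f x = g x}.
Proof. by move=> hf; apply: is_fourier_unique => //; exact: fourierP. Qed.

Lemma fourier_L1L2 f : cintegrable f -> csquare f ->
  {ae mu, forall x, fourier f x = fourier_integral f x}.
Proof. by move=> f1 f2; apply: is_fourierE => //; exact: is_fourier_L1L2. Qed.

Lemma fourier_linear c f g : csquare f -> csquare g ->
  {ae mu, forall x, fourier (fun t => c * f t + g t) x = c * fourier f x + fourier g x}.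
Proof.
move=> hf hg; apply: is_fourierE; first by apply: csquareD => //; exact: csquareZ.
by apply: is_fourier_linear => //; exact: fourierP.
Qed.

Lemma fourier_ae f g : csquare f -> csquare g -> {ae mu, forall t, f t = g t} ->
  {ae mu, forall x, fourier f x = fourier g x}.
Proof.
move=> hf hg fg; apply: is_fourierE => //.
apply: (is_fourier_ae hg hf (csquare_fourier hg) _ _ (fourierP hg)).
  by apply: ae_imp fg => t ->.
exact: ae_all.
Qed.

Lemma sqnorm_fourier f : csquare f -> sqnorm (fourier f) = sqnorm f.
Proof. by move=> hf; apply: is_fourier_sqnorm => //; exact: fourierP. Qed.

Lemma fourier_inj f g : csquare f -> csquare g ->
  {ae mu, forall x, fourier f x = fourier g x} -> {ae mu, forall t, f t = g t}.
Proof.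
move=> hf hg fg; have hfg := csquareD (csquareZ (-1) hf) hg.
have : sqnorm (fun t => -1 * f t + g t) = 0.
  rewrite -sqnorm_fourier// -[RHS](@sqnorm0 R).
  apply: cmeasurable_ae_sqnorm; [exact: csquare_fourier|exact: csquare0|].
  by apply: ae_imp2 fg (fourier_linear (-1) hf hg) => x -> ->; rewrite mulN1r addNr.
move=> /(sqnorm_eq0 hfg); apply: ae_imp => t.
by rewrite mulN1r addrC => /eqP; rewrite subr_eq0 => /eqP.
Qed.

Lemma rinner_fourier f g : csquare f -> csquare g ->
  rinner (fourier f) (fourier g) = rinner f g.
Proof.
move=> hf hg; have Ff := csquare_fourier hf; have Fg := csquare_fourier hg.
have e1 := sqnormB Ff Fg; have e2 := sqnormB hf hg.
have := is_fourier_sqnorm _ (is_fourier_linear (-1) hg hf (fourierP hg) (fourierP hf)).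
move=> /(_ (csquareD (csquareZ (-1) hg) hf)).
have sE (p q : R -> R[i]) : sqnorm (fun x => -1 * q x + p x) = sqnorm (fun x => p x - q x).
  by apply: eq_sqnorm => x; rewrite mulN1r addrC.
rewrite !sE e1 e2 (sqnorm_fourier hf) (sqnorm_fourier hg).
by move=> /addIr/addrI/oppr_inj/mulfI; apply; rewrite pnatr_eq0.
Qed.

(* F^* k := conj (F (conj k)) is the adjoint of F and an isometry, so that
   |F F^* k - k|^2 = |k|^2 + |k|^2 - 2 |F^* k|^2 = 0. *)
Lemma fourier_surj k : csquare k ->
  exists f, csquare f /\ {ae mu, forall x, fourier f x = k x}.
Proof.
move=> hk; have hck := csquare_conj hk.
pose f x := conjc (fourier (fun t => conjc (k t)) x).
have hf : csquare f by exact/csquare_conj/csquare_fourier.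
exists f; split=> //.
have nf : sqnorm f = sqnorm k.
  by rewrite /f sqnorm_conj sqnorm_fourier// sqnorm_conj.
have h := is_fourier_adjoint hf hk (fourierP hf) (fourierP hck).
have rff : rinner f f = sqnorm f by apply: eq_Rint => t; rewrite /normsq; ring.
have Ff := csquare_fourier hf.
have : sqnorm (fun x => fourier f x - k x) = 0.
  by rewrite sqnormB// h rff sqnorm_fourier// nf; ring.
move/(sqnorm_eq0 (csquareB Ff hk)); apply: ae_imp => x /eqP.
by rewrite subr_eq0 => /eqP.
Qed.

Lemma fourier_invP f : csquare f -> csquare (fourier_inv f) /\
  {ae mu, forall x, fourier (fourier_inv f) x = f x}.
Proof.
move=> hf; have [g [hg gf]] := fourier_surj hf.
rewrite /fourier_inv; case: xgetP => [h -> [/inL2P hh hF]//|h].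
by case: (h g); split=> //; exact/inL2P.
Qed.

Lemma fourier_invK f : csquare f -> {ae mu, forall t, fourier_inv (fourier f) t = f t}.
Proof.
move=> hf; have [h1 h2] := fourier_invP (csquare_fourier hf).
exact: fourier_inj.
Qed.

End fourier_transform.

(** * Entire power series *)

Section power_series.
Context {R : realType}.
Implicit Types (G H : R -> R[i]) (a b : nat -> R[i]).

Lemma modulus0 : modulus (0 : R[i]) = 0.
Proof. by rewrite modulusE /normsq/= expr0n addr0 sqrtr0. Qed.

Lemma modulusM (z w : R[i]) : modulus (z * w) = modulus z * modulus w.
Proof. by rewrite !modulusE normsqM sqrtrM// normsq_ge0. Qed.

Lemma modulusD (z w : R[i]) : modulus (z + w) <= modulus z + modulus w.
Proof. exact: le_normcD. Qed.

Lemma modulusN (z : R[i]) : modulus (- z) = modulus z.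
Proof. by rewrite !modulusE normsqN. Qed.

Lemma modulus_conj (z : R[i]) : modulus (conjc z) = modulus z.
Proof. by rewrite !modulusE normsq_conj. Qed.

Lemma modulus_real (x : R) : modulus x%:C = `|x|.
Proof. by rewrite modulusE /normsq/= expr0n addr0 sqrtr_sqr. Qed.

Lemma modulus1 : modulus (1 : R[i]) = 1.
Proof. by rewrite (modulus_real 1) normr1. Qed.

Lemma modulusX (z : R[i]) n : modulus (z ^+ n) = modulus z ^+ n.
Proof.
by elim: n => [|n IH]; [rewrite !expr0 modulus1|rewrite !exprS modulusM IH].
Qed.

Lemma modulus_eq0 (z : R[i]) : modulus z = 0 -> z = 0.
Proof. exact: eq0_normc. Qed.

Lemma modulus_sum n (F : nat -> R[i]) :
  modulus (\sum_(k < n) F k) <= \sum_(k < n) modulus (F k).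
Proof.
elim: n => [|n IH]; first by rewrite !big_ord0 modulus0.
by rewrite !big_ord_recr/=; apply: le_trans (modulusD _ _) _; rewrite lerD2r.
Qed.

Definition psum a (n : nat) (x : R) : R[i] := \sum_(k < n) a k * (x%:C) ^+ k.

(* G is entire with Taylor coefficients a at 0: on every disk the remainders
   are controlled geometrically. *)
Definition pser G a := forall r : R, 0 < r -> exists C : R,
  forall x n, `|x| <= r -> modulus (G x - psum a n x) <= C * (`|x| / r) ^+ n.

Lemma psumS a n x : psum a n.+1 x = psum a n x + a n * (x%:C) ^+ n.
Proof. by rewrite /psum big_ord_recr. Qed.

Lemma pser_ge0 G a (r C : R) : 0 < r ->
  (forall x n, `|x| <= r -> modulus (G x - psum a n x) <= C * (`|x| / r) ^+ n) -> 0 <= C.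
Proof.
move=> r0 /(_ 0 0%N); rewrite normr0 expr0 mulr1 => /(_ (ltW r0)).
by apply: le_trans; exact: modulus_ge0.
Qed.

(** Cauchy's estimate: a_n r ^ n is the difference of two consecutive remainders at the point r,
    each at most C. *)
Lemma pser_coef_le G a (r C : R) : 0 < r ->
  (forall x n, `|x| <= r -> modulus (G x - psum a n x) <= C * (`|x| / r) ^+ n) ->
  forall n x, modulus (a n * (x%:C) ^+ n) <= 2 * C * (`|x| / r) ^+ n.
Proof.
move=> r0 hC n x; have hr : `|r| <= r by rewrite gtr0_norm.
have h1 := hC r n hr; have h2 := hC r n.+1 hr.
rewrite gtr0_norm// mulfV ?gt_eqF// !expr1n mulr1 in h1 h2.
have h : modulus (a n) * r ^+ n <= 2 * C.
  have -> : modulus (a n) * r ^+ n = modulus ((G r - psum a n r) - (G r - psum a n.+1 r)).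
    rewrite psumS opprD addrACA subrr add0r opprK.
    have -> : - psum a n r + (psum a n r + a n * r%:C ^+ n) = a n * r%:C ^+ n by ring.
    by rewrite modulusM modulusX modulus_real gtr0_norm.
  by apply: le_trans (modulusD _ _) _; rewrite modulusN; lra.
rewrite modulusM modulusX modulus_real expr_div_n mulrA ler_pdivlMr ?exprn_gt0//.
by rewrite mulrAC ler_wpM2r// exprn_ge0.
Qed.

Lemma pser_cst0 : pser (fun=> 0) (fun=> 0).
Proof.
move=> r r0; exists 0 => x n _; rewrite mul0r /psum big1 ?subrr ?modulus0//.
by move=> k _; rewrite mul0r.
Qed.

Let geom_le (C A : R) : (forall n : nat, A <= C * 2^-1 ^+ n) -> A <= 0.
Proof.
move=> h; have cg : C * 2^-1 ^+ n @[n --> \oo] --> (C * 0 : R).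
  apply: cvgM; first exact: cvg_cst.
  by apply: cvg_expr; rewrite ger0_norm ?invr_ge0// invf_lt1// ltr1n.
rewrite mulr0 in cg; rewrite -(cvg_lim _ cg)//.
by apply: limr_ge; [exact: cvgP cg|exact: nearW].
Qed.

Lemma pser_eq0 G : pser G (fun=> 0) -> forall x, G x = 0.
Proof.
move=> hG x; apply: modulus_eq0; apply/eqP; rewrite eq_le modulus_ge0 andbT.
have [->|x0] := eqVneq x 0.
  have [C hC] := hG 1 ltr01.
  have := hC 0 1%N; rewrite normr0 mul0r expr1 mulr0 ler01 => /(_ isT).
  by rewrite /psum big1 ?subr0// => k _; rewrite mul0r.
(* The radius 2 |x| makes the ratio in the remainder bound equal to 1/2. *)
have r0 : 0 < 2 * `|x| by rewrite mulr_gt0 ?normr_gt0.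
have [C hC] := hG _ r0; apply: (@geom_le C) => n.
have := hC x n; rewrite /psum big1 ?subr0; last by move=> k _; rewrite mul0r.
have -> : `|x| / (2 * `|x|) = 2^-1 by field; rewrite normr_eq0.
by apply; have := normr_ge0 x; lra.
Qed.

Lemma pser_sub G H a b : pser G a -> pser H b ->
  pser (fun x => G x - H x) (fun k => a k - b k).
Proof.
move=> ha hb r r0; have [C hC] := ha r r0; have [D hD] := hb r r0.
exists (C + D) => x n xr.
have -> : G x - H x - psum (fun k => a k - b k) n x =
    (G x - psum a n x) + - (H x - psum b n x).
  have -> : psum (fun k => a k - b k) n x = psum a n x - psum b n x.
    by rewrite /psum -sumrB; apply: eq_bigr => k _; exact: mulrBl.
  by ring.
apply: le_trans (modulusD _ _) _; rewrite modulusN mulrDl.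
by apply: lerD; [exact: hC|exact: hD].
Qed.

Lemma pser_ext G H a : pser G a -> pser H a -> forall x, G x = H x.
Proof.
move=> hG hH x; have := pser_sub hG hH.
have -> : (fun k => a k - a k) = fun=> 0 by apply/funext => k; rewrite subrr.
by move=> /pser_eq0 /(_ x) /eqP; rewrite subr_eq0 => /eqP.
Qed.

(** If the coefficients below n agree, comparing the remainders of order n + 1 bounds |a_n - b_n| x
    ^ n by a multiple of x ^ (n + 1); then x tends to 0. *)
Lemma pser_unique G a b : pser G a -> pser G b -> a = b.
Proof.
move=> ha hb; apply/funext => n; elim/ltn_ind: n => n IH.
have [C hC] := ha 1 ltr01; have [D hD] := hb 1 ltr01.
have pE x : psum a n x = psum b n x.
  by apply: eq_bigr => k _; rewrite IH.
have key x : 0 < x -> x <= 1 -> modulus (a n - b n) <= (C + D) * x.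
  move=> x0 x1; have ax : `|x| <= 1 by rewrite gtr0_norm.
  have h1 := hC x n.+1 ax; have h2 := hD x n.+1 ax.
  have e : (a n - b n) * x%:C ^+ n = (G x - psum b n.+1 x) - (G x - psum a n.+1 x).
    by rewrite !psumS pE; ring.
  have : modulus ((a n - b n) * x%:C ^+ n) <= (C + D) * x ^+ n.+1.
    rewrite e; apply: le_trans (modulusD _ _) _; rewrite modulusN.
    by move: h1 h2; rewrite divr1 gtr0_norm//; lra.
  rewrite modulusM modulusX modulus_real gtr0_norm// exprS mulrA.
  by rewrite ler_pM2r ?exprn_gt0.
have : modulus (a n - b n) <= 0.
  apply: (@geom_le (C + D)) => m; apply: key; first by rewrite exprn_gt0 ?invr_gt0.
  by rewrite exprn_ile1 ?invr_ge0// invf_le1// ler1n.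
rewrite le_eqVlt ltNge modulus_ge0 orbF => /eqP/modulus_eq0/eqP.
by rewrite subr_eq0 => /eqP.
Qed.

Lemma pser_conj G a : pser G a -> pser (fun x => conjc (G x)) (fun k => conjc (a k)).
Proof.
move=> ha r r0; have [C hC] := ha r r0; exists C => x n xr.
rewrite -modulus_conj rmorphB/= conjcK /psum rmorph_sum/=.
rewrite (eq_bigr (fun k : 'I_n => a k * x%:C ^+ k)); first exact: hC.
by move=> k _; rewrite rmorphM rmorphXn/= conjcK oppr0.
Qed.

Lemma pser_opp G a : pser G a -> pser (fun x => G (- x)) (fun k => (-1) ^+ k * a k).
Proof.
move=> ha r r0; have [C hC] := ha r r0; exists C => x n xr.
have e : psum a n (- x) = psum (fun k => (-1) ^+ k * a k) n x.
  apply: eq_bigr => k _; have -> : (- x)%:C = -1 * x%:C by rewrite mulN1r rmorphN.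
  by rewrite exprMn mulrCA mulrA.
by have := hC (- x) n; rewrite normrN e => /(_ xr).
Qed.

Definition cauchy_prod a b n : R[i] := \sum_(i < n.+1) a i * b (n - i)%N.

(** The form that fits remainders: each a_i x ^ i meets a partial sum of b whose length n - i makes
    up the total order n. *)
Let psum_cauchy a b n x :
  psum (cauchy_prod a b) n x = \sum_(i < n) a i * x%:C ^+ i * psum b (n - i) x.
Proof.
elim: n => [|n IH]; first by rewrite /psum !big_ord0.
rewrite psumS IH [RHS]big_ord_recr/= subSnn.
have -> : \sum_(i < n) a i * x%:C ^+ i * psum b (n.+1 - i) x =
    \sum_(i < n) (a i * x%:C ^+ i * psum b (n - i) x +
      a i * b (n - i)%N * x%:C ^+ n).
  apply: eq_bigr => i _; rewrite subSn ?(ltnW (ltn_ord i))// psumS mulrDr.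
  congr (_ + _); rewrite mulrACA -exprD subnKC ?(ltnW (ltn_ord i))//.
rewrite big_split/= -addrA; congr (_ + _).
rewrite /cauchy_prod big_ord_recr/= mulrDl mulr_suml; congr (_ + _).
by rewrite subnn psumS /psum big_ord0 add0r expr0; ring.
Qed.

(** The remainder splits into n + 1 terms of size q ^ n, where q is the ratio for the doubled radius
    2 r. The factor n + 1 is at most 2 ^ n, and (2 q) ^ n is the bound wanted for radius r. *)
Lemma pser_mul G H a b : pser G a -> pser H b ->
  pser (fun x => G x * H x) (cauchy_prod a b).
Proof.
move=> ha hb r r0; have r2 : 0 < 2 * r by rewrite mulr_gt0.
have [C hC] := ha _ r2; have [D hD] := hb _ r2.
have C0 := pser_ge0 r2 hC; have D0 := pser_ge0 r2 hD.
exists (2 * C * D) => x n xr; have xr2 : `|x| <= 2 * r by lra.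
pose q := `|x| / (2 * r); have q0 : 0 <= q by rewrite divr_ge0// ltW.
have e : G x * H x - psum (cauchy_prod a b) n x =
    \sum_(i < n) a i * x%:C ^+ i * (H x - psum b (n - i) x) + (G x - psum a n x) * H x.
  have -> : \sum_(i < n) a i * x%:C ^+ i * (H x - psum b (n - i) x) =
      psum a n x * H x - psum (cauchy_prod a b) n x.
    rewrite psum_cauchy {1}/psum mulr_suml -sumrB.
    by apply: eq_bigr => i _; exact: mulrBr.
  by ring.
have h1 : modulus (\sum_(i < n) a i * x%:C ^+ i * (H x - psum b (n - i) x)) <=
    n%:R * (2 * C * D * q ^+ n).
  apply: le_trans (modulus_sum _ (fun i => a i * x%:C ^+ i * (H x - psum b (n - i) x))) _.
  rewrite -[n in n%:R]card_ord mulr_natl -sumr_const; apply: ler_sum => i _.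
  rewrite modulusM -[n in q ^+ n](subnKC (ltnW (ltn_ord i))) exprD.
  have -> : 2 * C * D * (q ^+ i * q ^+ (n - i)) = (2 * C * q ^+ i) * (D * q ^+ (n - i)) by ring.
  apply: ler_pM; rewrite ?modulus_ge0//; [exact: (pser_coef_le r2 hC i x)|exact: hD].
have h2 : modulus ((G x - psum a n x) * H x) <= C * D * q ^+ n.
  rewrite modulusM mulrAC; apply: ler_pM; rewrite ?modulus_ge0//; first exact: hC.
  by have := hD x 0%N xr2; rewrite /psum big_ord0 subr0 expr0 mulr1.
rewrite e; apply: le_trans (modulusD _ _) _; apply: le_trans (lerD h1 h2) _.
have -> : `|x| / r = 2 * q by rewrite /q; field; rewrite gt_eqF.
rewrite (exprMn _ 2 q); have n2 : n.+1%:R <= 2 ^+ n :> R by rewrite -natrX ler_nat ltn_expl.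
pose p := C * D * q ^+ n; have p0 : 0 <= p by rewrite /p !mulr_ge0// exprn_ge0.
have h := ler_wpM2r p0 n2; rewrite -natr1 in h.
have -> : n%:R * (2 * C * D * q ^+ n) + C * D * q ^+ n = 2 * ((n%:R + 1) * p) - p.
  by rewrite /p; ring.
have -> : 2 * C * D * (2 ^+ n * q ^+ n) = 2 * (2 ^+ n * p) by rewrite /p; ring.
by move: h p0; move: (_ * p) (_ * p) => u v; lra.
Qed.

(** If a_p and b_q are the first nonzero coefficients, the coefficient of order p + q of the product
    is a_p b_q. *)
Lemma pser_idom G H a b : pser G a -> pser H b ->
  (forall x, G x * H x = 0) -> (forall x, G x = 0) \/ (forall x, H x = 0).
Proof.
move=> ha hb GH0.
have c0 : cauchy_prod a b = fun=> 0.
  apply: (pser_unique (pser_mul ha hb)); have := pser_cst0.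
  by under [fun x => G x * H x]eq_fun do rewrite GH0.
have [a0|/existsNP/cid[p0 /eqP p0_neq]] := pselect (forall n, a n = 0).
  by left; apply: pser_eq0; rewrite (_ : (fun=> 0) = a)//; apply/funext => n; rewrite a0.
have [b0|/existsNP/cid[q0 /eqP q0_neq]] := pselect (forall n, b n = 0).
  by right; apply: pser_eq0; rewrite (_ : (fun=> 0) = b)//; apply/funext => n; rewrite b0.
have pP : exists n, a n != 0 by exists p0.
have qP : exists n, b n != 0 by exists q0.
pose p := ex_minn pP; pose q := ex_minn qP.
have [ap amin] : a p != 0 /\ forall i, (i < p)%N -> a i = 0.
  rewrite /p; case: ex_minnP => m am mmin; split=> // i im; apply/eqP; apply: contraLR im.
  by move=> /mmin; rewrite -leqNgt.
have [bq bmin] : b q != 0 /\ forall i, (i < q)%N -> b i = 0.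
  rewrite /q; case: ex_minnP => m bm mmin; split=> // i im; apply/eqP; apply: contraLR im.
  by move=> /mmin; rewrite -leqNgt.
have := congr1 (@^~ (p + q)%N) c0; rewrite /= /cauchy_prod.
have pq : (p < (p + q).+1)%N by rewrite ltnS leq_addr.
rewrite (bigD1 (Ordinal pq))//= addKn big1 ?addr0.
  by move=> /eqP; rewrite mulf_eq0 (negPf ap) (negPf bq).
move=> i; rewrite -val_eqE/= neq_ltn => /orP[ip|pi]; first by rewrite amin ?mul0r.
by rewrite bmin ?mulr0// ltn_subLR ?ltn_add2r// -ltnS.
Qed.

Lemma pser_cvg0 G a : pser G a -> forall e, 0 < e -> exists2 d, 0 < d &
  forall x, `|x| <= d -> modulus (G x - G 0) <= e.
Proof.
move=> ha e e0; have [C hC] := ha 1 ltr01; have C0 := pser_ge0 ltr01 hC.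
have h x : `|x| <= 1 -> modulus (G x - a 0%N) <= C * `|x|.
  by move=> x1; have := hC x 1%N x1; rewrite /psum big_ord1 expr0 mulr1 divr1.
have g0 : G 0 = a 0%N.
  have := h 0; rewrite normr0 mulr0 ler01 => /(_ isT).
  rewrite le_eqVlt ltNge modulus_ge0 orbF => /eqP/modulus_eq0/eqP.
  by rewrite subr_eq0 => /eqP.
exists (Num.min 1 (e / (C + 1))).
  by rewrite lt_min ltr01 divr_gt0// ltr_wpDl.
move=> x; rewrite le_min => /andP[x1 xe]; rewrite g0; apply: le_trans (h x x1) _.
have : C * `|x| <= (C + 1) * `|x| by rewrite ler_wpM2r// lerDl.
by move: xe; rewrite ler_pdivlMr ?ltr_wpDl//; lra.
Qed.

End power_series.

(** * Laplace and Fourier transforms of rapidly decaying functions *)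

Section exponential_kernel.
Context {R : realType}.
Local Notation mu := (@lebesgue_measure R).

(* Taylor's formula for y |-> K y = exp (iota * y), with iota a unit: only the
   cases iota = 1 and iota = 'i occur. *)
Definition exp_kernel (K : R -> R[i]) (iota : R[i]) := forall y n,
  modulus (K y - \sum_(k < n) iota ^+ k * ((y ^+ k) / k`!%:R)%:C) <=
  `|y| ^+ n / n`!%:R * expR `|y|.

Let exp_psum (iota : R[i]) (y : R) n : R[i] :=
  \sum_(k < n) iota ^+ k * ((y ^+ k) / k`!%:R)%:C.

Let fact_gt0R n : 0 < n`!%:R :> R. Proof. by rewrite ltr0n fact_gt0. Qed.

Lemma series_exp_le (x : R) n : 0 <= x -> \sum_(k < n) x ^+ k / k`!%:R <= expR x.
Proof.
move=> x0; rewrite -[X in X <= _](big_mkord xpredT (fun k => x ^+ k / k`!%:R)).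
apply: nondecreasing_cvgn_le; last exact: is_cvg_series_exp_coeff.
apply/nondecreasing_seqP => m; rewrite /series/= big_nat_recr//= lerDl.
by rewrite /exp_coeff/= divr_ge0 ?exprn_ge0// ltW.
Qed.

Lemma monomial_le_expR (x : R) n : 0 <= x -> x ^+ n / n`!%:R <= expR x.
Proof.
move=> x0; apply: le_trans (series_exp_le n.+1 x0); rewrite big_ord_recr/= lerDr.
by apply: sumr_ge0 => k _; rewrite divr_ge0 ?exprn_ge0// ltW.
Qed.

Let exp_tail (iota : R[i]) (y : R) n m : modulus iota = 1 ->
  modulus (exp_psum iota y (n + m) - exp_psum iota y n) <=
  `|y| ^+ n / n`!%:R * expR `|y|.
Proof.
move=> i1; have -> : exp_psum iota y (n + m) - exp_psum iota y n =
    \sum_(j < m) iota ^+ (n + j) * ((y ^+ (n + j)) / (n + j)`!%:R)%:C.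
  by rewrite /exp_psum big_split_ord/= addrAC subrr add0r.
apply: le_trans (modulus_sum _ (fun j => iota ^+ (n + j) * ((y ^+ (n + j)) / (n + j)`!%:R)%:C)) _.
apply: le_trans (_ : \sum_(j < m) `|y| ^+ n / n`!%:R * (`|y| ^+ j / j`!%:R) <= _).
  apply: ler_sum => j _; rewrite modulusM modulusX i1 expr1n mul1r modulus_real.
  rewrite normrM normrX normfV (ger0_norm (ltW (fact_gt0R _))) exprD.
  have -> : `|y| ^+ n / n`!%:R * (`|y| ^+ j / j`!%:R) =
      (`|y| ^+ n * `|y| ^+ j) / (n`! * j`!)%:R.
    by rewrite natrM invfM; ring.
  rewrite ler_wpM2l ?mulr_ge0 ?exprn_ge0// lef_pV2 ?posrE ?ltr0n ?muln_gt0 ?fact_gt0//.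
  (* n! j! is at most (n + j)! since the binomial coefficient is positive. *)
  rewrite ler_nat -(@bin_fact (n + j) n) ?leq_addr// addKn.
  by rewrite leq_pmull// bin_gt0 leq_addr.
rewrite -mulr_sumr ler_wpM2l ?divr_ge0 ?exprn_ge0// ?(ltW (fact_gt0R _))//.
exact: series_exp_le.
Qed.

(** The bound in [exp_tail] is uniform in m, so it survives the limit of the partial sums. *)
Let exp_kernel_lim (K : R -> R[i]) (iota : R[i]) : modulus iota = 1 ->
  (forall y, re (exp_psum iota y n) @[n --> \oo] --> re (K y)) ->
  (forall y, im (exp_psum iota y n) @[n --> \oo] --> im (K y)) ->
  exp_kernel K iota.
Proof.
move=> i1 hre him y n; apply/ler_addgt0Pr => e e0.
have e2 : 0 < e / 2 by rewrite divr_gt0.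
move/cvgrPdist_le : (hre y) => /(_ _ e2)[N1 _ h1].
move/cvgrPdist_le : (him y) => /(_ _ e2)[N2 _ h2].
pose m := (n + (N1 + N2))%N.
have m1 : (N1 <= m)%N by rewrite /m addnCA leq_addr.
have m2 : (N2 <= m)%N by rewrite /m addnA leq_addl.
have -> : K y - \sum_(k < n) iota ^+ k * ((y ^+ k) / k`!%:R)%:C =
    (exp_psum iota y m - exp_psum iota y n) + (K y - exp_psum iota y m).
  by rewrite /exp_psum; ring.
apply: le_trans (modulusD _ _) _; apply: lerD; first exact: exp_tail.
apply: le_trans (modulus_le _) _; rewrite re_add re_opp im_add im_opp.
by have := h1 m m1; have := h2 m m2; rewrite /=; lra.
Qed.

Lemma re_sum n (F : nat -> R[i]) : re (\sum_(k < n) F k) = \sum_(k < n) re (F k).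
Proof.
by elim: n => [|n IH]; [rewrite !big_ord0|rewrite !big_ord_recr/= re_add IH].
Qed.

Lemma im_sum n (F : nat -> R[i]) : im (\sum_(k < n) F k) = \sum_(k < n) im (F k).
Proof.
by elim: n => [|n IH]; [rewrite !big_ord0|rewrite !big_ord_recr/= im_add IH].
Qed.

Lemma exp_kernel_expR : exp_kernel (fun y => (expR y)%:C) 1.
Proof.
apply: exp_kernel_lim => [|y|y]; first exact: modulus1.
  apply: eq_cvg_seq (is_cvg_series_exp_coeff y) => n.
  rewrite (re_sum n (fun k => 1 ^+ k * (y ^+ k / k`!%:R)%:C)) /series/= big_mkord.
  by apply: eq_bigr => k _; rewrite expr1n mul1r.
apply: cvg_near_cst; apply: nearW => n.
rewrite (im_sum n (fun k => 1 ^+ k * (y ^+ k / k`!%:R)%:C)) big1//.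
by move=> k _; rewrite expr1n mul1r.
Qed.

Lemma realCM (x y : R) : (x * y)%:C = x%:C * y%:C.
Proof. by apply: complexP; rewrite !reimE; ring. Qed.

Lemma realCX (x : R) k : (x ^+ k)%:C = x%:C ^+ k.
Proof. by elim: k => [//|k IH]; rewrite !exprS -IH rmorphM. Qed.

(** Written in the shape of the signs in [cos_coeff] and [sin_coeff]. *)
Let powi k : ('i%C : R[i]) ^+ k =
  ((~~ odd k)%:R * (-1) ^+ k./2) +i* ((odd k)%:R * (-1) ^+ k.-1./2).
Proof.
have h m : ('i%C : R[i]) ^+ m.*2 = ((-1) ^+ m)%:C.
  rewrite -mul2n exprM sqr_i; elim: m => [//|m IH]; rewrite !exprS IH.
  by apply: complexP; rewrite !reimE/=; ring.
rewrite -[in LHS](odd_double_half k); case: (boolP (odd k)) => ok /=.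
  rewrite add1n exprS h; apply: complexP.
    by rewrite re_mul re_real im_real mulr0 subr0 /= !mul0r.
  rewrite im_mul re_real im_real mulr0 add0r /= !mul1r.
  by congr (_ ^+ _); case: k ok => //= k; rewrite uphalf_half => /negPf ->.
by rewrite add0n h mul1r mul0r.
Qed.

Lemma exp_kernel_expi : exp_kernel (@expi R) 'i%C.
Proof.
apply: exp_kernel_lim => [|y|y].
- by rewrite modulusE /normsq/= expr0n add0r expr1n sqrtr1.
- have h : series (cos_coeff y) n @[n --> \oo] --> cos y.
    by rewrite unlock; exact: is_cvg_series_cos_coeff.
  apply: eq_cvg_seq h => n.
  rewrite (re_sum n (fun k => 'i%C ^+ k * (y ^+ k / k`!%:R)%:C)) /series/= big_mkord.
  apply: eq_bigr => k _; rewrite powi !reimE /= mulr0 subr0 /cos_coeff/=.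
  by rewrite !mulrA.
- have h : series (sin_coeff y) n @[n --> \oo] --> sin y.
    by rewrite unlock; exact: is_cvg_series_sin_coeff.
  apply: eq_cvg_seq h => n.
  rewrite (im_sum n (fun k => 'i%C ^+ k * (y ^+ k / k`!%:R)%:C)) /series/= big_mkord.
  apply: eq_bigr => k _; rewrite powi !reimE /= mulr0 add0r /sin_coeff/=.
  by rewrite !mulrA.
Qed.

Lemma exp_kernel_le K iota y : exp_kernel K iota -> modulus (K y) <= expR `|y|.
Proof.
by move=> /(_ y 0%N); rewrite big_ord0 subr0 expr0 fact0 divr1 mul1r.
Qed.

(** Allowing every exponential weight makes the transforms of g converge everywhere, with Taylor
    remainders controlled at every radius. *)
Definition exp_decay (g : R -> R[i]) := cmeasurable g /\
  forall r, integrableR (fun t => expR (r * `|t|) * modulus (g t)).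

Definition kernel_transform (K : R -> R[i]) (g : R -> R[i]) (y : R) : R[i] :=
  cintegral (fun t => K (y * t) * g t).

(** With the factorial included, these are the Taylor coefficients of [laplace g] at 0; those of
    [vertical g] carry an extra 'i ^ k. *)
Definition moment (g : R -> R[i]) (k : nat) : R[i] :=
  cintegral (fun t => (t ^+ k / k`!%:R)%:C * g t).

Lemma cintegrable_le (f : R -> R[i]) (h : R -> R) : cmeasurable f ->
  (forall t, modulus (f t) <= h t) -> integrableR h -> cintegrable f.
Proof.
move=> [m1 m2] fh ih; split; apply: integrableR_le ih => // t.
  by apply: le_trans (fh t); exact: re_le_modulus.
by apply: le_trans (fh t); exact: im_le_modulus.
Qed.

Lemma integrableR_modulus (f : R -> R[i]) : cintegrable f ->
  integrableR (fun t => modulus (f t)).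
Proof. by move=> /inL1P hf; have [mf _] := hf; move/inL1P: hf => [h1 h2];
apply: integrableR_le (integrableRD (integrableR_norm h1) (integrableR_norm h2));
  [exact: measurable_modulus|move=> t; rewrite ger0_norm ?modulus_ge0//; exact: modulus_le].
Qed.

Lemma modulus_cintegral (f : R -> R[i]) : cintegrable f ->
  modulus (cintegral f) <= \int[mu]_t modulus (f t).
Proof.
move=> hf; set z := cintegral f.
have i1 := cintegrableZ (conjc z) hf.
(* Multiplying by conj z makes the integral real, so that only real parts need to be estimated. *)
have : normsq z <= modulus z * \int[mu]_t modulus (f t).
  have -> : normsq z = re (cintegral (fun t => conjc z * f t)).
    by rewrite cintegralZ// mulrC mul_conj.
  rewrite re_cintegral -(RintZ _ (integrableR_modulus hf)); apply: le_Rint.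
  - by have [] := i1.
  - exact: integrableRZ (integrableR_modulus hf).
  - move=> t; apply: le_trans (ler_norm _) _; apply: le_trans (re_le_modulus _) _.
    by rewrite modulusM modulus_conj.
rewrite -modulus_sqr expr2; have := modulus_ge0 z; rewrite le_eqVlt => /orP[/eqP <- _|z0].
  by apply: ge0_Rint => t; exact: modulus_ge0.
by rewrite ler_pM2l.
Qed.

Lemma cmeasurableM (f g : R -> R[i]) : cmeasurable f -> cmeasurable g ->
  cmeasurable (fun t => f t * g t).
Proof.
move=> [f1 f2] [g1 g2]; split; under eq_fun do rewrite reimE.
  by apply: measurable_funB; exact: measurable_funM.
by apply: measurable_funD; exact: measurable_funM.
Qed.

Lemma cmeasurable_real (k : R -> R) : measurable_fun [set: R] k ->
  cmeasurable (fun t => (k t)%:C).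
Proof. by move=> mk; split. Qed.

Lemma cmeasurable_comp_affine (K : R -> R[i]) (y : R) : cmeasurable K ->
  cmeasurable (fun t => K (y * t)).
Proof.
by move=> [m1 m2]; split; [exact: (measurableT_comp m1 (measurable_mulc y))|
  exact: (measurableT_comp m2 (measurable_mulc y))].
Qed.

Let cint_sum n (F : nat -> R -> R[i]) : (forall k, cintegrable (F k)) ->
  cintegrable (fun t => \sum_(k < n) F k t) /\
  cintegral (fun t => \sum_(k < n) F k t) = \sum_(k < n) cintegral (F k).
Proof.
move=> hF; elim: n => [|n [IH1 IH2]].
  have z : (fun t : R => \sum_(k < 0) F k t) = fun=> 0.
    by apply/funext => t; rewrite big_ord0.
  rewrite z big_ord0; split; first by split; exact: integrableR0.
  by apply: complexP; rewrite ?re_cintegral ?im_cintegral Rint0.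
have e : (fun t : R => \sum_(k < n.+1) F k t) = fun t => \sum_(k < n) F k t + F n t.
  by apply/funext => t; rewrite big_ord_recr.
by rewrite e cintegralD// IH2 big_ord_recr; split=> //; exact: cintegrableD.
Qed.

Section transform.
Variables (K : R -> R[i]) (iota : R[i]) (g : R -> R[i]).
Hypotheses (mK : cmeasurable K) (hK : exp_kernel K iota) (hg : exp_decay g).

Lemma cintegrable_kernel y : cintegrable (fun t => K (y * t) * g t).
Proof.
have [mg ig] := hg; apply: cintegrable_le (ig `|y|).
  by apply: cmeasurableM => //; exact: cmeasurable_comp_affine.
move=> t; rewrite modulusM ler_wpM2r ?modulus_ge0//.
by have := exp_kernel_le (y * t) hK; rewrite normrM.
Qed.

Let cintegrable_moment k : cintegrable (fun t => (t ^+ k / k`!%:R)%:C * g t).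
Proof.
have [mg ig] := hg; apply: cintegrable_le (ig 1).
  apply: cmeasurableM => //; apply: cmeasurable_real.
  by apply: measurable_funM => //; exact: measurable_funX.
move=> t; rewrite modulusM modulus_real ler_wpM2r ?modulus_ge0// mul1r.
by rewrite normrM normrX normfV (ger0_norm (ltW (fact_gt0R _))) monomial_le_expR.
Qed.

Lemma kernel_transform_pser :
  pser (kernel_transform K g) (fun k => iota ^+ k * moment g k).
Proof.
move=> r r0; have [mg ig] := hg.
(* For |x| <= r the kernel remainder is at most (|x| / r) ^ n (r |t|) ^ n / n! exp (r |t|), and the
   monomial costs another exp (r |t|). *)
exists (\int[mu]_t (expR (2 * r * `|t|) * modulus (g t))) => x n xr.
pose F k t := iota ^+ k * x%:C ^+ k * ((t ^+ k / k`!%:R)%:C * g t).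
have iF k : cintegrable (F k) by apply: cintegrableZ.
have [iS eS] := cint_sum n iF.
have e : kernel_transform K g x - psum (fun k => iota ^+ k * moment g k) n x =
    cintegral (fun t => K (x * t) * g t + (-1) * \sum_(k < n) F k t).
  rewrite cintegralD; [|exact: cintegrable_kernel|exact: cintegrableZ].
  rewrite cintegralZ// eS mulN1r; congr (_ - _); apply: eq_bigr => k _.
  by rewrite cintegralZ// /moment mulrAC.
have iE : cintegrable (fun t => K (x * t) * g t + (-1) * \sum_(k < n) F k t).
  by apply: cintegrableD; [exact: cintegrable_kernel|exact: cintegrableZ].
rewrite e; apply: le_trans (modulus_cintegral iE) _; rewrite mulrC.
rewrite -(RintZ _ (ig (2 * r))); apply: le_Rint.
- exact: integrableR_modulus.
- exact: integrableRZ.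
move=> t; have -> : K (x * t) * g t + -1 * \sum_(k < n) F k t =
    (K (x * t) - \sum_(k < n) iota ^+ k * (((x * t) ^+ k) / k`!%:R)%:C) * g t.
  rewrite mulrBl mulN1r; congr (_ - _); rewrite mulr_suml; apply: eq_bigr => k _.
  by rewrite /F exprMn -(mulrA (x ^+ k)) (realCM (x ^+ k)) realCX !mulrA.
rewrite modulusM mulrA ler_wpM2r ?modulus_ge0//; apply: le_trans (hK _ _) _.
have -> : `|x * t| ^+ n / n`!%:R = (`|x| / r) ^+ n * ((r * `|t|) ^+ n / n`!%:R).
  rewrite mulrA -exprMn normrM; congr (_ ^+ _ / _).
  by field; rewrite gt_eqF.
rewrite -mulrA; apply: ler_wpM2l; first by rewrite exprn_ge0// divr_ge0// ltW.
have -> : 2 * r * `|t| = r * `|t| + r * `|t| by ring.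
rewrite expRD; apply: ler_pM.
- by rewrite divr_ge0 ?exprn_ge0// ?mulr_ge0// ltW.
- exact: expR_ge0.
- by apply: monomial_le_expR; rewrite mulr_ge0// ltW.
- by rewrite ler_expR normrM ler_wpM2r.
Qed.

End transform.

Definition laplace := kernel_transform (fun y => (expR y)%:C).

(** The Laplace transform on the imaginary axis, kept as a separate function because [laplace] takes
    real arguments only. *)
Definition vertical := kernel_transform (@expi R).

Let mexp : cmeasurable (fun y : R => (expR y)%:C).
Proof. by apply: cmeasurable_real; exact: measurable_expRR. Qed.

Let mexpi : cmeasurable (@expi R).
Proof. by split; [exact: measurable_cosR|exact: measurable_sinR]. Qed.

Lemma laplace_pser g : exp_decay g -> pser (laplace g) (moment g).
Proof.
move=> hg; have := kernel_transform_pser mexp exp_kernel_expR hg.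
by congr pser; apply/funext => k; rewrite expr1n mul1r.
Qed.

Lemma vertical_pser g : exp_decay g -> pser (vertical g) (fun k => 'i%C ^+ k * moment g k).
Proof. exact: kernel_transform_pser mexpi exp_kernel_expi. Qed.

Lemma cintegrable_laplace g y : exp_decay g -> cintegrable (fun t => (expR (y * t))%:C * g t).
Proof. by move=> hg; exact: (cintegrable_kernel mexp exp_kernel_expR hg y). Qed.

Lemma exp_decay_mul (k : R -> R[i]) (c : R) g : cmeasurable k ->
  (forall t, modulus (k t) <= expR (c * `|t|)) -> exp_decay g ->
  exp_decay (fun t => k t * g t).
Proof.
move=> mk kc [mg ig]; have m := cmeasurableM mk mg; split=> // r.
apply: integrableR_le (ig (r + c)).
  apply: measurable_funM; last exact: measurable_modulus.
  apply: (measurableT_comp measurable_expRR).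
  by apply: (measurableT_comp (measurable_mulc r)); exact: normr_measurable.
move=> t; rewrite ger0_norm ?mulr_ge0 ?expR_ge0 ?modulus_ge0//.
by rewrite modulusM mulrDl expRD mulrA ler_wpM2r ?modulus_ge0// ler_wpM2l ?expR_ge0.
Qed.

Lemma exp_decay_expR (y : R) g : exp_decay g -> exp_decay (fun t => (expR (y * t))%:C * g t).
Proof.
apply: (@exp_decay_mul _ `|y|); first exact: (cmeasurable_comp_affine y mexp).
move=> t; rewrite modulus_real ger0_norm ?expR_ge0// ler_expR.
by rewrite -normrM ler_norm.
Qed.

Lemma exp_decay_expi (y : R) g : exp_decay g -> exp_decay (fun t => expi (y * t) * g t).
Proof.
apply: (@exp_decay_mul _ 0); first exact: (cmeasurable_comp_affine y mexpi).
by move=> t; rewrite expi_modulus mul0r expR0.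
Qed.

Lemma laplace_shift g x y : laplace g (x + y) = laplace (fun t => (expR (x * t))%:C * g t) y.
Proof.
apply: eq_cintegral => t; rewrite mulrDl expRD rmorphM/= mulrA.
by rewrite [in RHS](mulrC (expR (y * t))%:C).
Qed.

Lemma vertical_shift g x y : vertical g (x + y) = vertical (fun t => expi (x * t) * g t) y.
Proof.
apply: eq_cintegral => t; rewrite mulrDl expiD mulrA.
by rewrite [in RHS](mulrC (expi (y * t))).
Qed.

Lemma vertical_continuous g x : exp_decay g -> forall e, 0 < e ->
  exists2 d, 0 < d & forall y, `|y - x| <= d -> modulus (vertical g y - vertical g x) <= e.
Proof.
move=> hg e e0; have [d d0 h] := pser_cvg0 (vertical_pser (exp_decay_expi x hg)) e0.
exists d => // y /h; rewrite -!vertical_shift addr0.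
by rewrite (addrC x) subrK.
Qed.

End exponential_kernel.

(** * Entire functions with equal phaseless products *)

Section entire_functions.
Context {R : realType}.
Implicit Types (F G H : R -> R[i]).

(** The restriction of an entire function to the real line. Expansions at all real centres make the
    class visibly stable under translation. *)
Definition entire F := forall d, exists a, pser (fun x => F (d + x)) a.

Lemma eq_pser G H a : G =1 H -> pser G a -> pser H a.
Proof. by move=> /funext ->. Qed.

Lemma entire_shift F c : entire F -> entire (fun x => F (x + c)).
Proof.
move=> hF d; have [a ha] := hF (d + c); exists a.
by apply: eq_pser ha => x; rewrite addrAC.
Qed.

(** On the real line this agrees with z |-> conj (F (c - conj z)), which is holomorphic. *)
Lemma entire_reflect F c : entire F -> entire (fun x => conjc (F (c - x))).
Proof.
move=> hF d; have [a ha] := hF (c - d); eexists.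
by apply: eq_pser (pser_conj (pser_opp ha)) => x /=; rewrite opprD addrA.
Qed.

Lemma entire_mul F G : entire F -> entire G -> entire (fun x => F x * G x).
Proof.
by move=> hF hG d; have [a ha] := hF d; have [b hb] := hG d; eexists; exact: pser_mul ha hb.
Qed.

Lemma entire_sub F G : entire F -> entire G -> entire (fun x => F x - G x).
Proof.
by move=> hF hG d; have [a ha] := hF d; have [b hb] := hG d; eexists; exact: pser_sub ha hb.
Qed.

Lemma entire_cst_mul (c : R[i]) F : entire F -> entire (fun x => c * F x).
Proof.
move=> hF d; have [a ha] := hF d; exists (fun k => c * a k) => r r0.
have [C hC] := ha r r0; exists (modulus c * C) => x n xr.
have -> : psum (fun k => c * a k) n x = c * psum a n x.
  by rewrite /psum mulr_sumr; apply: eq_bigr => k _; rewrite mulrA.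
by rewrite -mulrBr modulusM -mulrA ler_wpM2l ?modulus_ge0// hC.
Qed.

Lemma entire_idom F G : entire F -> entire G -> (forall x, F x * G x = 0) ->
  (forall x, F x = 0) \/ (forall x, G x = 0).
Proof.
move=> hF hG FG; have [a ha] := hF 0; have [b hb] := hG 0.
have [|h|h] := pser_idom ha hb; first by move=> x; exact: FG.
  by left=> x; rewrite -(add0r x) h.
by right=> x; rewrite -(add0r x) h.
Qed.

Lemma entire_continuous F x e : entire F -> 0 < e -> exists2 d, 0 < d &
  forall y, `|y - x| <= d -> modulus (F y - F x) <= e.
Proof.
move=> hF e0; have [a ha] := hF x; have [d d0 h] := pser_cvg0 ha e0.
by exists d => // y /h; rewrite addr0 (addrC x) subrK.
Qed.

Lemma le_all_eq0 (z : R[i]) : (forall e, 0 < e -> modulus z <= e) -> z = 0.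
Proof.
move=> h; apply: modulus_eq0; apply/eqP; rewrite eq_le modulus_ge0 andbT.
by apply/ler_addgt0Pr => e e0; rewrite add0r h.
Qed.

(** The infimum of the positive elements decides. If it is 0, multiples of small elements approach
    every x, and closedness gives everything; if it is positive it lies in D, and division with
    remainder shows that it generates D. Without positive elements the generator is 0. *)
Lemma closed_subgroup_dichotomy (D : R -> Prop) : D 0 ->
  (forall x y, D x -> D y -> D (x - y)) ->
  (forall x, (forall e, 0 < e -> exists2 y, D y & `|y - x| <= e) -> D x) ->
  (forall x, D x) \/ exists a, forall x, D x -> exists n : int, x = a * n%:~R.
Proof.
move=> D0 DB Dcl.
have DN x : D x -> D (- x) by move=> Dx; rewrite -[- x]add0r; exact: DB.
have DD x y : D x -> D y -> D (x + y).
  by move=> Dx Dy; rewrite -[y]opprK; apply: DB => //; exact: DN.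
have Dn x (n : nat) : D x -> D (x * n%:R).
  move=> Dx; elim: n => [|n IH]; first by rewrite mulr0.
  by rewrite -natr1 mulrDr mulr1; exact: DD.
have Dz x (n : int) : D x -> D (x * n%:~R).
  move=> Dx; case: n => n; first exact: Dn.
  by rewrite NegzE rmorphN/= mulrN; apply: DN; exact: Dn.
pose P : set R := [set x | D x /\ 0 < x].
have [P0|/set0P[p0 Pp0]] := eqVneq P set0.
  right; exists 0 => x Dx; exists 0; rewrite mul0r.
  have nP y : D y -> 0 < y -> False.
    by move=> Dy y0; have : P y by []; rewrite P0.
  have [x0|x0|//] := ltgtP x 0; last by case: (nP x).
  by case: (nP (- x)); [exact: DN|rewrite oppr_gt0].
have lbP : lbound P 0 by move=> y [_ /ltW].
have hiP : has_inf P by split; [exists p0|exists 0].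
pose a := inf P; have a0 : 0 <= a by apply: lb_le_inf; [exists p0|].
have approx e : 0 < e -> exists2 p, P p & p < a + e.
  by move=> e0; have [p Pp pe] := inf_adherent e0 hiP; exists p.
have quot (p x : R) : 0 < p -> 0 <= x - p * (Num.floor (x / p))%:~R < p.
  move=> p1; have := floor_itv (x / p).
  by rewrite intrD1 ler_pdivlMr// ltr_pdivrMr// => /andP[h1 h2]; lra.
have [az|az] := eqVneq a 0.
  left=> x; apply: Dcl => e e0; have [p [Dp p1]] := approx e e0.
  rewrite az add0r => pe; exists (p * (Num.floor (x / p))%:~R); first exact: Dz.
  by rewrite distrC; have /andP[h1 h2] := quot p x p1; rewrite ger0_norm//; lra.
have a1 : 0 < a by rewrite lt_def az.
have Da : D a.
  apply: Dcl => e e0; have [p Pp pe] := approx e e0; have [Dp _] := Pp.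
  exists p => //; have : a <= p by apply: ge_inf => //; exists 0.
  by move=> ap; rewrite ger0_norm; lra.
right; exists a => x Dx; exists (Num.floor (x / a)).
have /andP[h1 h2] := quot a x a1.
have Dr : D (x - a * (Num.floor (x / a))%:~R) by apply: DB => //; exact: Dz.
apply/eqP; rewrite -subr_eq0 eq_le h1 andbT leNgt; apply/negP => r0.
have : a <= x - a * (Num.floor (x / a))%:~R by apply: ge_inf; [exists 0|].
by lra.
Qed.

(* F(u) conj F(v) = H(u) conj H(v) whenever u + v = 4 pi lambda.  Two values of
   lambda make F/H periodic with period d = 4 pi (lambda' - lambda); the periods
   form a closed subgroup, which is all of R unless Lambda lies in a progression. *)
Lemma entire_phase F H (Lambda : set R) : entire F -> entire H ->
  (forall l, Lambda l -> forall x,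
    F (x + 2 * pi * l) * conjc (F (- x + 2 * pi * l)) =
    H (x + 2 * pi * l) * conjc (H (- x + 2 * pi * l))) ->
  ~ (exists A : set R, arithmetic_progression A /\ Lambda `<=` A) ->
  exists tau, modulus tau = 1 /\ forall x, F x = tau * H x.
Proof.
move=> eF eH FH nAP.
(* An empty Lambda lies in every progression, here {0}. *)
have [l0 L0] : Lambda !=set0.
  apply/set0P/negP => /eqP L0; apply: nAP; exists [set 0 * n%:~R + 0 | n in [set: int]].
  by split; [exists 0, 0|rewrite L0; exact: sub0set].
have FH' l y : Lambda l -> F y * conjc (F (4 * pi * l - y)) = H y * conjc (H (4 * pi * l - y)).
  move=> Ll; have := FH l Ll (y - 2 * pi * l); rewrite subrK.
  by have -> : - (y - 2 * pi * l) + 2 * pi * l = 4 * pi * l - y by ring.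
have conj0 (G : R -> R[i]) c : (forall y, conjc (G (c - y)) = 0) -> forall y, G y = 0.
  move=> h y; have := h (c - y); rewrite opprB addrC subrK => /(congr1 conjc).
  by rewrite conjcK => ->; apply: complexP; rewrite /= ?oppr0.
have sq0 (G : R -> R[i]) : entire G ->
    (forall y, G y * conjc (G (4 * pi * l0 - y)) = 0) -> forall y, G y = 0.
  move=> eG h; have [//|] := entire_idom eG (entire_reflect (4 * pi * l0) eG) h.
  exact: conj0.
have one : exists tau : R[i], modulus tau = 1 by exists 1; exact: modulus1.
have [F0|/existsNP[y1 Fy1]] := pselect (forall y, F y = 0).
  exists 1; split; first exact: modulus1; move=> x; rewrite mul1r F0; apply/esym.
  by apply: sq0 => // y; rewrite -FH'// F0 mul0r.
have [H0|/existsNP[z0 Hz0]] := pselect (forall y, H y = 0).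
  exfalso; apply: Fy1; apply: sq0 => // y; by rewrite FH'// H0 mul0r.
(* The statement that d is a period of F / H, with denominators cleared. *)
pose D d := forall y, F y * H (y + d) = H y * F (y + d).
have FHne : ~ (forall y, F y * H y = 0).
  by move=> /(entire_idom eF eH)[]; [exact: (fun h => Fy1 (h y1))|exact: (fun h => Hz0 (h z0))].
(* Stands in for division: F H is not identically zero, so a translate of it can be cancelled from
   an identity between entire functions. *)
have FHn c (E : R -> R[i]) : entire E ->
    (forall y, E y * (F (y + c) * H (y + c)) = 0) -> forall y, E y = 0.
  move=> eE h; have eFH := entire_shift c (entire_mul eF eH).
  have [//|FH0] := entire_idom eE eFH h.
  by case: FHne => y; have := FH0 (y - c); rewrite subrK.
have eD d : entire (fun y => F y * H (y + d) - H y * F (y + d)).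
  by apply: entire_sub; apply: entire_mul => //; exact: entire_shift.
have D0 : D 0 by move=> y; rewrite addr0 mulrC.
have DB x y : D x -> D y -> D (x - y).
  move=> Dx Dy t; apply/eqP; rewrite -subr_eq0; apply/eqP.
  apply: (FHn x _ (eD (x - y))) => u.
  have := Dy (u + (x - y)); have -> : u + (x - y) + y = u + x by ring.
  by move=> h1; have := Dx u => h2; move: (F (u + x)) (H (u + x)) (F u) (H u)
    (F (u + (x - y))) (H (u + (x - y))) h1 h2 => a b c d p q h1 h2; ring: h1 h2.
have Dcl x : (forall e, 0 < e -> exists2 y, D y & `|y - x| <= e) -> D x.
  move=> h y; apply/eqP; rewrite -subr_eq0; apply/eqP; apply: le_all_eq0 => e e0.
  pose E u := F y * H (u + y) - H y * F (u + y).
  have eE : entire E.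
    by apply: entire_sub; apply: entire_cst_mul; exact: entire_shift.
  have [d d0 hd] := entire_continuous x eE e0; have [z Dz zx] := h d d0.
  have := hd z zx; have -> : E z = 0 by rewrite /E (addrC z) (Dz y) subrr.
  by rewrite sub0r modulusN /E (addrC x).
(* The point u for l and the point u + 4 pi (l' - l) for l' have the same partner 4 pi l - u.
   Cross-multiplying the two relations leaves the factor conj (F H) at that partner, which is
   cancelled. *)
have DL l l' : Lambda l -> Lambda l' -> D (4 * pi * (l' - l)).
  move=> Ll Ll' y; apply/eqP; rewrite -subr_eq0; apply/eqP; move: y.
  have eG := entire_reflect (4 * pi * l) (entire_mul eF eH).
  suff EG u : (F u * H (u + 4 * pi * (l' - l)) - H u * F (u + 4 * pi * (l' - l))) *
      conjc (F (4 * pi * l - u) * H (4 * pi * l - u)) = 0.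
    have [//|G0] := entire_idom (eD (4 * pi * (l' - l))) eG EG.
    by case: FHne; exact: conj0 G0.
  have h1 := FH' l u Ll; have h2 := FH' l' (u + 4 * pi * (l' - l)) Ll'.
  have e : 4 * pi * l' - (u + 4 * pi * (l' - l)) = 4 * pi * l - u by ring.
  rewrite e in h2; rewrite rmorphM/=; move: h1 h2.
  move: (F u) (H u) (F (u + _)) (H (u + _)) (conjc (F _)) (conjc (H _)).
  by move=> p q p' q' s t h1 h2; ring: h1 h2.
have [Dall|[a Da]] := closed_subgroup_dichotomy D0 DB Dcl; last first.
  (* Each 4 pi (l - l0) is an integer multiple of a. *)
  case: nAP; exists [set (a / (4 * pi)) * n%:~R + l0 | n in [set: int]].
  split; first by exists (a / (4 * pi)), l0.
  move=> l Ll; have [n hn] := Da _ (DL l0 l L0 Ll); exists n => //.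
  have p0 : 4 * pi != 0 :> R by rewrite mulf_neq0 ?gt_eqF ?pi_gt0.
  by rewrite mulrAC -hn mulrAC mulfV// mul1r subrK.
have Hz : H z0 != 0 by apply/eqP.
(* Every real number is a period, so F / H is the constant read off at a point where H does not
   vanish. *)
pose tau := F z0 / H z0.
have Ft y : F y = tau * H y.
  have := Dall (z0 - y) y; rewrite (addrC y) subrK => h.
  by apply: (mulIf Hz); rewrite h /tau mulrAC mulfVK// mulrC.
exists tau; split=> //; rewrite modulusE.
(* The relation at [l0] becomes (|tau|^2 - 1) H (y) conj (H (4 pi l0 - y)) = 0; for |tau| other than
   1, [sq0] would make H vanish. *)
have [->|t1] := eqVneq (normsq tau) 1; first by rewrite sqrtr1.
case: Hz0; apply: sq0 => // y; have := FH' l0 y L0; rewrite !Ft rmorphM/=.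
have -> : tau * H y * (conjc tau * conjc (H (4 * pi * l0 - y))) =
    tau * conjc tau * (H y * conjc (H (4 * pi * l0 - y))) by ring.
rewrite mul_conj => /eqP; rewrite -subr_eq0 -[X in _ - X]mul1r -mulrBl mulf_eq0.
move=> /orP[/eqP h|/eqP //]; case/eqP: t1.
by have := congr1 (@complex.Re R) h; rewrite reimE /= => /eqP; rewrite subr_eq0 => /eqP.
Qed.

End entire_functions.

(** * Gaussian windows *)

Section windowed.
Context {R : realType}.
Local Notation mu := (@lebesgue_measure R).
Implicit Types (f g h : R -> R[i]).

Lemma measurable_gaussian (l : R) : measurable_fun [set: R] (fun t => gaussian (t - l)).
Proof.
apply: (measurableT_comp measurable_expRR); apply: measurableT_comp => //.
apply: measurable_funM => //; apply: measurable_funX.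
exact: measurable_funB.
Qed.

Lemma gaussian_gt0 (t : R) : 0 < gaussian t.
Proof. exact: expR_gt0. Qed.

Lemma gaussian_le1 (t : R) : gaussian t <= 1.
Proof. by rewrite -expR0 ler_expR oppr_le0 mulr_ge0 ?pi_ge0// sqr_ge0. Qed.

(** Moving the centre of the window costs an exponential factor, that is, a shift of the Laplace
    variable by 2 pi l. *)
Lemma gaussianB (t l : R) :
  gaussian (t - l) = gaussian l * (expR (2 * pi * l * t) * gaussian t).
Proof. by rewrite /gaussian -!expRD; congr expR; move: pi => p; ring. Qed.

Lemma measurable_exp_norm (r : R) : measurable_fun [set: R] (fun t : R => expR (r * `|t|)).
Proof.
apply: (measurableT_comp measurable_expRR).
by apply: (measurableT_comp (measurable_mulc r)); exact: normr_measurable.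
Qed.

Lemma squareR_exp_gaussian (r l : R) :
  squareR (fun t => expR (r * `|t|) * gaussian (t - l)).
Proof.
have me : measurable_fun [set: R] (fun t => expR (r * `|t|) * gaussian (t - l)).
  by apply: measurable_funM; [exact: measurable_exp_norm|exact: measurable_gaussian].
(* Since pi >= 1, twice the exponent plus |t| is at most m |t| - 2 (t - l)^2, hence at most m |l| +
   m s - 2 s^2 with s = |t - l|; the maximum of m s - 2 s^2 is m^2 / 8. *)
split=> //; pose m := `|2 * r + 1|.
apply: integrableR_le (integrableRZ (expR (m * `|l| + m ^+ 2 / 8)) (integrableR_expRN_norm ltr01)).
  exact: measurable_funX.
move=> t; rewrite ger0_norm ?sqr_ge0// /gaussian -!expRD expr2 -expRD ler_expR mul1r.
have p1 : 1 <= pi :> R by apply: le_trans (pi_ge2 R); rewrite ler1n.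
have h1 : `|t| <= `|t - l| + `|l| by rewrite -[X in `|X| <= _](subrK l) ler_normD.
have h2 : (2 * r + 1) * `|t| <= m * `|t| by rewrite ler_wpM2r ?ler_norm.
have h3 : m * `|t| <= m * (`|t - l| + `|l|) by rewrite ler_wpM2l ?normr_ge0.
have h4 : (t - l) ^+ 2 <= pi * (t - l) ^+ 2 by rewrite ler_peMl ?sqr_ge0.
rewrite -(real_normK (num_real (t - l))) in h4 *.
have h5 := sqr_ge0 (m - 4 * `|t - l|).
clearbody m; move: (pi * `|t - l| ^+ 2) h4 => q h4.
move: h1 h2 h3 h4 h5; move: `|t| `|t - l| `|l| => a b c h1 h2 h3 h4 h5; nra.
Qed.

Lemma squareR_modulus f : csquare f -> squareR (fun t => modulus (f t)).
Proof.
move=> hf; split; first exact: measurable_modulus (csquare_measurable hf).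
by under eq_fun do rewrite modulus_sqr; exact: csquare_normsq.
Qed.

Definition windowed (l : R) f (t : R) : R[i] := (gaussian (t - l))%:C * f t.

Lemma csquare_windowed l f : csquare f -> csquare (windowed l f).
Proof.
apply: csquare_le; first exact: measurable_gaussian.
by move=> t; rewrite ger0_norm ?gaussian_le1// ltW// gaussian_gt0.
Qed.

Lemma sqnorm_windowed l f : csquare f -> sqnorm (windowed l f) <= sqnorm f.
Proof.
move=> hf; apply: le_Rint.
- exact: csquare_normsq (csquare_windowed l hf).
- exact: csquare_normsq.
move=> t; rewrite normsqM ler_piMl ?normsq_ge0// /normsq/= expr0n addr0.
by rewrite expr_le1// ?gaussian_le1// ltW// gaussian_gt0.
Qed.

Lemma windowed_linear l c f g t :
  windowed l (fun t => c * f t + g t) t = c * windowed l f t + windowed l g t.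
Proof. by rewrite /windowed mulrDr mulrCA. Qed.

Lemma windowed_ae l f g : {ae mu, forall t, f t = g t} ->
  {ae mu, forall t, windowed l f t = windowed l g t}.
Proof. by apply: ae_imp => t; rewrite /windowed => ->. Qed.

(** The Gaussian outweighs every exponential in L^2, and a product of two square integrable
    functions is integrable. *)
Lemma exp_decay_windowed l f : csquare f -> exp_decay (windowed l f).
Proof.
move=> hf; split; first exact: csquare_measurable (csquare_windowed l hf).
move=> r; have := squareR_mul (squareR_exp_gaussian r l) (squareR_modulus hf).
apply: eq_integrable => // t _ /=; rewrite modulusM modulus_real.
by rewrite (ger0_norm (ltW (gaussian_gt0 _))) mulrA.
Qed.

Lemma exp_decay_cintegrable g : exp_decay g -> cintegrable g.
Proof.
move=> hg; have := cintegrable_laplace 0 hg.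
by under eq_fun do rewrite mul0r expR0 mul1r.
Qed.

Lemma cintegrable_windowed l f : csquare f -> cintegrable (windowed l f).
Proof. by move=> hf; apply: exp_decay_cintegrable; exact: exp_decay_windowed. Qed.

Lemma fourier_integral_vertical g xi : fourier_integral g xi = vertical g (- (2 * pi * xi)).
Proof. by apply: eq_cintegral => t; rewrite mulrC mulNr. Qed.

Lemma gabor_op_ae l f : csquare f ->
  {ae mu, forall xi, gabor_op l f xi = vertical (windowed l f) (- (2 * pi * xi))}.
Proof.
move=> hf; have := fourier_L1L2 (cintegrable_windowed l hf) (csquare_windowed l hf).
by apply: ae_imp => xi; rewrite fourier_integral_vertical.
Qed.

Lemma csquare_gabor_op l f : csquare f -> csquare (gabor_op l f).
Proof. by move=> hf; apply: csquare_fourier; exact: csquare_windowed. Qed.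

(** An interval of length 2 d is contained in no null set. This turns almost everywhere equalities
    of continuous functions into equalities everywhere. *)
Lemma ae_exists (P : R -> Prop) (x d : R) : {ae mu, forall y, P y} -> 0 < d ->
  exists2 y, P y & `|y - x| <= d.
Proof.
move=> [N [mN N0 PN]] d0; apply: contrapT => nP.
have sub : `[x - d, x + d]%classic `<=` N.
  move=> y /=; rewrite in_itv/= => yx; apply: PN => Py; apply: nP; exists y => //.
  by rewrite ler_distl.
have : (mu `[(x - d)%R, (x + d)%R]%classic <= mu N)%E by apply: le_measure; rewrite ?inE.
rewrite N0 lebesgue_measure_itv/= lte_fin.
have -> : x - d < x + d by lra.
by rewrite -EFinB lee_fin; lra.
Qed.

End windowed.

(** * Phase retrieval outside arithmetic progressions *)

Section forward.
Context {R : realType}.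
Local Notation mu := (@lebesgue_measure R).
Implicit Types (f g h G H : R -> R[i]).

(** Since conj ('i ^ k) = 'i ^ k (-1) ^ k, the powers of 'i in each term of the convolution multiply
    to 'i ^ n. *)
Lemma cauchy_prod_i (m : nat -> R[i]) n :
  cauchy_prod (fun k => 'i%C ^+ k * m k) (fun k => conjc ('i%C ^+ k * m k)) n =
  'i%C ^+ n * cauchy_prod m (fun k => conjc ((-1) ^+ k * m k)) n.
Proof.
have ci k : conjc ('i%C ^+ k) = 'i%C ^+ k * (-1) ^+ k :> R[i].
  by rewrite rmorphXn /= -exprMn; congr (_ ^+ _); rewrite mulrN1; apply: complexP; rewrite !reimE /= ?oppr0.
rewrite /cauchy_prod mulr_sumr; apply: eq_bigr => j _.
have -> : 'i%C ^+ n = 'i%C ^+ j * 'i%C ^+ (n - j) :> R[i].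
  by rewrite -exprD subnKC// -ltnS.
rewrite !rmorphM/= ci !rmorphXn rmorphN1.
by rewrite -[X in _ * X]mulrA mulrACA.
Qed.

(* |vertical G|^2 and laplace G x * conj (laplace G (-x)) are the same power
   series evaluated along the two axes of the complex plane. *)
Lemma modulus_laplace G H : exp_decay G -> exp_decay H ->
  (forall y, modulus (vertical G y) = modulus (vertical H y)) ->
  forall x, laplace G x * conjc (laplace G (- x)) =
            laplace H x * conjc (laplace H (- x)).
Proof.
move=> hG hH GH.
have vP (K : R -> R[i]) : exp_decay K -> pser (fun y => (normsq (vertical K y))%:C)
    (fun n => 'i%C ^+ n * cauchy_prod (moment K) (fun k => conjc ((-1) ^+ k * moment K k)) n).
  move=> hK; have := pser_mul (vertical_pser hK) (pser_conj (vertical_pser hK)).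
  have -> : (fun x => vertical K x * conjc (vertical K x)) = fun y => (normsq (vertical K y))%:C.
    by apply/funext => y; rewrite mul_conj.
  by congr pser; apply/funext => n; exact: cauchy_prod_i.
have lP (K : R -> R[i]) : exp_decay K -> pser (fun x => laplace K x * conjc (laplace K (- x)))
    (cauchy_prod (moment K) (fun k => conjc ((-1) ^+ k * moment K k))).
  by move=> hK; exact: pser_mul (laplace_pser hK) (pser_conj (pser_opp (laplace_pser hK))).
have e : (fun y => (normsq (vertical H y))%:C) = fun y => (normsq (vertical G y))%:C.
  by apply/funext => y; have /modulus_inj -> := GH y.
have := vP H hH; rewrite e => /(pser_unique (vP G hG)) eGH.
apply: pser_ext (lP G hG) _; have := lP H hH; congr pser; apply/funext => n.
(* The factor 'i ^ n is invertible, so the two Laplace products have the same coefficients. *)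
have := congr1 (fun a => a n) eGH => /= /esym; apply: mulfI.
by rewrite expf_neq0// eq_complex /= oner_eq0 andbF.
Qed.

Lemma laplace_windowed l f x : csquare f ->
  laplace (windowed l f) x = (gaussian l)%:C * laplace (windowed 0 f) (x + 2 * pi * l).
Proof.
move=> hf; rewrite /laplace /kernel_transform.
rewrite -(cintegralZ _ (cintegrable_laplace _ (exp_decay_windowed 0 hf))).
apply: eq_cintegral => t; rewrite /windowed subr0 gaussianB (mulrDl x) expRD !realCM.
move: (expR _)%:C (expR _)%:C (gaussian l)%:C (gaussian t)%:C (f t) => a b c d e; ring.
Qed.

Lemma entire_laplace g : exp_decay g -> entire (laplace g).
Proof.
move=> hg d; eexists; apply: eq_pser (laplace_pser (exp_decay_expR d hg)) => x.
by rewrite laplace_shift.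
Qed.

(** Vanishing on the real axis kills all moments, hence the transform on the imaginary axis, which
    is the Fourier integral; Plancherel concludes. *)
Lemma laplace_eq0 g : exp_decay g -> csquare g -> (forall x, laplace g x = 0) ->
  {ae mu, forall t, g t = 0}.
Proof.
move=> hg g2 g0; apply: sqnorm_eq0 => //.
have m0 : moment g = fun=> 0.
  apply: pser_unique (laplace_pser hg) _.
  by have -> : laplace g = fun=> 0; [exact/funext|exact: pser_cst0].
have v0 : forall y, vertical g y = 0.
  apply: pser_eq0; have := vertical_pser hg; rewrite m0.
  by congr pser; apply/funext => k; rewrite mulr0.
rewrite -(plancherel_L1L2 (exp_decay_cintegrable hg) g2) -[RHS](@sqnorm0 R).
by apply: eq_sqnorm => xi; rewrite fourier_integral_vertical v0.
Qed.

(** The equality of moduli holds on a dense set by [ae_exists], and both sides are continuous in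
    y. *)
Lemma vertical_modulus_eq l f h : csquare f -> csquare h ->
  {ae mu, forall xi, modulus (gabor_op l f xi) = modulus (gabor_op l h xi)} ->
  forall y, modulus (vertical (windowed l f) y) = modulus (vertical (windowed l h) y).
Proof.
move=> hf hh fh y.
have : {ae mu, forall xi, modulus (vertical (windowed l f) (- (2 * pi * xi))) =
    modulus (vertical (windowed l h) (- (2 * pi * xi)))}.
  have W : {ae mu, forall xi, modulus (vertical (windowed l f) (- (2 * pi * xi))) =
      modulus (gabor_op l h xi)} by apply: ae_imp2 (gabor_op_ae l hf) fh => xi ->.
  by apply: ae_imp2 (gabor_op_ae l hh) W => xi ->.
move=> V.
have tri (a b : R[i]) : modulus a <= modulus b + modulus (a - b).
  by rewrite -[X in modulus X <= _](subrK b) addrC modulusD.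
have hw k := exp_decay_windowed l k.
suff small (e : R) : 0 < e -> `|modulus (vertical (windowed l f) y) -
    modulus (vertical (windowed l h) y)| <= e.
  by apply/eqP; rewrite -subr_eq0 -normr_le0; apply/ler_addgt0Pr => e e0; rewrite add0r small.
move=> e0; have e2 : 0 < e / 2 by rewrite divr_gt0.
have [d1 d10 h1] := vertical_continuous y (hw f hf) e2.
have [d2 d20 h2] := vertical_continuous y (hw h hh) e2.
have p0 : 0 < 2 * pi :> R by rewrite mulr_gt0// pi_gt0.
have d0 : 0 < Num.min d1 d2 / (2 * pi) by rewrite divr_gt0// lt_min d10.
have [xi Vxi xid] := ae_exists (- y / (2 * pi)) V d0.
have : `|- (2 * pi * xi) - y| <= Num.min d1 d2.
  move: xid; rewrite ler_pdivlMr// -[X in _ * X]gtr0_norm// -normrM mulrBl mulfVK ?gt_eqF//.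
  by rewrite -normrN; congr (`|_| <= _); ring.
rewrite le_min => /andP[/h1 a1 /h2 a2].
have := tri (vertical (windowed l f) y) (vertical (windowed l f) (- (2 * pi * xi))).
have := tri (vertical (windowed l f) (- (2 * pi * xi))) (vertical (windowed l f) y).
have := tri (vertical (windowed l h) y) (vertical (windowed l h) (- (2 * pi * xi))).
have := tri (vertical (windowed l h) (- (2 * pi * xi))) (vertical (windowed l h) y).
rewrite -(modulusN (vertical _ y - _)) opprB -(modulusN (vertical (windowed l f) y - _)) opprB.
move: Vxi a1 a2; rewrite ler_distl.
move: (modulus _) (modulus _) (modulus _) (modulus _) (modulus _) (modulus _).
by move=> *; lra.
Qed.

Lemma mul2_cancel (K : idomainType) (c a b p q : K) : c != 0 ->
  c * a * (c * b) = c * p * (c * q) -> a * b = p * q.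
Proof. by move=> c0; rewrite (mulrACA c a) (mulrACA c p) => /mulfI; apply; exact: mulf_neq0. Qed.

Lemma gabor_retrieval (Lambda : set R) f h : csquare f -> csquare h ->
  ~ (exists A : set R, arithmetic_progression A /\ Lambda `<=` A) ->
  (forall l, Lambda l ->
    {ae mu, forall xi, modulus (gabor_op l f xi) = modulus (gabor_op l h xi)}) ->
  equiv_phase f h.
Proof.
move=> hf hh nAP fh.
have df := exp_decay_windowed 0 hf; have dh := exp_decay_windowed 0 hh.
have [l Ll x|tau [t1 Ft]] := entire_phase (entire_laplace df) (entire_laplace dh) _ nAP.
  have := modulus_laplace (exp_decay_windowed l hf) (exp_decay_windowed l hh)
    (vertical_modulus_eq hf hh (fh l Ll)) x.
  rewrite (laplace_windowed l x hf) (laplace_windowed l (- x) hf).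
  rewrite (laplace_windowed l x hh) (laplace_windowed l (- x) hh).
  have c0 : (gaussian l)%:C != 0 by rewrite eq_complex /= gt_eqF// gaussian_gt0.
  have cm (a : R[i]) : conjc ((gaussian l)%:C * a) = (gaussian l)%:C * conjc a.
    by apply: complexP; rewrite !reimE; ring.
  rewrite !cm; move: (gaussian l)%:C c0 => c c0.
  move: (laplace _ _) (conjc _) (laplace _ _) (conjc _) => a b p q.
  exact: mul2_cancel.
exists tau; split=> //.
(* The window at 0 of f - tau h has vanishing Laplace transform, and the Gaussian factor is nowhere
   zero. *)
have hg : csquare (fun t => - tau * h t + f t) by apply: csquareD => //; exact: csquareZ.
have := laplace_eq0 (exp_decay_windowed 0 hg) (csquare_windowed 0 hg).
have lg x : laplace (windowed 0 (fun t => - tau * h t + f t)) x = 0.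
  rewrite /laplace /kernel_transform.
  have -> : cintegral (fun t => (expR (x * t))%:C * windowed 0 (fun t => - tau * h t + f t) t) =
      - tau * laplace (windowed 0 h) x + laplace (windowed 0 f) x.
    have i1 := cintegrable_laplace x dh; have i2 := cintegrable_laplace x df.
    rewrite -(cintegralZ (- tau) i1) -cintegralD//; last exact: cintegrableZ.
    by apply: eq_cintegral => t; rewrite windowed_linear mulrDr mulrCA.
  by rewrite Ft mulNr addNr.
move=> /(_ lg); apply: ae_imp => t /eqP; rewrite mulf_eq0 eq_complex /=.
by rewrite gt_eqF ?gaussian_gt0//= addrC mulNr subr_eq0 => /eqP.
Qed.

End forward.

(** * Arithmetic progressions *)

Section converse.
Context {R : realType}.
Local Notation mu := (@lebesgue_measure R).
Implicit Types (f g h : R -> R[i]).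

Lemma cintegral_sub (b : R) f : cintegrable f ->
  cintegral (fun t => f (b - t)) = cintegral f.
Proof.
move=> [f1 f2]; apply: complexP; rewrite ?re_cintegral ?im_cintegral.
  exact: (Rint_sub b f1).
exact: (Rint_sub b f2).
Qed.

(** Reflection and conjugation each reverse the frequency, so together they keep it; what remains is
    a conjugation and a unimodular factor, invisible to the modulus. *)
Lemma fourier_integral_conj_sub (b : R) g xi : cintegrable g ->
  fourier_integral (fun t => conjc (g (b - t))) xi =
  expi (- (2 * pi * xi * b)) * conjc (fourier_integral g xi).
Proof.
move=> hg; have hk := cintegrable_expi (- (2 * pi * xi)) hg.
have hc := cintegrable_conj hk.
rewrite fourier_integralE (fourier_integralE g) -(cintegral_conj hk) -(cintegralZ _ hc).
rewrite -(cintegral_sub b (cintegrableZ _ hc)); apply: eq_cintegral => t.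
have cM (z w : R[i]) : conjc (z * w) = conjc z * conjc w.
  by apply: complexP; rewrite !reimE; ring.
rewrite cM conj_expi mulrCA -expiD; congr (_ * expi _).
by move: pi => p; ring.
Qed.

Lemma expi_int (n : int) : expi (2 * pi * n%:~R) = 1 :> R[i].
Proof.
have nat_case k : expi (2 * pi * k%:R) = 1 :> R[i].
  elim: k => [|k IH]; first by rewrite mulr0 expi0.
  have -> : 2 * pi * k.+1%:R = 2 * pi * k%:R + pi *+ 2 :> R.
    by rewrite -natr1; move: pi => p; ring.
  by rewrite expiD IH mul1r /expi cos2pi sin2pi.
case: n => k; first exact: nat_case.
rewrite NegzE mulrNz mulrN -conj_expi nat_case.
by apply: complexP; rewrite /= ?oppr0.
Qed.

Lemma normsq_1expi (x : R) : normsq (1 + expi x) = 2 + 2 * cos x.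
Proof.
have -> : normsq (1 + expi x) = 1 + 2 * cos x + (cos x ^+ 2 + sin x ^+ 2).
  by rewrite /normsq !reimE /=; ring.
by rewrite cos2Dsin2; ring.
Qed.

Section counterexample.
Variables (a b : R) (a0 : a != 0).

(** Chosen so that [phase] (a n + b - t) = 2 pi n - [phase] t: reflection through any point of the
    progression reverses the phase modulo 2 pi. *)
Let phase (t : R) : R := (2 * t - b) * pi / a.

Let F (s t : R) : R[i] := (gaussian t)%:C * (1 + expi (s + phase t)).

Let csquare_F s : csquare (F s).
Proof.
have sg : squareR (@gaussian R).
  have := squareR_exp_gaussian (0 : R) 0.
  by under eq_fun do rewrite mul0r expR0 mul1r subr0.
have mg : measurable_fun [set: R] (@gaussian R) by case: sg.
have mp : measurable_fun [set: R] (fun t => s + phase t).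
  apply: measurable_funD => //; apply: measurable_funM => //.
  by apply: measurable_funM => //; apply: measurable_funB => //; exact: measurable_mulc.
have [mc ms] := cmeasurable_expi mp.
have h (k : R -> R) : measurable_fun [set: R] k -> (forall t, `|k t| <= 1) ->
    squareR (fun t => gaussian t * k t).
  move=> mk k1; apply: squareR_le sg; first exact: measurable_funM.
  by move=> t; rewrite normrM ler_piMr.
apply: (@eq_csquare _ (fun t => (gaussian t)%:C + (gaussian t)%:C * expi (s + phase t))).
  by move=> t; rewrite /F mulrDr mulr1.
have sz : squareR (fun=> 0 : R).
  by have := squareRZ 0 sg; under eq_fun do rewrite mul0r.
apply: csquareD; split=> //; under eq_fun do rewrite !reimE mul0r ?subr0 ?addr0.
  by apply: h => // t; exact: cos_norm.
by apply: h => // t; exact: sin_norm.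
Qed.

Let conj_F s (n : int) t : conjc (F s (a * n%:~R + b - t)) =
  (gaussian (t - (a * n%:~R + b)))%:C * (1 + expi (- s + phase t)).
Proof.
have -> : - s + phase t = - (s + phase (a * n%:~R + b - t)) + 2 * pi * n%:~R.
  by rewrite /phase; move: pi => p; field.
rewrite expiD expi_int mulr1 -conj_expi /F.
have -> : gaussian (t - (a * n%:~R + b)) = gaussian (a * n%:~R + b - t).
  by rewrite /gaussian -[X in X ^+ 2]opprB sqrrN.
by apply: complexP; rewrite !reimE /=; ring.
Qed.

(** The weight gaussian (t - l) gaussian (t) is invariant under t |-> l - t, while reflection and
    conjugation together keep [phase] and change s into - s. *)
Let windowed_F s (n : int) t :
  windowed (a * n%:~R + b) (F (- s)) t =
  conjc (windowed (a * n%:~R + b) (F s) (a * n%:~R + b - t)).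
Proof.
rewrite /windowed; set l := a * n%:~R + b.
have -> : l - t - l = - t by ring.
have -> : conjc ((gaussian (- t))%:C * F s (l - t)) = (gaussian t)%:C * conjc (F s (l - t)).
  by rewrite /gaussian sqrrN; apply: complexP; rewrite !reimE /=; ring.
by rewrite conj_F /F mulrCA.
Qed.

Let gabor_op_F s (n : int) :
  {ae mu, forall xi, modulus (gabor_op (a * n%:~R + b) (F s) xi) =
                     modulus (gabor_op (a * n%:~R + b) (F (- s)) xi)}.
Proof.
set l := a * n%:~R + b.
have Fi k := cintegrable_windowed l (csquare_F k).
have Fs k := csquare_windowed l (csquare_F k).
apply: ae_imp2 (fourier_L1L2 (Fi s) (Fs s)) (fourier_L1L2 (Fi (- s)) (Fs (- s))).
move=> xi; rewrite /gabor_op -!/(windowed _ _) => -> ->.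
have -> : windowed l (F (- s)) = fun t => conjc (windowed l (F s) (l - t)).
  by apply/funext => t; exact: windowed_F.
by rewrite fourier_integral_conj_sub// modulusM expi_modulus mul1r modulus_conj.
Qed.

(** Already the moduli differ: |1 +- i exp (i phase)|^2 = 2 -+ 2 sin (phase), so equivalence would
    make the sine of the phase vanish almost everywhere. *)
Let not_equiv_F : ~ equiv_phase (F (pi / 2)) (F (- (pi / 2))).
Proof.
move=> [tau [t1 FF]].
have S0 : {ae mu, forall t, sin (phase t) = 0}.
  apply: ae_imp FF => t /(congr1 normsq).
  rewrite /F !normsqM !normsq_1expi -(modulus_sqr tau) t1 expr1n mul1r.
  rewrite !cosD cosN sinN cos_pihalf sin_pihalf => /mulfI h.
  have : 2 + 2 * (0 * cos (phase t) - 1 * sin (phase t)) =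
    2 + 2 * (0 * cos (phase t) - - 1 * sin (phase t)).
    apply: h; rewrite /normsq/= expr0n addr0 expf_neq0//.
    by rewrite gt_eqF// gaussian_gt0.
  by move: (sin _) (cos _) => u v; lra.
have p2 : 2 <= pi :> R := pi_ge2 R.
have p0 : 0 < pi :> R := pi_gt0 R.
have d0 : 0 < `|a| / (4 * pi) by rewrite divr_gt0 ?normr_gt0// mulr_gt0.
(* At (a / 2 + b) / 2 the phase is pi / 2, and within |a| / (4 pi) it moves by at most 1/2, so it
   stays between 0 and pi. *)
have [t ht td] := ae_exists ((a / 2 + b) / 2) S0 d0.
have : 0 < sin (phase t).
  have : `|phase t - pi / 2| <= 1 / 2.
    have -> : phase t - pi / 2 = 2 * pi / a * (t - (a / 2 + b) / 2).
      by rewrite /phase; move: pi => p; field.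
    rewrite normrM; apply: le_trans (_ : `|2 * pi / a| * (`|a| / (4 * pi)) <= _).
      by rewrite ler_wpM2l.
    rewrite normrM normfV (gtr0_norm (mulr_gt0 _ p0))//.
    have : `|a| != 0 by rewrite normr_eq0.
    have : pi != 0 :> R by rewrite gt_eqF.
    by move: (@pi R) `|a| => p x px x0; rewrite le_eqVlt; apply/orP; left; apply/eqP; field; apply/andP.
  rewrite ler_distl => /andP[h1 h2]; apply: sin_gt0_pi; apply/andP; split; lra.
by rewrite ht ltxx.
Qed.

Lemma gabor_counterexample : exists f h, [/\ csquare f, csquare h,
  forall n : int, {ae mu, forall xi, modulus (gabor_op (a * n%:~R + b) f xi) =
                                     modulus (gabor_op (a * n%:~R + b) h xi)} &
  ~ equiv_phase f h].
Proof.
exists (F (pi / 2)), (F (- (pi / 2))); split => // n; exact: gabor_op_F.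
Qed.

End counterexample.

Lemma gabor_phase_retrieval (Lambda : set R) :
  phase_retrieval [set gabor_op lambda | lambda in Lambda] <->
  ~ (exists A : set R, arithmetic_progression A /\ Lambda `<=` A).
Proof.
split=> [PR [A [[a [b AE]] LA]]|nAP f h /inL2P hf /inL2P hh fh].
  have [a' [a'0 LA']] : exists a', a' != 0 /\
      forall l, Lambda l -> exists n : int, l = a' * n%:~R + b.
    have [az|an] := eqVneq a 0; last first.
      by exists a; split=> // l /LA; rewrite AE => -[n _ <-]; exists n.
    (* For a = 0 the progression is the single point b, which lies in Z + b. *)
    exists 1; split; first exact: oner_neq0.
    by move=> l /LA; rewrite AE => -[n _ <-]; exists 0; rewrite az mul0r mulr0.
  have [f [h [hf hh fh]]] := gabor_counterexample b a'0; apply.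
  apply: PR; [exact/inL2P|exact/inL2P|].
  by move=> T [l Ll <-]; have [n ->] := LA' l Ll; exact: fh.
apply: gabor_retrieval nAP _ => // l Ll; apply: fh; by exists l.
Qed.

End converse.

(** * The operators and the three-point criterion *)

Section operators.
Context {R : realType}.
Local Notation mu := (@lebesgue_measure R).
Implicit Types (f g h : R -> R[i]).

(** c f is written as (c - 1) f + f, which has the shape of [fourier_linear]. *)
Lemma fourierZ c f : csquare f ->
  {ae mu, forall x, fourier (fun t => c * f t) x = c * fourier f x}.
Proof.
move=> hf; have := fourier_linear (c - 1) hf hf; apply: ae_imp => x.
have -> : (fun t => (c - 1) * f t + f t) = fun t => c * f t.
  by apply/funext => t; rewrite mulrBl mul1r subrK.
by move=> ->; rewrite mulrBl mul1r subrK.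
Qed.

Lemma cinner_ae f f' g g' : csquare f -> csquare f' -> csquare g -> csquare g' ->
  {ae mu, forall t, f t = f' t} -> {ae mu, forall t, g t = g' t} ->
  cinner f g = cinner f' g'.
Proof.
move=> hf hf' hg hg' ff gg.
have m (k z : R -> R[i]) : csquare k -> csquare z -> cmeasurable (fun t => k t * conjc (z t)).
  move=> /csquare_measurable mk /csquare_conj /csquare_measurable mz.
  exact: cmeasurableM.
have [m1 m2] := m _ _ hf hg; have [m3 m4] := m _ _ hf' hg'.
have e : {ae mu, forall t, f t * conjc (g t) = f' t * conjc (g' t)}.
  by apply: ae_imp2 ff gg => t -> ->.
apply: complexP; rewrite ?re_cintegral ?im_cintegral; apply: Rint_ae_eq => //.
  by apply: ae_imp e => t ->.
by apply: ae_imp e => t ->.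
Qed.

Lemma cinner_rinner f g :
  cinner f g = rinner f g +i* rinner f (fun t => 'i%C * g t).
Proof.
apply: complexP; rewrite ?re_cintegral ?im_cintegral; apply: eq_Rint => t.
  by rewrite !reimE; ring.
by rewrite !reimE /= !mul0r !mul1r; ring.
Qed.

Lemma cinner_fourier f g : csquare f -> csquare g ->
  cinner (fourier f) (fourier g) = cinner f g.
Proof.
move=> hf hg; rewrite !cinner_rinner rinner_fourier//; congr (_ +i* _).
have hig : csquare (fun t => 'i%C * g t) by exact: csquareZ.
rewrite -(rinner_fourier hf hig).
have [m1 m2] := csquare_measurable (csquare_fourier hf).
have [m3 m4] := csquare_measurable (csquareZ 'i%C (csquare_fourier hg)).
have [m5 m6] := csquare_measurable (csquare_fourier hig).
apply: Rint_ae_eq.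
- by apply: measurable_funD; exact: measurable_funM.
- by apply: measurable_funD; exact: measurable_funM.
by apply: ae_imp (fourierZ 'i%C hg) => t ->.
Qed.

Lemma gabor_op_ae_eq l f g : csquare f -> csquare g -> {ae mu, forall t, f t = g t} ->
  {ae mu, forall x, gabor_op l f x = gabor_op l g x}.
Proof.
move=> hf hg fg; apply: fourier_ae (windowed_ae l fg); exact: csquare_windowed.
Qed.

Lemma gabor_op_linear l c f g : csquare f -> csquare g ->
  {ae mu, forall x, gabor_op l (fun t => c * f t + g t) x =
                    c * gabor_op l f x + gabor_op l g x}.
Proof.
move=> hf hg; rewrite /gabor_op.
have -> : (fun t => (gaussian (t - l))%:C * (c * f t + g t)) =
    fun t => c * windowed l f t + windowed l g t.
  by apply/funext => t; exact: windowed_linear.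
by apply: fourier_linear; exact: csquare_windowed.
Qed.

Lemma bounded_operatorP (T : (R -> R[i]) -> (R -> R[i])) :
  (forall f, csquare f -> csquare (T f)) ->
  (forall c f g, csquare f -> csquare g ->
    {ae mu, forall x, T (fun t => c * f t + g t) x = c * T f x + T g x}) ->
  (forall f, csquare f -> sqnorm (T f) <= sqnorm f) ->
  bounded_operator T.
Proof.
move=> T2 Tlin Tle; split.
- by move=> f /inL2P hf; apply/inL2P; exact: T2.
- by move=> c f g /inL2P hf /inL2P hg; exact: Tlin.
exists 1 => f /inL2P hf; rewrite mul1e !cLnorm2E//; last exact: T2.
by rewrite lee_fin ler_wsqrtr// Tle.
Qed.

Lemma sqnorm_gabor_op l f : csquare f -> sqnorm (gabor_op l f) <= sqnorm f.
Proof.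
move=> hf; rewrite /gabor_op sqnorm_fourier; last exact: (csquare_windowed l hf).
exact: sqnorm_windowed.
Qed.

Lemma bounded_gabor_op l : bounded_operator (@gabor_op R l).
Proof.
apply: bounded_operatorP; first by move=> f; exact: csquare_gabor_op.
  by move=> c f g; exact: gabor_op_linear.
by move=> f; exact: sqnorm_gabor_op.
Qed.

Lemma csquare_fourier_inv f : csquare f -> csquare (fourier_inv f).
Proof. by move=> /fourier_invP[]. Qed.

Lemma fourier_fourier_inv f : csquare f ->
  {ae mu, forall x, fourier (fourier_inv f) x = f x}.
Proof. by move=> /fourier_invP[]. Qed.

Lemma sqnorm_fourier_inv f : csquare f -> sqnorm (fourier_inv f) = sqnorm f.
Proof.
move=> hf; have hi := csquare_fourier_inv hf; rewrite -(sqnorm_fourier hi).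
by apply: cmeasurable_ae_sqnorm => //; [exact: csquare_fourier|exact: fourier_fourier_inv].
Qed.

Lemma fourier_inv_linear c f g : csquare f -> csquare g ->
  {ae mu, forall x, fourier_inv (fun t => c * f t + g t) x =
                    c * fourier_inv f x + fourier_inv g x}.
Proof.
move=> hf hg; have hif := csquare_fourier_inv hf; have hig := csquare_fourier_inv hg.
have hl : csquare (fun t => c * f t + g t) by apply: csquareD => //; exact: csquareZ.
apply: fourier_inj.
- exact: csquare_fourier_inv.
- by apply: csquareD => //; exact: csquareZ.
have h : {ae mu, forall x, fourier (fun t => c * fourier_inv f t + fourier_inv g t) x =
    c * f x + fourier (fourier_inv g) x}.
  by apply: ae_imp2 (fourier_linear c hif hig) (fourier_fourier_inv hf) => x -> ->.
have h' : {ae mu, forall x, fourier (fun t => c * fourier_inv f t + fourier_inv g t) x =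
    c * f x + g x}.
  by apply: ae_imp2 h (fourier_fourier_inv hg) => x -> ->.
by apply: ae_imp2 h' (fourier_fourier_inv hl) => x -> ->.
Qed.

Lemma cinner_windowed l f g : cinner (windowed l f) g = cinner f (windowed l g).
Proof.
apply: eq_cintegral => t; rewrite /windowed; move: (gaussian _) => c.
by apply: complexP; rewrite !reimE; ring.
Qed.

(** The operator is F M F^-1 with F unitary and M the multiplication by a real function. *)
Lemma self_adjoint_gabor_op l : self_adjoint (gabor_op l \o @fourier_inv R).
Proof.
split.
  apply: bounded_operatorP => [f hf|c f g hf hg|f hf] /=.
  - by apply: csquare_gabor_op; exact: csquare_fourier_inv.
  - have hif := csquare_fourier_inv hf; have hig := csquare_fourier_inv hg.
    have h2 : csquare (fun t => c * fourier_inv f t + fourier_inv g t).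
      by apply: csquareD => //; exact: csquareZ.
    have h1 : csquare (fourier_inv (fun t => c * f t + g t)).
      by apply: csquare_fourier_inv; apply: csquareD => //; exact: csquareZ.
    apply: ae_imp2 (gabor_op_ae_eq l h1 h2 (fourier_inv_linear c hf hg))
      (gabor_op_linear l c hif hig) => x -> ->.
    by [].
  - rewrite -(sqnorm_fourier_inv hf); apply: sqnorm_gabor_op.
    exact: csquare_fourier_inv.
move=> f g /inL2P hf /inL2P hg /=.
have hif := csquare_fourier_inv hf; have hig := csquare_fourier_inv hg.
have gf := csquare_gabor_op l hif; have gg := csquare_gabor_op l hig.
have same k : {ae mu, forall x, k x = k x :> R[i]} by exact: ae_all.
have invg : {ae mu, forall x, g x = fourier (fourier_inv g) x}.
  by apply: ae_imp (fourier_fourier_inv hg) => x ->.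
rewrite (cinner_ae gf gf hg (csquare_fourier hig) (same _) invg).
rewrite -(cinner_ae (csquare_fourier hif) hf gg gg (fourier_fourier_inv hf) (same _)).
rewrite (cinner_fourier (csquare_windowed l hif) hig).
by rewrite (cinner_fourier hif (csquare_windowed l hig)) cinner_windowed.
Qed.

(** The families differ by precomposition with a unitary map; its linearity carries the unimodular
    factor tau in both directions. *)
Lemma phase_retrieval_fourier_inv (Lambda : set R) :
  phase_retrieval [set gabor_op l \o fourier_inv | l in Lambda] <->
  phase_retrieval [set gabor_op l | l in Lambda].
Proof.
split=> PR f h /inL2P hf /inL2P hh fh.
  have Ff := csquare_fourier hf; have Fh := csquare_fourier hh.
  have [|tau [t1 tE]] := PR (fourier f) (fourier h) ((inL2P _).2 Ff) ((inL2P _).2 Fh).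
    move=> T [l Ll <-] /=.
    have e k : csquare k ->
        {ae mu, forall x, gabor_op l (fourier_inv (fourier k)) x = gabor_op l k x}.
      move=> hk; apply: gabor_op_ae_eq (fourier_invK hk) => //.
      by apply: csquare_fourier_inv; exact: csquare_fourier.
    have fhl := fh _ (ex_intro2 _ _ l Ll erefl).
    have h1 : {ae mu, forall x, modulus (gabor_op l (fourier_inv (fourier f)) x) =
        modulus (gabor_op l h x)} by apply: ae_imp2 (e f hf) fhl => x ->.
    by apply: ae_imp2 (e h hh) h1 => x -> ->.
  exists tau; split=> //; apply: fourier_inj => //; first exact: csquareZ.
  by apply: ae_imp2 tE (fourierZ tau hh) => x -> ->.
have hif := csquare_fourier_inv hf; have hih := csquare_fourier_inv hh.
have [|tau [t1 tE]] := PR (fourier_inv f) (fourier_inv h) ((inL2P _).2 hif) ((inL2P _).2 hih).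
  by move=> T [l Ll <-]; apply: (fh (gabor_op l \o fourier_inv)); exists l.
exists tau; split=> //.
have e1 := fourier_ae hif (csquareZ tau hih) tE.
have e2 : {ae mu, forall x, f x = fourier (fun t => tau * fourier_inv h t) x}.
  by apply: ae_imp2 (fourier_fourier_inv hf) e1 => x <- ->.
have e3 : {ae mu, forall x, f x = tau * fourier (fourier_inv h) x}.
  by apply: ae_imp2 e2 (fourierZ tau hih) => x -> ->.
by apply: ae_imp2 e3 (fourier_fourier_inv hh) => x -> ->.
Qed.

Lemma arithmetic_progression3 (alpha beta gamma : R) : alpha < beta -> beta < gamma ->
  (exists A : set R, arithmetic_progression A /\ [set alpha; beta; gamma] `<=` A) <->
  rational ((beta - alpha) / (gamma - beta)).
Proof.
move=> ab bg; have gb0 : gamma - beta != 0 by rewrite subr_eq0 gt_eqF.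
split=> [[A [[a [b ->]] sub]]|/rationalP[p [q pq]]].
  have [n1 _ e1] := sub alpha (or_introl (or_introl erefl)).
  have [n2 _ e2] := sub beta (or_introl (or_intror erefl)).
  have [n3 _ e3] := sub gamma (or_intror erefl).
  exists ((n2 - n1)%:~R / (n3 - n2)%:~R) => //.
  rewrite fmorph_div/= !ratr_int.
  have ba : beta - alpha = a * (n2 - n1)%:~R by rewrite intrB -e1 -e2; ring.
  have gb : gamma - beta = a * (n3 - n2)%:~R by rewrite intrB -e2 -e3; ring.
  have a0 : a != 0 by apply: contraNneq gb0 => a0; rewrite gb a0 mul0r.
  by rewrite ba gb -mulf_div divff// mul1r.
(* With q = 0 the quotient would be 0, as the inverse of 0 is 0 by convention, against alpha <
   beta. *)
have q0 : q%:R != 0 :> R.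
  apply/eqP => q0; move: pq; rewrite q0 invr0 mulr0 => /eqP.
  by rewrite mulf_eq0 invr_eq0 (negPf gb0) orbF subr_eq0 gt_eqF.
(* Counted from beta in steps of (gamma - beta) / q, the points alpha, beta and gamma have the
   indices - p, 0 and q. *)
exists [set (gamma - beta) / q%:R * n%:~R + beta | n in [set: int]].
split; first by exists ((gamma - beta) / q%:R), beta.
have {}pq : beta - alpha = p%:~R / q%:R * (gamma - beta) by rewrite -pq mulfVK.
move=> _ [[]|] ->.
- exists (- p) => //; rewrite intrN mulrN.
  have -> : (gamma - beta) / q%:R * p%:~R = beta - alpha by rewrite pq; ring.
  by ring.
- by exists 0 => //; rewrite mulr0 add0r.
- by exists (Posz q) => //; rewrite mulfVK// subrK.
Qed.

End operators.

Theorem theorem1p5 (R : realType) (Lambda : set R) :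
  (forall lambda : R, bounded_operator (gabor_op lambda)) /\
  (phase_retrieval [set gabor_op lambda | lambda in Lambda] <->
   ~ (exists A : set R, arithmetic_progression A /\ Lambda `<=` A)) /\
  (forall alpha beta gamma : R, alpha < beta -> beta < gamma ->
   [/\ self_adjoint (gabor_op alpha \o fourier_inv),
       self_adjoint (gabor_op beta \o fourier_inv),
       self_adjoint (gabor_op gamma \o fourier_inv)
     & phase_retrieval [set gabor_op alpha \o fourier_inv;
                            gabor_op beta \o fourier_inv;
                            gabor_op gamma \o fourier_inv] <->
       ~ rational ((beta - alpha) / (gamma - beta))]).
Proof.
split; first by move=> l; exact: bounded_gabor_op.
split; first exact: gabor_phase_retrieval.
move=> alpha beta gamma ab bg; split; try exact: self_adjoint_gabor_op.
have -> : [set gabor_op alpha \o fourier_inv; gabor_op beta \o fourier_inv;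
    gabor_op gamma \o fourier_inv] =
    [set gabor_op l \o fourier_inv | l in [set alpha; beta; gamma]].
  by rewrite !image_setU !image_set1.
rewrite phase_retrieval_fourier_inv gabor_phase_retrieval.
by rewrite (arithmetic_progression3 ab bg).
Qed.
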